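(* Let $\alpha\in\mathbb{R}$, let $\kappa\in\mathbb{N}_0\cup\{\infty\}$, let $(s_j)_{j=0}^{\kappa}$ be a sequence of complex $q\times q$ matrices, and let $m\in\{0,1,\dots,\kappa\}$. Further, let $\mathcal{D}$ be a discrete subset of $\Pi_+$ and let $F\colon\Pi_+\setminus\mathcal{D}\to\mathbb{C}^{q\times q}$ be a holomorphic matrix-valued function such that \[ P_m^{[F]}(z)\succeq 0\quad\text{and}\quad P_{m-1}^{[F]}(z)\succeq 0\qquad\text{for each }z\in\Pi_+\setminus\mathcal{D}. \] Then there exists a unique $S\in\mathcal{S}_{0,q,[\alpha,\infty)}$ such that the restriction of $S$ to $\Pi_+\setminus\mathcal{D}$ equals $F$. Moreover, the inequality $P_k^{[S]}(z)\succeq 0$ holds true for each $k\in\{-1,0,\dots,m\}$ and each $z\in\mathbb{C}\setminus\mathbb{R}$.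
   Context: Notation: $q$ is a positive integer, $\Pi_+=\{z\in\mathbb{C}:\operatorname{Im}z>0\}$, $I_q$ is the identity matrix, $A^*$ the adjoint of $A$, and $A\succeq 0$ means that $A$ is nonnegative Hermitian. For a sequence $(s_j)_{j=0}^{\kappa}$ of complex $q\times q$ matrices and $\alpha\in\mathbb{R}$ set $s_{-1}:=0_{q\times q}$, $s_{\alpha\triangleright j}:=-\alpha s_j+s_{j+1}$, $H_n:=[s_{j+k}]_{j,k=0}^n$ (for $2n\le\kappa$), $H_{\alpha\triangleright n}:=[s_{\alpha\triangleright j+k}]_{j,k=0}^n$ (for $2n+1\le\kappa$), $y_{0,n}:=\operatorname{col}(s_j)_{j=0}^n$, $u_n:=-\operatorname{col}(s_{j-1})_{j=0}^n$, $T_{q,n}:=[\delta_{j,k+1}I_q]_{j,k=0}^n$, $v_{q,n}:=\operatorname{col}(\delta_{j,0}I_q)_{j=0}^n$ and $R_{T_{q,n}}(z):=(I_{(n+1)q}-zT_{q,n})^{-1}$. For a subset $\mathcal{G}\subseteq\mathbb{C}$ with $\mathcal{G}\setminus\mathbb{R}\ne\emptyset$ and $f\colon\mathcal{G}\to\mathbb{C}^{q\times q}$ and $z\in\mathcal{G}\setminus\mathbb{R}$ define \[ P_{2n}^{[f]}(z):=\begin{bmatrix}H_n & R_{T_{q,n}}(z)[v_{q,n}f(z)-u_n]\\ \big(R_{T_{q,n}}(z)[v_{q,n}f(z)-u_n]\big)^* & \frac{f(z)-f^*(z)}{z-\bar z}\end{bmatrix}\quad(2n\le\kappa), \] \[ P_{2n+1}^{[f]}(z):=\begin{bmatrix}H_{\alpha\triangleright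 n} & B(z)\\ B(z)^* & \frac{(z-\alpha)f(z)-[(z-\alpha)f(z)]^*}{z-\bar z}\end{bmatrix},\ B(z):=R_{T_{q,n}}(z)\big(v_{q,n}(z-\alpha)f(z)-(-\alpha u_n-y_{0,n})\big)\quad(2n+1\le\kappa), \] and $P_{-1}^{[f]}(z):=\frac{(z-\alpha)f(z)-[(z-\alpha)f(z)]^*}{z-\bar z}$. The class $\mathcal{S}_{0,q,[\alpha,\infty)}$ consists of all $S\colon\mathbb{C}\setminus[\alpha,\infty)\to\mathbb{C}^{q\times q}$ holomorphic in $\mathbb{C}\setminus[\alpha,\infty)$ with $\operatorname{Im}S(z)\succeq0$ for all $z\in\Pi_+$, $S(x)\succeq 0$ for all $x\in(-\infty,\alpha)$, and $\sup_{y\in[1,\infty)}y\|S(iy)\|<\infty$ (operator norm). *)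

(* Defs.v *)
From HB Require Import structures.
From mathcomp Require Import all_boot all_order all_algebra.
From mathcomp Require Import all_classical all_reals all_analysis.
From mathcomp Require Import complex.
Set Implicit Arguments.
Unset Strict Implicit.
Unset Printing Implicit Defensive.
Import Order.TTheory GRing.Theory Num.Theory.
Import numFieldNormedType.Exports.
Local Open Scope ring_scope.
Local Open Scope classical_set_scope.

Section Defs.
Variable R : realType.
Local Notation C := R[i].

Definition rC (x : R) : C := Complex x 0.

Definition adjmx m n (A : 'M[C]_(m, n)) : 'M[C]_(n, m) := (map_mx conjc A)^T.

Definition psd n (A : 'M[C]_n) : Prop :=
  adjmx A = A /\ forall v : 'cV[C]_n, 0 <= (adjmx v *m A *m v) 0 0.

Definition ImM n (A : 'M[C]_n) : 'M[C]_n := (2 * Complex 0 1)^-1 *: (A - adjmx A).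

Definition mxget m n (A : 'M[C]_(m, n)) (a b : nat) : C :=
  match (insub a : option 'I_m), (insub b : option 'I_n) with
  | Some i, Some j => A i j
  | _, _ => 0
  end.

Variable q : nat.

Definition blkmx n (B : nat -> nat -> 'M[C]_q) : 'M[C]_(n.+1 * q) :=
  \matrix_(i, j) mxget (B (i %/ q)%N (j %/ q)%N) (i %% q)%N (j %% q)%N.

Definition blkcol n (B : nat -> 'M[C]_q) : 'M[C]_(n.+1 * q, q) :=
  \matrix_(i, j) mxget (B (i %/ q)%N) (i %% q)%N j.

Variable s : nat -> 'M[C]_q.
Variable alpha : R.

Definition sm1 (j : nat) : 'M[C]_q := if j is j'.+1 then s j' else 0.
Definition salpha (j : nat) : 'M[C]_q := - rC alpha *: s j + s j.+1.

Definition Hmx n := blkmx n (fun j k => s (j + k)%N).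
Definition Hamx n := blkmx n (fun j k => salpha (j + k)%N).
Definition y0mx n := blkcol n s.
Definition umx n := - blkcol n sm1.
Definition Tmx n := blkmx n (fun j k => if j == k.+1 then 1%:M else 0).
Definition vmx n := blkcol n (fun j => if j == 0%N then 1%:M else 0).
Definition RT n (z : C) : 'M[C]_(n.+1 * q) := invmx (1%:M - z *: Tmx n).

Variable f : C -> 'M[C]_q.

Definition Peven n (z : C) : 'M[C]_(n.+1 * q + q) :=
  let X := RT n z *m (vmx n *m f z - umx n) in
  block_mx (Hmx n) X (adjmx X) ((z - conjc z)^-1 *: (f z - adjmx (f z))).

Definition Podd n (z : C) : 'M[C]_(n.+1 * q + q) :=
  let g := (z - rC alpha) *: f z in
  let B := RT n z *m (vmx n *m g - (- rC alpha *: umx n - y0mx n)) in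
  block_mx (Hamx n) B (adjmx B) ((z - conjc z)^-1 *: (g - adjmx g)).

Definition Pm1 (z : C) : 'M[C]_q :=
  let g := (z - rC alpha) *: f z in (z - conjc z)^-1 *: (g - adjmx g).

(* "P_k^{[f]}(z) is nonnegative Hermitian", for k in {-1, 0, 1, ...}
   (the value for k < -1 is irrelevant and never used) *)
Definition Pk_psd (k : int) (z : C) : Prop :=
  match k with
  | Posz k => if odd k then psd (Podd k./2 z) else psd (Peven k./2 z)
  | Negz 0 => psd (Pm1 z)
  | Negz _ => True
  end.

End Defs.

(* kappa in N_0 \cup {infinity}: None stands for infinity *)
Definition le_kappa (j : nat) (kappa : option nat) : bool :=
  if kappa is Some K then (j <= K)%N else true.

Section Sets.
Variable R : realType.
Local Notation C := R[i].

Definition Piplus : set C := [set z | 0 < complex.Im z].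

Definition slit (alpha : R) : set C :=
  [set z | ~ (complex.Im z = 0 /\ alpha <= complex.Re z)].

Definition discrete_in_Piplus (D : set C) : Prop :=
  D `<=` Piplus /\
  forall w, Piplus w -> exists r : R, 0 < r /\
    forall z, D z -> `|z - w| < rC r -> z = w.

Definition holomorphic_on (q : nat) (U : set C) (f : C -> 'M[C]_q) : Prop :=
  forall z, U z -> @derivable C C^o 'M[C]_q f z 1.

Definition S0class (q : nat) (alpha : R) (S : C -> 'M[C]_q) : Prop :=
  [/\ holomorphic_on (slit alpha) S,
      forall z, Piplus z -> psd (ImM (S z)),
      forall x : R, x < alpha -> psd (S (rC x)) &
      exists M : R, forall y : R, 1 <= y ->
        rC y * `| S (Complex 0 y) | <= rC M].

End Sets.

(* Main.v *)
(* Let c be the trace of s_0.  The minors of P_0 >= 0 give |F_jk(z)| Im z <= c.  Together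
   with P_(-1) >= 0 they give |F_jk(z)| (alpha - Re z) <= c and
   |F - F^*|_jk (alpha - Re z)^2 <= 2 c Im z for Re z < alpha.  So F is bounded near each
   point of D, where it extends by Riemann's theorem, and F - F^* tends to 0 at (-oo, alpha),
   across which F extends by reflection.  Both extensions come from Cauchy's formula
   on a rectangle, with Goursat's lemma for bounded functions that are holomorphic off
   finitely many points, or off a real segment across which the jump tends to 0.
   Nonnegativity in the lower half-plane is algebraic: P_k(z) is congruent to a block
   Hankel matrix that does not change when z and F(z) are replaced by z^* and F(z)^*. *)
Require Import Defs.
From HB Require Import structures.
From mathcomp Require Import all_boot all_order all_algebra.
From mathcomp Require Import all_classical all_reals all_analysis.
From mathcomp Require Import complex.
From mathcomp Require Import ring lra.
Import Order.TTheory GRing.Theory Num.Theory.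
Import numFieldNormedType.Exports.
Local Open Scope ring_scope.
Local Open Scope classical_set_scope.
Set Implicit Arguments.
Unset Strict Implicit.
Unset Printing Implicit Defensive.
Local Notation Re := complex.Re.
Local Notation Im := complex.Im.
Local Notation nm := (@ComplexField.Normc.normc _).
Local Notation holo f z := (@derivable _ _^o _^o f z 1).
Local Notation ccont f z := ({for z, continuous (f : _^o -> _^o)}).
Local Notation rcont f t := ({for t, continuous (f : _ -> _^o)}).

(** * Complex numbers *)

Section ComplexNorm.
Variable R : realType.
Local Notation C := R[i].
Implicit Types (z w h l : C) (x y e d : R).

(** The value 2 pi i of the Cauchy integral of the constant 1 is never computed. For a rectangle,
    N(z) = integral of G(p)/(p - z) and W(z) = integral of 1/(p - z) are holomorphic inside as soon
    as G is bounded with finitely many discontinuities on the sides; W has no zero; and G = N/W at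
    every z where the integral of (G(p) - G(z))/(p - z) vanishes. Both extension theorems thus
    reduce to the vanishing of one integral, and N/W is itself the extension. The same formula,
    applied after division by high powers, replaces power series in the identity theorem behind
    uniqueness. The two assumed inequalities have opposite parities, and each P_k is a principal
    submatrix of the later ones of its parity; so every k from -1 to m is covered, in particular 0
    and -1, the source of all bounds. Reflection alone gives no inequality in the lower half-plane,
    since P_k at conj z is not simply a conjugate of P_k at z. On (-oo, alpha) the forms of S are
    limits of those of S(x + iy), whose real parts are nonnegative by P_0 and P_(-1) and whose
    imaginary parts tend to 0. *)

Lemma normE z : `|z| = rC (nm z).
Proof. by rewrite normc_def; case: z. Qed.

Lemma nm_ge0 z : 0 <= nm z.
Proof. by case: z => a b; exact: sqrtr_ge0. Qed.

Lemma nmM z w : nm (z * w) = nm z * nm w.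
Proof. exact: ComplexField.Normc.normcM. Qed.

Lemma nmV z : nm z^-1 = (nm z)^-1.
Proof. exact: ComplexField.Normc.normcV. Qed.

Lemma nm0 : nm (0 : C) = 0.
Proof. exact: ComplexField.Normc.normc0. Qed.

Lemma nm1 : nm (1 : C) = 1.
Proof. exact: ComplexField.Normc.normc1. Qed.

Lemma nm_eq0 z : (nm z == 0) = (z == 0).
Proof.
apply/eqP/eqP => [|->]; first exact: ComplexField.Normc.eq0_normc.
exact: nm0.
Qed.

Lemma nm_gt0 z : (0 < nm z) = (z != 0).
Proof. by rewrite lt_def nm_ge0 andbT nm_eq0. Qed.

Lemma nmX z n : nm (z ^+ n) = nm z ^+ n.
Proof. by elim: n => [|n ih]; rewrite ?expr0 ?nm1 // !exprS nmM ih. Qed.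

Lemma ler_nmD z w : nm (z + w) <= nm z + nm w.
Proof. exact: le_normcD. Qed.

Lemma nmN z : nm (- z) = nm z.
Proof. by case: z => a b /=; rewrite !sqrrN. Qed.

Lemma nm_distC z w : nm (z - w) = nm (w - z).
Proof. by rewrite -nmN opprB. Qed.

Lemma ler_nmB z w : nm (z - w) <= nm z + nm w.
Proof. by rewrite (le_trans (ler_nmD _ _)) // nmN. Qed.

Lemma lerB_nm z w : nm z - nm w <= nm (z - w).
Proof. by rewrite lerBlDr; have := ler_nmD (z - w) w; rewrite subrK. Qed.

Lemma nm_conj z : nm (conjc z) = nm z.
Proof. by case: z => a b /=; rewrite sqrrN. Qed.

Lemma nm_rC x : nm (rC x) = `|x|.
Proof. by rewrite /= expr0n /= addr0 sqrtr_sqr. Qed.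

Lemma nm_sqr z : nm z ^+ 2 = Re z ^+ 2 + Im z ^+ 2.
Proof. by case: z => a b /=; rewrite sqr_sqrtr // addr_ge0 ?sqr_ge0. Qed.

Lemma Re_le_nm z : `|Re z| <= nm z.
Proof.
rewrite -(ler_pXn2r (n := 2)) ?nnegrE ?nm_ge0 // nm_sqr real_normK ?num_real //.
by rewrite lerDl sqr_ge0.
Qed.

Lemma Im_le_nm z : `|Im z| <= nm z.
Proof.
rewrite -(ler_pXn2r (n := 2)) ?nnegrE ?nm_ge0 // nm_sqr real_normK ?num_real //.
by rewrite lerDr sqr_ge0.
Qed.

Lemma nm_le_ReIm z : nm z <= `|Re z| + `|Im z|.
Proof.
rewrite -(ler_pXn2r (n := 2)) ?nnegrE ?nm_ge0 ?addr_ge0 // nm_sqr sqrrD.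
by rewrite !real_normK ?num_real // lerD2r lerDl mulrn_wge0 // mulr_ge0.
Qed.

Lemma nm_i : nm (Complex 0 1 : C) = 1.
Proof. by rewrite /= expr0n expr1n add0r sqrtr1. Qed.

Lemma cReD z w : Re (z + w) = Re z + Re w. Proof. by case: z; case: w. Qed.
Lemma cImD z w : Im (z + w) = Im z + Im w. Proof. by case: z; case: w. Qed.
Lemma cReN z : Re (- z) = - Re z. Proof. by case: z. Qed.
Lemma cImN z : Im (- z) = - Im z. Proof. by case: z. Qed.
Lemma cReB z w : Re (z - w) = Re z - Re w. Proof. by rewrite cReD cReN. Qed.
Lemma cImB z w : Im (z - w) = Im z - Im w. Proof. by rewrite cImD cImN. Qed.
Lemma cReM z w : Re (z * w) = Re z * Re w - Im z * Im w.
Proof. by case: z; case: w. Qed.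
Lemma cImM z w : Im (z * w) = Re z * Im w + Im z * Re w.
Proof. by case: z; case: w. Qed.
Lemma cReJ z : Re (conjc z) = Re z. Proof. by case: z. Qed.
Lemma cImJ z : Im (conjc z) = - Im z. Proof. by case: z. Qed.

Lemma complex_eq z w : Re z = Re w -> Im z = Im w -> z = w.
Proof. by case: z; case: w => ? ? ? ? /= -> ->. Qed.

Lemma lt_rC x y : (rC x < rC y) = (x < y). Proof. exact: ltcR. Qed.
Lemma le_rC x y : (rC x <= rC y) = (x <= y). Proof. exact: lecR. Qed.
Lemma rC_gt0 e : (0 < rC e) = (0 < e). Proof. exact: ltcR. Qed.

Lemma gt0_rC z : 0 < z -> z = rC (Re z) /\ 0 < Re z.
Proof.
case: z => a b; rewrite ltcE /= => /andP[/eqP b0 a0]; split => //.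
by rewrite /rC b0.
Qed.

(** Radii of balls in C are elements of C; a positive one is real by [gt0_rC], so radii can be taken
    in R, where [lra] works. *)
Lemma nbhsC_P z (P : set C) :
  nbhs (z : C^o) P <-> exists2 d, 0 < d & forall w, nm (w - z) < d -> P w.
Proof.
split.
  move/nbhs_ballP => [e /= e0 eP]; have [Ee e1] := gt0_rC e0; rewrite Ee in eP.
  exists (Re e) => // w wz; apply: eP.
  by rewrite /ball /= distrC normE lt_rC.
move=> [d d0 dP]; apply/nbhs_ballP; exists (rC d); first by rewrite /= rC_gt0.
by move=> w; rewrite /ball /= distrC normE lt_rC; exact: dP.
Qed.

Lemma nbhsR_P (t : R) (P : set R) :
  nbhs t P <-> exists2 d, 0 < d & forall u, `|u - t| < d -> P u.
Proof.
split.
  move/nbhs_ballP => [e /= e0 eP]; exists e => // w wz; apply: eP.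
  by rewrite /ball /= distrC.
move=> [d d0 dP]; apply/nbhs_ballP; exists d => //.
by move=> w; rewrite /ball /= distrC; exact: dP.
Qed.

Lemma cvgCP {T} (F : set_system T) {FF : Filter F} (f : T -> C) (l : C) :
  (f : T -> C^o) @ F --> (l : C^o) <-> forall e, 0 < e -> \forall x \near F, nm (f x - l) <= e.
Proof.
split=> [/cvgrPdist_le fl e e0|fl].
  have := fl (rC e); rewrite rC_gt0 => /(_ e0).
  by apply: filterS => x; rewrite distrC normE le_rC.
apply/cvgrPdist_le => e /gt0_rC [-> /fl].
by apply: filterS => x; rewrite distrC normE le_rC.
Qed.

Lemma contCP (f : C -> C) z : ccont f z <->
  forall e, 0 < e -> exists2 d, 0 < d & forall w, nm (w - z) < d -> nm (f w - f z) <= e.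
Proof.
apply: iff_trans (cvgCP (F := nbhs (z : C^o)) f (f z)) _.
by split=> fz e /fz /nbhsC_P.
Qed.

Lemma contRP (f : R -> C) t : rcont f t <->
  forall e, 0 < e -> exists2 d, 0 < d & forall u, `|u - t| < d -> nm (f u - f t) <= e.
Proof.
apply: iff_trans (cvgCP (F := nbhs t) f (f t)) _.
by split=> fz e /fz /nbhsR_P.
Qed.

Lemma contRRP (f : R -> R) t : {for t, continuous f} <->
  forall e, 0 < e -> exists2 d, 0 < d & forall u, `|u - t| < d -> `|f u - f t| <= e.
Proof.
split.
  move=> /cvgrPdist_le fz e /fz /nbhsR_P [d d0 dP]; exists d => // u /dP.
  by rewrite distrC.
move=> fz; apply/cvgrPdist_le => e /fz [d d0 dP]; apply/nbhsR_P; exists d => // u /dP.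
by rewrite distrC.
Qed.

(** The remainder is multiplied out, so h = 0 is allowed and later estimates contain no quotient. *)
Lemma holoP (f : C -> C) z : holo f z <-> exists l, forall e, 0 < e ->
  exists2 d, 0 < d & forall h, nm h < d -> nm (f (z + h) - f z - l * h) <= e * nm h.
Proof.
split.
  move=> /cvg_ex[/= l fl]; exists l => e e0.
  have /cvgCP/(_ e e0)[/= d d0 dP] := fl.
  have [Ed d1] := gt0_rC d0; rewrite Ed in dP.
  exists (Re d) => // h hd; have [->|hn0] := eqVneq h 0.
    by rewrite addr0 mulr0 subrr subr0 nm0 mulr0.
  have := dP h; rewrite /= sub0r normrN normE lt_rC => /(_ hd hn0).
  rewrite /GRing.scale /= mulr1 [h + z]addrC => H.
  have -> : f (z + h) - f z - l * h = (h^-1 * (f (z + h) - f z) - l) * h.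
    by rewrite mulrBl mulrAC mulVf // mul1r.
  by rewrite nmM ler_wpM2r // nm_ge0.
move=> [l fl]; apply/cvg_ex; exists l => /=; apply/cvgCP => e e0.
have [d d0 dP] := fl e e0.
exists (rC d); first by rewrite /= rC_gt0.
move=> h /=; rewrite sub0r normrN normE lt_rC => /dP H hn0.
rewrite /GRing.scale /= mulr1 [h + z]addrC.
have -> : h^-1 * (f (z + h) - f z) - l = (f (z + h) - f z - l * h) * h^-1.
  by rewrite mulrBl mulfK // mulrC.
by rewrite nmM nmV ler_pdivrMr // nm_gt0.
Qed.

Lemma holo_cont (f : C -> C) z : holo f z -> ccont f z.
Proof.
move=> /derivable1_diffP; exact: differentiable_continuous.
Qed.

Lemma holo_cst (a z : C) : holo (fun=> a) z.
Proof. exact: derivable_cst. Qed.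

Lemma holo_id z : holo (fun w => w) z.
Proof. exact: derivable_id. Qed.

Lemma holoD (f g : C -> C) z : holo f z -> holo g z -> holo (fun w => f w + g w) z.
Proof. exact: derivableD. Qed.

Lemma holoB (f g : C -> C) z : holo f z -> holo g z -> holo (fun w => f w - g w) z.
Proof. exact: derivableB. Qed.

Lemma holoM (f g : C -> C) z : holo f z -> holo g z -> holo (fun w => f w * g w) z.
Proof. exact: derivableM. Qed.

Lemma holoV (f : C -> C) z : f z != 0 -> holo f z -> holo (fun w => (f w)^-1) z.
Proof. exact: derivableV. Qed.

Lemma holoXn (f : C -> C) n z : holo f z -> holo (fun w => f w ^+ n) z.
Proof.
move=> hf; elim: n => [|n ih].
  rewrite (_ : (fun w => f w ^+ 0) = fun=> 1); first exact: holo_cst.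
  by apply/funext => w; rewrite expr0.
rewrite (_ : (fun w => f w ^+ n.+1) = fun w => f w * f w ^+ n).
  exact: (holoM hf ih).
by apply/funext => w; rewrite exprS.
Qed.

Lemma holo_near (f g : C -> C) z d : 0 < d ->
  (forall w, nm (w - z) < d -> f w = g w) -> holo f z -> holo g z.
Proof.
move=> d0 fg /holoP[l H]; apply/holoP; exists l => e e0.
have [d1 d10 H1] := H e e0; exists (Order.min d d1); first by rewrite lt_min d0.
move=> h; rewrite lt_min => /andP[hd hd1]; rewrite -!fg ?H1 // ?subrr ?nm0 //.
by rewrite addrC addKr.
Qed.

(** Conjugation is a ring morphism that preserves the modulus, so it carries the estimate of [holoP]
    over, with the conjugate derivative. *)
Lemma holo_conj (f : C -> C) z :
  holo f (conjc z) -> holo (fun w => conjc (f (conjc w))) z.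
Proof.
move=> /holoP[l H]; apply/holoP; exists (conjc l) => e /H[d d0 dP].
exists d => // h hd; have := dP (conjc h); rewrite nm_conj => /(_ hd).
by rewrite -[in X in X -> _]nm_conj !rmorphB !rmorphM !rmorphD /= !conjcK.
Qed.

End ComplexNorm.

(** * Integrals over an interval *)

Section IntervalIntegral.
Variable R : realType.
Local Notation C := R[i].
Local Notation mu := (@lebesgue_measure R).
Implicit Types (a b c t M : R) (f g : R -> R) (phi psi : R -> C).

Definition cintegrable (phi : R -> C) a b : Prop :=
  mu.-integrable `[a, b] (EFin \o (fun t => Re (phi t))) /\
  mu.-integrable `[a, b] (EFin \o (fun t => Im (phi t))).

Definition cint (phi : R -> C) a b : C :=
  Complex (\int[mu]_(t in `[a, b]) Re (phi t)) (\int[mu]_(t in `[a, b]) Im (phi t)).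

Lemma eq_integrable_itv f g a b : (forall t, a <= t <= b -> f t = g t) ->
  mu.-integrable `[a, b] (EFin \o f) -> mu.-integrable `[a, b] (EFin \o g).
Proof.
move=> fg; apply: eq_integrable => // t tab /=; congr EFin; apply: fg.
by move: tab; rewrite inE /= in_itv.
Qed.

Lemma eq_cint phi psi a b : (forall t, a <= t <= b -> phi t = psi t) ->
  cint phi a b = cint psi a b.
Proof.
move=> e; rewrite /cint; congr Complex; apply: eq_Rintegral => t;
by rewrite inE /= in_itv /= => /e ->.
Qed.

Lemma eq_cintegrable phi psi a b : (forall t, a <= t <= b -> phi t = psi t) ->
  cintegrable phi a b -> cintegrable psi a b.
Proof.
move=> e [h1 h2]; split; [apply: eq_integrable_itv h1|apply: eq_integrable_itv h2];
by move=> t /e ->.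
Qed.

Lemma integrable_itvZl f a b k : mu.-integrable `[a, b] (EFin \o f) ->
  mu.-integrable `[a, b] (EFin \o (fun t => k * f t)).
Proof.
move=> h; have H : mu.-integrable `[a, b] (fun t => k%:E * (EFin \o f) t)%E.
  by apply: integrableZl.
exact: H.
Qed.

Lemma integrable_itvB f g a b : mu.-integrable `[a, b] (EFin \o f) ->
  mu.-integrable `[a, b] (EFin \o g) ->
  mu.-integrable `[a, b] (EFin \o (fun t => f t - g t)).
Proof.
move=> h1 h2; have H : mu.-integrable `[a, b] ((EFin \o f) \- (EFin \o g))%E.
  by apply: integrableB.
exact: H.
Qed.

Lemma integrable_itvD f g a b : mu.-integrable `[a, b] (EFin \o f) ->
  mu.-integrable `[a, b] (EFin \o g) ->
  mu.-integrable `[a, b] (EFin \o (fun t => f t + g t)).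
Proof.
move=> h1 h2; have H : mu.-integrable `[a, b] ((EFin \o f) \+ (EFin \o g))%E.
  by apply: integrableD.
exact: H.
Qed.

Lemma cintegrableD phi psi a b : cintegrable phi a b -> cintegrable psi a b ->
  cintegrable (fun t => phi t + psi t) a b.
Proof.
move=> [p1 p2] [q1 q2]; split.
  by apply: eq_integrable_itv (integrable_itvD p1 q1) => t _; rewrite cReD.
by apply: eq_integrable_itv (integrable_itvD p2 q2) => t _; rewrite cImD.
Qed.

Lemma cintD phi psi a b : cintegrable phi a b -> cintegrable psi a b ->
  cint (fun t => phi t + psi t) a b = cint phi a b + cint psi a b.
Proof.
move=> [p1 p2] [q1 q2]; apply: complex_eq; rewrite ?cReD ?cImD /=.
  by rewrite -RintegralD //; apply: eq_Rintegral => t _; rewrite cReD.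
by rewrite -RintegralD //; apply: eq_Rintegral => t _; rewrite cImD.
Qed.

Lemma cintegrableZ (k : C) phi a b : cintegrable phi a b ->
  cintegrable (fun t => k * phi t) a b.
Proof.
move=> [p1 p2]; split.
  have := integrable_itvB (integrable_itvZl (Re k) p1) (integrable_itvZl (Im k) p2).
  by apply: eq_integrable_itv => t _ /=; rewrite cReM.
have := integrable_itvD (integrable_itvZl (Re k) p2) (integrable_itvZl (Im k) p1).
by apply: eq_integrable_itv => t _ /=; rewrite cImM.
Qed.

Lemma cintZ (k : C) phi a b : cintegrable phi a b ->
  cint (fun t => k * phi t) a b = k * cint phi a b.
Proof.
move=> [p1 p2]; apply: complex_eq; rewrite ?cReM ?cImM /= -!RintegralZl //.
  rewrite -RintegralB //; try exact: integrable_itvZl.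
  by apply: eq_Rintegral => t _; rewrite cReM.
rewrite -RintegralD //; try exact: integrable_itvZl.
by apply: eq_Rintegral => t _; rewrite cImM.
Qed.

Lemma cintegrableB phi psi a b : cintegrable phi a b -> cintegrable psi a b ->
  cintegrable (fun t => phi t - psi t) a b.
Proof.
move=> p q; have := cintegrableD p (cintegrableZ (-1) q).
by apply: eq_cintegrable => t _; rewrite mulN1r.
Qed.

Lemma cintB phi psi a b : cintegrable phi a b -> cintegrable psi a b ->
  cint (fun t => phi t - psi t) a b = cint phi a b - cint psi a b.
Proof.
move=> p q; rewrite -[- cint psi a b]mulN1r -cintZ // -cintD //.
  by apply: eq_cint => t _; rewrite mulN1r.
exact: cintegrableZ.
Qed.

Lemma Rint_cst a b k : a <= b -> \int[mu]_(t in `[a, b]) k = k * (b - a).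
Proof.
move=> ab; rewrite Rintegral_cst //= lebesgue_measure_itv /= lte_fin.
case: ltP => //= h; have -> : b = a by apply/eqP; rewrite eq_le h ab.
by rewrite subrr.
Qed.

Lemma cint_cst (k : C) a b : a <= b -> cint (fun=> k) a b = k * rC (b - a).
Proof.
by move=> ab; rewrite /cint !Rint_cst //; apply: complex_eq;
  rewrite ?cReM ?cImM /=; ring.
Qed.

Lemma Rint_split f a b c : a <= b <= c -> mu.-integrable `[a, c] (EFin \o f) ->
  \int[mu]_(t in `[a, c]) f t =
  \int[mu]_(t in `[a, b]) f t + \int[mu]_(t in `[b, c]) f t.
Proof.
move=> /andP[ab bc] h.
have := @Rintegral_itvB _ f (BLeft a) (BRight c) b h.
rewrite !bnd_simp => /(_ ab bc); rewrite Rintegral_itv_obnd_cbnd; last first.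
  apply: integrableS h => // t /=; rewrite !in_itv /= => /andP[? ?].
  by apply/andP; split; lra.
by move=> <-; ring.
Qed.

Lemma cint_split phi a b c : a <= b <= c -> cintegrable phi a c ->
  cint phi a c = cint phi a b + cint phi b c.
Proof.
move=> abc [p1 p2]; apply: complex_eq; rewrite ?cReD ?cImD /=;
exact: Rint_split.
Qed.

Lemma integrable_itv_cst a b k : mu.-integrable `[a, b] (EFin \o (fun=> k)).
Proof.
apply: measurable_bounded_integrable => //.
  by rewrite /= lebesgue_measure_itv /=; case: ifP => _ //; rewrite -EFinB ltry.
exact: bounded_cst.
Qed.

Lemma Rint_bound f a b M : a <= b -> mu.-integrable `[a, b] (EFin \o f) ->
  (forall t, a <= t <= b -> `|f t| <= M) ->
  `|\int[mu]_(t in `[a, b]) f t| <= M * (b - a).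
Proof.
move=> ab h fM.
have up : \int[mu]_(t in `[a, b]) f t <= \int[mu]_(t in `[a, b]) M.
  apply: le_Rintegral => //; first exact: integrable_itv_cst.
  by move=> t /=; rewrite in_itv /= => /fM; rewrite ler_norml => /andP[].
have dn : \int[mu]_(t in `[a, b]) - M <= \int[mu]_(t in `[a, b]) f t.
  apply: le_Rintegral => //; first exact: integrable_itv_cst.
  by move=> t /=; rewrite in_itv /= => /fM; rewrite ler_norml => /andP[].
move: up dn; rewrite !Rint_cst // ler_norml => -> dn; rewrite andbT.
by rewrite (le_trans _ dn) // mulNr.
Qed.

(* Bounding real and imaginary parts separately costs the factor 2. *)
Lemma cint_bound phi a b M : a <= b -> cintegrable phi a b ->
  (forall t, a <= t <= b -> nm (phi t) <= M) ->
  nm (cint phi a b) <= 2 * M * (b - a).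
Proof.
move=> ab [p1 p2] pM; apply: (le_trans (nm_le_ReIm _)) => /=.
have -> : 2 * M * (b - a) = M * (b - a) + M * (b - a) by ring.
apply: lerD; apply: Rint_bound => // t /pM; apply: le_trans.
  exact: Re_le_nm.
exact: Im_le_nm.
Qed.

Lemma Rint_ge f a b M : a <= b -> mu.-integrable `[a, b] (EFin \o f) ->
  (forall t, a <= t <= b -> M <= f t) ->
  M * (b - a) <= \int[mu]_(t in `[a, b]) f t.
Proof.
move=> ab h fM; rewrite -Rint_cst //.
by apply: le_Rintegral => //; exact: integrable_itv_cst.
Qed.

(** The integrands met below: a side of a rectangle may run through exceptional points or cross the
    real axis, where only boundedness is known. *)
Definition pcont (phi : R -> C) a b : Prop :=
  (exists M, forall t, a <= t <= b -> nm (phi t) <= M) /\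
  exists L : seq R, forall t, a <= t <= b -> t \notin L -> rcont phi t.

Lemma rcont_Re phi t : rcont phi t -> {for t, continuous (fun u => Re (phi u))}.
Proof.
move=> /contRP H; apply/contRRP => e /H[d d0 dP]; exists d => // u /dP.
by apply: le_trans; rewrite -cReB; exact: Re_le_nm.
Qed.

Lemma rcont_Im phi t : rcont phi t -> {for t, continuous (fun u => Im (phi u))}.
Proof.
move=> /contRP H; apply/contRRP => e /H[d d0 dP]; exists d => // u /dP.
by apply: le_trans; rewrite -cImB; exact: Im_le_nm.
Qed.

Lemma seq_set_cons (x : R) (L : seq R) : [set` x :: L] = x |` [set` L].
Proof.
apply/seteqP; split => y /=; rewrite inE; first by case/orP => [/eqP|]; [left|right].
by case=> [->|->]; rewrite ?eqxx ?orbT.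
Qed.

Lemma measurable_finite_seq (L : seq R) : measurable [set` L].
Proof.
elim: L => [|x L ih]; first by rewrite set_nil.
by rewrite seq_set_cons; apply: measurableU.
Qed.

Lemma measurable_fun_finite_seq (L : seq R) f : measurable_fun [set` L] f.
Proof.
elim: L => [|x L ih]; first by rewrite set_nil; exact: measurable_fun_set0.
rewrite seq_set_cons; apply/measurable_funU => //; first exact: measurable_finite_seq.
by split => //; exact: measurable_fun_set1.
Qed.

Lemma closed_finite_seq (L : seq R) : closed [set` L].
Proof.
elim: L => [|x L ih]; first by rewrite set_nil; exact: closed0.
by rewrite seq_set_cons; apply: closedU => //; exact: closed1.
Qed.

Lemma measurable_pcont f a b (L : seq R) :
  (forall t, a <= t <= b -> t \notin L -> {for t, continuous f}) ->
  measurable_fun `[a, b] f.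
Proof.
(* On the open set [D] the function is continuous; the rest, endpoints included, is finite, and
   there every function is measurable. *)
move=> fc; pose D := `]a, b[%classic `&` ~` [set` L].
have oD : open D.
  by apply: openI; [exact: interval_open|apply: closed_openC; exact: closed_finite_seq].
have mD : measurable_fun D f.
  apply: measurable_realfun.open_continuous_measurable_fun => // t.
  rewrite inE /D /= in_itv /= => -[/andP[? ?] /negP tL]; apply: fc => //.
  by apply/andP; split; exact: ltW.
have sub : `[a, b] `<=` D `|` [set` [:: a, b & L]].
  move=> t /=; rewrite in_itv /= => /andP[ta tb].
  have [tL|tL] := boolP (t \in [:: a, b & L]); [by right|left].
  move: tL; rewrite !inE !negb_or => /and3P[na nb nL]; split; last exact/negP.
  by rewrite /= in_itv /= !lt_def ta tb na eq_sym nb.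
apply: measurable_funS sub _.
  by apply: measurableU; [exact: measurable_realfun.open_measurable|exact: measurable_finite_seq].
apply/measurable_funU; [exact: measurable_realfun.open_measurable|exact: measurable_finite_seq|].
by split => //; exact: measurable_fun_finite_seq.
Qed.

Lemma integrable_pcont f a b M (L : seq R) :
  (forall t, a <= t <= b -> `|f t| <= M) ->
  (forall t, a <= t <= b -> t \notin L -> {for t, continuous f}) ->
  mu.-integrable `[a, b] (EFin \o f).
Proof.
move=> fM fc; apply: measurable_bounded_integrable => //.
- by rewrite /= lebesgue_measure_itv /=; case: ifP => _ //; rewrite -EFinB ltry.
- exact: measurable_pcont fc.
- exists M; split; rewrite ?num_real // => x Mx t /=.
  by rewrite in_itv /= => /fM h; rewrite (le_trans h) // ltW.
Qed.

Lemma pcont_integrable phi a b : pcont phi a b -> cintegrable phi a b.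
Proof.
move=> [[M hM] [L hL]]; split; apply: (@integrable_pcont _ _ _ M L) => t tab.
- by rewrite (le_trans (Re_le_nm _)) // hM.
- by move=> tL; apply: rcont_Re; exact: hL.
- by rewrite (le_trans (Im_le_nm _)) // hM.
- by move=> tL; apply: rcont_Im; exact: hL.
Qed.

Lemma pcontM phi psi a b : pcont phi a b -> pcont psi a b ->
  pcont (fun t => phi t * psi t) a b.
Proof.
move=> [[M hM] [L hL]] [[N hN] [K hK]]; split.
  exists (M * N) => t tab; rewrite nmM ler_pM ?nm_ge0 ?hM ?hN //.
exists (L ++ K) => t tab; rewrite mem_cat negb_or => /andP[tL tK].
by apply: cvgM; [exact: hL|exact: hK].
Qed.

Lemma pcont_cst (k : C) a b : pcont (fun=> k) a b.
Proof. by split; [exists (nm k)|exists [::] => t _ _; exact: cvg_cst]. Qed.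

End IntervalIntegral.

(** * Integrals over the boundary of a rectangle *)

Section RectangleIntegral.
Variable R : realType.
Local Notation C := R[i].
Implicit Types (x y t w h s e d M : R) (f g : C -> C) (z p : C) (E : seq C).

Lemma rcont_hor f x y : ccont f (Complex x y) -> rcont (fun t => f (Complex t y)) x.
Proof.
move=> /contCP H; apply/contRP => e /H[d d0 dP]; exists d => // u ux.
apply: dP; have -> : Complex u y - Complex x y = rC (u - x).
  by apply: complex_eq; rewrite /= ?subrr.
by rewrite nm_rC.
Qed.

Lemma rcont_ver f x y : ccont f (Complex x y) -> rcont (fun t => f (Complex x t)) y.
Proof.
move=> /contCP H; apply/contRP => e /H[d d0 dP]; exists d => // u uy.
apply: dP; have -> : Complex x u - Complex x y = Complex 0 1 * rC (u - y).
  by apply: complex_eq; rewrite /=; ring.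
by rewrite nmM nm_i mul1r nm_rC.
Qed.

Lemma cint_pt (phi : R -> C) x : cint phi x x = 0.
Proof. by apply: complex_eq; rewrite /= set_itv1 Rintegral_set1. Qed.

(** The counterclockwise contour integral: dz is dt on the horizontal sides and i dt on the vertical
    ones. *)
Definition rectint f x0 x1 y0 y1 : C :=
  cint (fun t => f (Complex t y0)) x0 x1 - cint (fun t => f (Complex t y1)) x0 x1 +
  Complex 0 1 * (cint (fun t => f (Complex x1 t)) y0 y1 -
                 cint (fun t => f (Complex x0 t)) y0 y1).

Definition sidesint f x0 x1 y0 y1 : Prop :=
  [/\ cintegrable (fun t => f (Complex t y0)) x0 x1,
      cintegrable (fun t => f (Complex t y1)) x0 x1,
      cintegrable (fun t => f (Complex x0 t)) y0 y1 &
      cintegrable (fun t => f (Complex x1 t)) y0 y1].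

Definition inrect x0 x1 y0 y1 z : bool :=
  (x0 <= Re z <= x1) && (y0 <= Im z <= y1).

Definition onsides x0 x1 y0 y1 z : bool :=
  inrect x0 x1 y0 y1 z &&
  [|| Re z == x0, Re z == x1, Im z == y0 | Im z == y1].

Lemma rectint_splitx f x0 x x1 y0 y1 : x0 <= x <= x1 -> sidesint f x0 x1 y0 y1 ->
  rectint f x0 x1 y0 y1 = rectint f x0 x y0 y1 + rectint f x x1 y0 y1.
Proof.
move=> xx [h0 h1 _ _]; rewrite /rectint (cint_split xx h0) (cint_split xx h1).
ring.
Qed.

Lemma rectint_splity f x0 x1 y0 y y1 : y0 <= y <= y1 -> sidesint f x0 x1 y0 y1 ->
  rectint f x0 x1 y0 y1 = rectint f x0 x1 y0 y + rectint f x0 x1 y y1.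
Proof.
move=> yy [_ _ h0 h1]; rewrite /rectint (cint_split yy h0) (cint_split yy h1).
ring.
Qed.

Lemma rectint_degx f x y0 y1 : rectint f x x y0 y1 = 0.
Proof. by rewrite /rectint !cint_pt !subrr mulr0 addr0. Qed.

Lemma rectint_degy f x0 x1 y : rectint f x0 x1 y y = 0.
Proof. by rewrite /rectint !cint_pt !subrr mulr0 addr0. Qed.

(** This shape has two uses: c = 1 subtracts an affine approximation, c = G z splits the Cauchy
    kernel. *)
Lemma rectint_lin f g (c : C) x0 x1 y0 y1 :
  sidesint f x0 x1 y0 y1 -> sidesint g x0 x1 y0 y1 ->
  rectint (fun z => f z - c * g z) x0 x1 y0 y1 =
  rectint f x0 x1 y0 y1 - c * rectint g x0 x1 y0 y1.
Proof.
move=> [f0 f1 f2 f3] [g0 g1 g2 g3]; rewrite /rectint.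
rewrite !cintB ?cintZ //; try exact: cintegrableZ.
ring.
Qed.

Lemma sidesint_lin f g (c : C) x0 x1 y0 y1 :
  sidesint f x0 x1 y0 y1 -> sidesint g x0 x1 y0 y1 ->
  sidesint (fun z => f z - c * g z) x0 x1 y0 y1.
Proof.
move=> [f0 f1 f2 f3] [g0 g1 g2 g3].
by split; apply: cintegrableB => //; exact: cintegrableZ.
Qed.

Lemma onsides_hor0 x0 x1 y0 y1 t : y0 <= y1 -> x0 <= t <= x1 ->
  onsides x0 x1 y0 y1 (Complex t y0).
Proof. by move=> yy tt; rewrite /onsides /inrect /= tt lexx yy eqxx !orbT. Qed.

Lemma onsides_hor1 x0 x1 y0 y1 t : y0 <= y1 -> x0 <= t <= x1 ->
  onsides x0 x1 y0 y1 (Complex t y1).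
Proof. by move=> yy tt; rewrite /onsides /inrect /= tt lexx yy eqxx !orbT. Qed.

Lemma onsides_ver0 x0 x1 y0 y1 t : x0 <= x1 -> y0 <= t <= y1 ->
  onsides x0 x1 y0 y1 (Complex x0 t).
Proof. by move=> yy tt; rewrite /onsides /inrect /= tt lexx yy eqxx. Qed.

Lemma onsides_ver1 x0 x1 y0 y1 t : x0 <= x1 -> y0 <= t <= y1 ->
  onsides x0 x1 y0 y1 (Complex x1 t).
Proof. by move=> yy tt; rewrite /onsides /inrect /= tt lexx yy eqxx orbT. Qed.

Lemma rectint_bound f M x0 x1 y0 y1 : x0 <= x1 -> y0 <= y1 ->
  sidesint f x0 x1 y0 y1 ->
  (forall z, onsides x0 x1 y0 y1 z -> nm (f z) <= M) ->
  nm (rectint f x0 x1 y0 y1) <= 4 * M * ((x1 - x0) + (y1 - y0)).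
Proof.
move=> xx yy [h0 h1 v0 v1] fM; rewrite /rectint.
have H0 := cint_bound xx h0 (fun t tt => fM _ (onsides_hor0 yy tt)).
have H1 := cint_bound xx h1 (fun t tt => fM _ (onsides_hor1 yy tt)).
have V0 := cint_bound yy v0 (fun t tt => fM _ (onsides_ver0 xx tt)).
have V1 := cint_bound yy v1 (fun t tt => fM _ (onsides_ver1 xx tt)).
apply: (le_trans (ler_nmD _ _)); rewrite nmM nm_i mul1r.
have := ler_nmB (cint (fun t => f (Complex t y0)) x0 x1) (cint (fun t => f (Complex t y1)) x0 x1).
have := ler_nmB (cint (fun t => f (Complex x1 t)) y0 y1) (cint (fun t => f (Complex x0 t)) y0 y1).
lra.
Qed.

Lemma continuous_Rintegrable (f : R -> R) a b :
  (forall t, a <= t <= b -> {for t, continuous f}) ->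
  (@lebesgue_measure R).-integrable `[a, b] (EFin \o f).
Proof.
move=> fc; apply: continuous_compact_integrable; first exact: segment_compact.
apply: continuous_in_subspaceT => t; rewrite inE /= in_itv /=; exact: fc.
Qed.

Lemma continuous_cintegrable (phi : R -> C) a b :
  (forall t, a <= t <= b -> rcont phi t) -> cintegrable phi a b.
Proof.
move=> fc; split; apply: continuous_Rintegrable => t /fc.
  exact: rcont_Re.
exact: rcont_Im.
Qed.

Lemma continuous_sidesint f x0 x1 y0 y1 : x0 <= x1 -> y0 <= y1 ->
  (forall z, inrect x0 x1 y0 y1 z -> ccont f z) -> sidesint f x0 x1 y0 y1.
Proof.
move=> xx yy fc; split; apply: continuous_cintegrable => t tt;
[apply: rcont_hor|apply: rcont_hor|apply: rcont_ver|apply: rcont_ver];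
by apply: fc; rewrite /inrect /= ?lexx ?tt ?xx ?yy.
Qed.

Lemma ccont_affine (a b p : C) : ccont (fun z => a + b * z) p.
Proof. by apply: holo_cont; apply: holoD; [exact: holo_cst|apply: holoM; [exact: holo_cst|exact: holo_id]]. Qed.

Lemma affineB (a b u v : C) : a + b * u - (a + b * v) = b * (u - v).
Proof. ring. Qed.

Lemma rectint_affine (a b : C) x0 x1 y0 y1 : x0 <= x1 -> y0 <= y1 ->
  rectint (fun z => a + b * z) x0 x1 y0 y1 = 0.
Proof.
move=> xx yy.
have [h0 h1 v0 v1] : sidesint (fun z => a + b * z) x0 x1 y0 y1.
  by apply: continuous_sidesint => // z _; exact: ccont_affine.
(* On opposite sides the function differs by a constant; the two constants contribute opposite
   amounts. *)
rewrite /rectint -!cintB //.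
rewrite (@eq_cint _ _ (fun=> b * Complex 0 (y0 - y1))); last first.
  move=> t _; have -> : Complex 0 (y0 - y1) = Complex t y0 - Complex t y1.
    by apply: complex_eq => /=; rewrite ?subrr.
  exact: affineB.
rewrite [X in _ + _ * X](@eq_cint _ _ (fun=> b * rC (x1 - x0))); last first.
  move=> t _; have -> : rC (x1 - x0) = Complex x1 t - Complex x0 t.
    by apply: complex_eq => /=; rewrite ?subrr.
  exact: affineB.
rewrite !cint_cst //; apply: complex_eq; rewrite !(cReM, cImM, cReD, cImD) /=; ring.
Qed.

(** * Repeated division of a rectangle into quarters *)

Section Quadrisection.
Variables (P : R -> R -> R -> Prop) (x0 y0 w h : R).
Hypotheses (w0 : 0 <= w) (h0 : 0 <= h).

(** The triple (x, y, s) stands for the rectangle with lower left corner (x, y) and sides w s and h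
    s, here inside the initial one. A single scale s keeps the shape, so that estimates depend on s
    alone. *)
Let sub x y s := [&& x0 <= x, y0 <= y, x + w * s <= x0 + w & y + h * s <= y0 + h].

Hypothesis glue : forall x y s, 0 < s -> sub x y s ->
  P x y (s / 2) -> P (x + w * (s / 2)) y (s / 2) ->
  P x (y + h * (s / 2)) (s / 2) -> P (x + w * (s / 2)) (y + h * (s / 2)) (s / 2) ->
  P x y s.
Hypothesis loc : forall p, inrect x0 (x0 + w) y0 (y0 + h) p ->
  exists2 d, 0 < d & forall x y s, 0 < s < d -> sub x y s ->
    inrect x (x + w * s) y (y + h * s) p -> P x y s.

Let nxt (q q' : R * R * R) :=
  let: (x, y, s) := q in let: (x', y', s') := q' in
  [/\ s' = s / 2, x <= x', y <= y', x' + w * s' <= x + w * s &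
      y' + h * s' <= y + h * s /\ ~ P x' y' s'].

Let nxt_ex q : let: (x, y, s) := q in 0 < s -> sub x y s -> ~ P x y s ->
  exists q', nxt q q'.
Proof.
case: q => [[x y] s] s0 sb nP.
have ws : 0 <= w * (s / 2) by apply: mulr_ge0 => //; lra.
have hs : 0 <= h * (s / 2) by apply: mulr_ge0 => //; lra.
have ews : w * s = w * (s / 2) + w * (s / 2) by field.
have ehs : h * s = h * (s / 2) + h * (s / 2) by field.
have [p1|n1] := pselect (P x y (s / 2)); last first.
  by exists (x, y, s / 2); split => //; [lra|split=> //; lra].
have [p2|n2] := pselect (P (x + w * (s / 2)) y (s / 2)); last first.
  by exists (x + w * (s / 2), y, s / 2); split => //; [lra|lra|split=> //; lra].
have [p3|n3] := pselect (P x (y + h * (s / 2)) (s / 2)); last first.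
  by exists (x, y + h * (s / 2), s / 2); split => //; [lra|lra|split=> //; lra].
have [p4|n4] := pselect (P (x + w * (s / 2)) (y + h * (s / 2)) (s / 2)); last first.
  by exists (x + w * (s / 2), y + h * (s / 2), s / 2); split => //;
     [lra|lra|lra|split=> //; lra].
by case: nP; exact: glue.
Qed.

(** The default [q] is a filler: [nxt_ex] provides a successor for every triple with positive scale,
    inside the initial rectangle, on which [P] fails. *)
Let step q := if pselect (exists q', nxt q q') is left e then sval (cid e) else q.
Let u n := iter n step (x0, y0, 1).

(** If [P] failed for the whole rectangle, it would fail for one of its quarters, for a quarter of
    that one, and so on. These rectangles share a point, where [loc] contradicts the failure on the
    small ones. *)
Lemma quadrisection : P x0 y0 1.
Proof using glue h0 loc w0.
have [//|nP] := pselect (P x0 y0 1); exfalso.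
have stepP q : let: (x, y, s) := q in 0 < s -> sub x y s -> ~ P x y s ->
    nxt q (step q).
  have := @nxt_ex q; case: q => [[x y] s] H s0 sb nPt.
  rewrite /step; case: pselect => [e|[]]; last exact: H.
  exact: svalP (cid e).
pose X n := (u n).1.1; pose Y n := (u n).1.2; pose S n := (u n).2.
have un n : u n = (X n, Y n, S n) by rewrite /X /Y /S; case: (u n) => [[]].
have inv n : [/\ S n = 2^-1 ^+ n, sub (X n) (Y n) (S n) & ~ P (X n) (Y n) (S n)] /\
    nxt (u n) (u n.+1).
  elim: n => [|n [[Sn sb nPn] nx]].
    have I : [/\ S 0%N = 2^-1 ^+ 0, sub (X 0%N) (Y 0%N) (S 0%N) & ~ P (X 0%N) (Y 0%N) (S 0%N)].
      by split => //; rewrite /sub /= !mulr1 !lexx.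
    by split => //; apply: (stepP (x0, y0, 1)) => //; case: I.
  have I : [/\ S n.+1 = 2^-1 ^+ n.+1, sub (X n.+1) (Y n.+1) (S n.+1) &
               ~ P (X n.+1) (Y n.+1) (S n.+1)].
    move: nx; rewrite (un n) (un n.+1) => -[-> xx yy xw [yh nP']]; split => //.
      by rewrite Sn exprS mulrC.
    move: sb; rewrite /sub => /and4P[a b c d].
    by rewrite (le_trans a xx) (le_trans b yy) (le_trans xw c) (le_trans yh d).
  split => //; rewrite [u n.+2]/(step (u n.+1)).
  have [SE sb' nP'] := I; have S0 : 0 < S n.+1 by rewrite SE exprn_gt0 // invr_gt0.
  by have := stepP (u n.+1); rewrite (un n.+1) => /(_ S0 sb' nP').
have Xm n m : X n <= X (n + m)%N /\ X (n + m)%N + w * S (n + m)%N <= X n + w * S n.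
  elim: m => [|m [ih1 ih2]]; first by rewrite addn0.
  have [_] := inv (n + m)%N; rewrite addnS (un (n + m)%N) (un (n + m).+1).
  by move=> [_ a _ b _]; split; [exact: le_trans a|exact: le_trans ih2].
have Ym n m : Y n <= Y (n + m)%N /\ Y (n + m)%N + h * S (n + m)%N <= Y n + h * S n.
  elim: m => [|m [ih1 ih2]]; first by rewrite addn0.
  have [_] := inv (n + m)%N; rewrite addnS (un (n + m)%N) (un (n + m).+1).
  by move=> [_ _ a _ [b _]]; split; [exact: le_trans a|exact: le_trans ih2].
have S_ge0 n : 0 <= S n by have [[-> _ _] _] := inv n; rewrite exprn_ge0 // invr_ge0.
(* The common point is, in each coordinate, the supremum of the left ends: every right end is an
   upper bound of all of them. *)
have limit (Z : nat -> R) k : 0 <= k ->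
    (forall n m, Z n <= Z (n + m)%N /\ Z (n + m)%N + k * S (n + m)%N <= Z n + k * S n) ->
    exists c, forall n, Z n <= c <= Z n + k * S n.
  move=> k0 Zm; have ub n : ubound (range Z) (Z n + k * S n).
    move=> _ [m _ <-]; have [nm|mn] := leqP n m.
      have [_] := Zm n (m - n)%N; rewrite subnKC //; apply: le_trans.
      by rewrite lerDl mulr_ge0.
    have [a _] := Zm m (n - m)%N; move: a; rewrite subnKC; last exact: ltnW.
    by move=> a; apply: (le_trans a); rewrite lerDl mulr_ge0.
  have ne : range Z !=set0 by exists (Z 0%N), 0%N.
  exists (sup (range Z)) => n; apply/andP; split.
    by apply: ub_le_sup; [exists (Z 0%N + k * S 0%N); exact: ub|exists n].
  by apply: ge_sup => //; exact: ub.
have [a aP] := limit X w w0 Xm; have [b bP] := limit Y h h0 Ym.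
have [d d0 dP] : exists2 d, 0 < d & forall x y s, 0 < s < d -> sub x y s ->
    inrect x (x + w * s) y (y + h * s) (Complex a b) -> P x y s.
  apply: loc; have := aP 0%N; have := bP 0%N.
  by rewrite /inrect /X /Y /S /= !mulr1 => -> ->.
have [n nd] : exists n, 2^-1 ^+ n < d.
  have := @cvg_geometric R 1 2^-1; rewrite ger0_norm ?invr_ge0 // invf_lt1 // ltr1n.
  move=> /(_ isT) /cvgrPdist_lt /(_ _ d0) [n _ /(_ n (leqnn n))] /=.
  rewrite sub0r normrN /geometric /= mul1r ger0_norm; first by exists n.
  by rewrite exprn_ge0 // invr_ge0.
have [[Sn sb nPn] _] := inv n; apply: nPn; apply: dP => //.
  by rewrite Sn nd exprn_gt0 // invr_gt0.
by rewrite /inrect /= aP bP.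
Qed.

End Quadrisection.

(** Boundedness passes from four quarters to their union and holds near each point by continuity: an
    instance of [quadrisection]. *)
Lemma continuous_rect_bounded f x0 x1 y0 y1 : x0 <= x1 -> y0 <= y1 ->
  (forall z, inrect x0 x1 y0 y1 z -> ccont f z) ->
  exists M, forall z, inrect x0 x1 y0 y1 z -> nm (f z) <= M.
Proof.
move=> xx yy fc; pose w := x1 - x0; pose h := y1 - y0.
pose P x y s := exists M, forall z, inrect x (x + w * s) y (y + h * s) z -> nm (f z) <= M.
have w0 : 0 <= w by rewrite subr_ge0.
have h0 : 0 <= h by rewrite subr_ge0.
have := @quadrisection P x0 y0 w h w0 h0; rewrite /P !mulr1 /w /h !subrKC; apply.
  move=> x y s s0 _ [M1 H1] [M2 H2] [M3 H3] [M4 H4].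
  have ews : (x1 - x0) * s = (x1 - x0) * (s / 2) + (x1 - x0) * (s / 2) by field.
  have ehs : (y1 - y0) * s = (y1 - y0) * (s / 2) + (y1 - y0) * (s / 2) by field.
  exists (Num.max (Num.max M1 M2) (Num.max M3 M4)) => z.
  rewrite /inrect ews ehs !addrA => /andP[/andP[a b] /andP[c d]]; rewrite !le_max.
  case: (leP (Re z) (x + (x1 - x0) * (s / 2))) => [rz|/ltW rz];
  case: (leP (Im z) (y + (y1 - y0) * (s / 2))) => [iz|/ltW iz].
  - by rewrite H1 // /inrect a rz c iz.
  - by rewrite (H3 z) ?orbT // /inrect a rz iz d.
  - by rewrite (H2 z) ?orbT // /inrect rz b c iz.
  - by rewrite (H4 z) ?orbT // /inrect rz b d iz.
move=> p pr; have /contCP/(_ 1 ltr01)[d d0 dP] := fc p pr.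
(* Two points of a rectangle of scale s are within (w + h) s of each other; the 1 keeps the
   denominator positive when the initial rectangle is a point. *)
exists (d / (w + h + 1)); first by rewrite divr_gt0 // ltr_wpDl // addr_ge0.
move=> x y s /andP[s0]; rewrite ltr_pdivlMr; last by rewrite ltr_wpDl // addr_ge0.
move=> sd _ /andP[/andP[a b] /andP[c e]].
exists (nm (f p) + 1) => z /andP[/andP[a' b'] /andP[c' e']].
have : nm (f z - f p) <= 1.
  apply: dP; apply: le_lt_trans (nm_le_ReIm _) _; rewrite cReB cImB.
  have : `|Re z - Re p| <= w * s by rewrite ler_norml /w; apply/andP; split; lra.
  have : `|Im z - Im p| <= h * s by rewrite ler_norml /h; apply/andP; split; lra.
  nra.
have := ler_nmD (f z - f p) (f p); rewrite subrK; lra.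
Qed.

End RectangleIntegral.

(** * Goursat's lemma *)

Section CauchyTheory.
Variable R : realType.
Local Notation C := R[i].
Implicit Types (x y t h s e d M : R) (f g G : C -> C) (z p w : C) (E : seq C).

Lemma le_eps0 (a : R) : (forall e, 0 < e -> a <= e) -> a <= 0.
Proof.
by move=> H; rewrite leNgt; apply/negP => a0; have := H (a / 2); lra.
Qed.

Lemma nm_le0 z : nm z <= 0 -> z = 0.
Proof.
by move=> z0; apply/eqP; rewrite -nm_eq0 eq_le z0 nm_ge0.
Qed.

Lemma inrect_sub x0 x1 y0 y1 a b c k z : x0 <= a -> b <= x1 -> y0 <= c -> k <= y1 ->
  inrect a b c k z -> inrect x0 x1 y0 y1 z.
Proof.
move=> xa bx yc ky /andP[/andP[? ?] /andP[? ?]].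
by rewrite /inrect; apply/andP; split; apply/andP; split; lra.
Qed.

Lemma rectint_quarter f x y a b e : 0 <= a -> 0 <= b ->
  (forall c d k l, x <= c -> c <= d -> d <= x + a + a ->
     y <= k -> k <= l -> l <= y + b + b -> sidesint f c d k l) ->
  nm (rectint f x (x + a) y (y + b)) <= e ->
  nm (rectint f (x + a) (x + a + a) y (y + b)) <= e ->
  nm (rectint f x (x + a) (y + b) (y + b + b)) <= e ->
  nm (rectint f (x + a) (x + a + a) (y + b) (y + b + b)) <= e ->
  nm (rectint f x (x + a + a) y (y + b + b)) <= 4 * e.
Proof.
move=> a0 b0 sint H1 H2 H3 H4.
rewrite (@rectint_splitx _ _ _ (x + a)); last 2 first.
- by clear -a0; apply/andP; split; lra.
- by apply: sint; clear -a0 b0; lra.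
have yb : y <= y + b <= y + b + b by clear -b0; apply/andP; split; lra.
rewrite (@rectint_splity _ _ x (x + a) y (y + b)) //; last first.
  by apply: sint; clear -a0 b0; lra.
rewrite (@rectint_splity _ _ (x + a) (x + a + a) y (y + b)) //; last first.
  by apply: sint; clear -a0 b0; lra.
apply: (le_trans (ler_nmD _ _)); apply: (le_trans (lerD (ler_nmD _ _) (ler_nmD _ _))).
have -> : 4 * e = (e + e) + (e + e) by ring.
exact: lerD (lerD H1 H3) (lerD H2 H4).
Qed.

Lemma goursat f x0 x1 y0 y1 : x0 <= x1 -> y0 <= y1 ->
  (forall z, inrect x0 x1 y0 y1 z -> holo f z) -> rectint f x0 x1 y0 y1 = 0.
Proof.
move=> xx yy fh; pose w := x1 - x0; pose h := y1 - y0.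
have w0 : 0 <= w by rewrite subr_ge0.
have h0 : 0 <= h by rewrite subr_ge0.
have ex1 : x0 + w = x1 by rewrite /w subrKC.
have ey1 : y0 + h = y1 by rewrite /h subrKC.
clearbody w h.
have sint a b c d : x0 <= a -> a <= b -> b <= x1 -> y0 <= c -> c <= d -> d <= y1 ->
    sidesint f a b c d.
  move=> *; apply: continuous_sidesint => // z zr.
  by apply: holo_cont; apply: fh; exact: inrect_sub zr.
apply: nm_le0; apply: le_eps0 => e e0.
(* The bound scales like the area, so four quarters with e (s/2)^2 each add up to e s^2. *)
pose P x y s := nm (rectint f x (x + w * s) y (y + h * s)) <= e * s ^+ 2.
have := @quadrisection _ P x0 y0 w h w0 h0.
rewrite /P !mulr1 ex1 ey1 expr1n mulr1; apply => //.
  move=> x y s s0 /and4P[sa sb sc sd].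
  have ews : w * s = w * (s / 2) + w * (s / 2) by field.
  have ehs : h * s = h * (s / 2) + h * (s / 2) by field.
  have ws : 0 <= w * (s / 2) by rewrite mulr_ge0 // divr_ge0 // ltW.
  have hs : 0 <= h * (s / 2) by rewrite mulr_ge0 // divr_ge0 // ltW.
  have -> : e * s ^+ 2 = 4 * (e * (s / 2) ^+ 2) by field.
  move: sc sd; rewrite ews ehs !addrA => sc sd.
  move=> H1 H2 H3 H4; apply: rectint_quarter => // c d k l c1 c2 c3 c4 c5 c6.
  by apply: sint => //; [exact: le_trans c1|exact: le_trans sc|exact: le_trans c4|exact: le_trans sd].
move=> p pr; have /holoP[l lP] := fh p pr.
(* A function bounded by eps (w + h) s on a boundary of half perimeter (w + h) s has integral at
   most 4 eps ((w + h) s)^2, by [rectint_bound]; with eps = e / (4 (w + h)^2 + 1) this is at most e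
   s^2. *)
have K0 : 0 < 4 * (w + h) ^+ 2 + 1 by rewrite ltr_wpDl // mulr_ge0 // sqr_ge0.
have [d d0 dP] := lP (e / (4 * (w + h) ^+ 2 + 1)) (divr_gt0 e0 K0).
exists (d / (w + h + 1)); first by rewrite divr_gt0 // ltr_wpDl // addr_ge0.
move=> x y s /andP[s0]; rewrite ltr_pdivlMr; last by rewrite ltr_wpDl // addr_ge0.
move=> sd /and4P[sa sb sc se] /andP[/andP[a b] /andP[c k]].
have ws : 0 <= w * s by rewrite mulr_ge0 // ltW.
have hs : 0 <= h * s by rewrite mulr_ge0 // ltW.
have xx' : x <= x + w * s by rewrite lerDl.
have yy' : y <= y + h * s by rewrite lerDl.
(* The affine approximation of f at p has integral 0, so only the remainder counts. *)
pose aff := fun z => (f p - l * p) + l * z.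
have s1 : sidesint f x (x + w * s) y (y + h * s).
  by apply: sint.
have s2 : sidesint aff x (x + w * s) y (y + h * s).
  by apply: continuous_sidesint => // z _; exact: ccont_affine.
have -> : rectint f x (x + w * s) y (y + h * s) =
    rectint (fun z => f z - 1 * aff z) x (x + w * s) y (y + h * s).
  by rewrite rectint_lin // [rectint aff _ _ _ _]rectint_affine // mulr0 subr0.
have := @rectint_bound _ (fun z => f z - 1 * aff z)
  (e / (4 * (w + h) ^+ 2 + 1) * ((w + h) * s)) _ _ _ _ xx' yy' (sidesint_lin 1 s1 s2).
have e1 : 0 <= e / (4 * (w + h) ^+ 2 + 1) by rewrite divr_ge0 // ltW.
move=> H; apply: (le_trans (H _)).
  move=> z /andP[/andP[/andP[a' b'] /andP[c' k']] _].
  have zp : nm (z - p) <= (w + h) * s.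
    apply: le_trans (nm_le_ReIm _) _; rewrite cReB cImB.
    have h1 : `|Re z - Re p| <= w * s.
      by rewrite ler_norml; clear -a b a' b'; apply/andP; split; lra.
    have h2 : `|Im z - Im p| <= h * s.
      by rewrite ler_norml; clear -c k c' k'; apply/andP; split; lra.
    by rewrite mulrDl lerD.
  have -> : f z - 1 * aff z = f (p + (z - p)) - f p - l * (z - p).
    by rewrite subrKC /aff; ring.
  apply: le_trans (dP _ _) _; last by rewrite ler_wpM2l.
  by apply: le_lt_trans zp _; rewrite mulrC; apply: le_lt_trans sd; rewrite ler_wpM2l ?lerDl // ltW.
rewrite [x + w * s]addrC [y + h * s]addrC !addrK.
have -> : 4 * (e / (4 * (w + h) ^+ 2 + 1) * ((w + h) * s)) * (w * s + h * s) =
  e * s ^+ 2 * (4 * (w + h) ^+ 2 / (4 * (w + h) ^+ 2 + 1)) by field; lra.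
apply: ler_piMr; first by rewrite mulr_ge0 ?ltW // exprn_gt0.
by rewrite ler_pdivrMr // mul1r lerDl.
Qed.

Lemma exc_cint_hor f M E x0 x1 y :
  (forall t, x0 <= t <= x1 -> nm (f (Complex t y)) <= M) ->
  (forall t, x0 <= t <= x1 -> Complex t y \notin E -> ccont f (Complex t y)) ->
  pcont (fun t => f (Complex t y)) x0 x1.
Proof.
move=> fM fc; split; first by exists M.
exists (map (@complex.Re R) E) => t tt tE; apply: rcont_hor; apply: fc => //.
by apply: contra tE => tE; apply/mapP; exists (Complex t y).
Qed.

Lemma exc_cint_ver f M E x y0 y1 :
  (forall t, y0 <= t <= y1 -> nm (f (Complex x t)) <= M) ->
  (forall t, y0 <= t <= y1 -> Complex x t \notin E -> ccont f (Complex x t)) ->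
  pcont (fun t => f (Complex x t)) y0 y1.
Proof.
move=> fM fc; split; first by exists M.
exists (map (@complex.Im R) E) => t tt tE; apply: rcont_ver; apply: fc => //.
by apply: contra tE => tE; apply/mapP; exists (Complex x t).
Qed.

Definition sidespc f x0 x1 y0 y1 : Prop :=
  [/\ pcont (fun t => f (Complex t y0)) x0 x1,
      pcont (fun t => f (Complex t y1)) x0 x1,
      pcont (fun t => f (Complex x0 t)) y0 y1 &
      pcont (fun t => f (Complex x1 t)) y0 y1].

Lemma sidespc_int f x0 x1 y0 y1 : sidespc f x0 x1 y0 y1 -> sidesint f x0 x1 y0 y1.
Proof. by case=> *; split; exact: pcont_integrable. Qed.

Lemma exc_sides f M E x0 x1 y0 y1 : x0 <= x1 -> y0 <= y1 ->
  (forall z, inrect x0 x1 y0 y1 z -> nm (f z) <= M) ->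
  (forall z, inrect x0 x1 y0 y1 z -> z \notin E -> ccont f z) ->
  sidespc f x0 x1 y0 y1.
Proof.
move=> xx yy fM fc.
split; [apply: (@exc_cint_hor _ M E)|apply: (@exc_cint_hor _ M E)
       |apply: (@exc_cint_ver _ M E)|apply: (@exc_cint_ver _ M E)] => t tt;
 [apply: fM|apply: fc|apply: fM|apply: fc|apply: fM|apply: fc|apply: fM|apply: fc];
 by rewrite /inrect /= ?lexx ?tt ?xx ?yy.
Qed.

(** The place to cut before p, at distance at most d. If p is too close to the end a, the cut is at
    a itself and the strip cut off has width 0. *)
Lemma cut_below (a p d : R) : a <= p -> 0 < d ->
  exists b, [/\ a <= b, b <= p, b = a \/ b < p & p - d <= b].
Proof.
move=> ap d0; have [h|h] := leP a (p - d).
  by exists (p - d); split => //; [lra|right; lra].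
by exists a; split => //; [left|lra].
Qed.

Lemma cut_above (a p d : R) : p <= a -> 0 < d ->
  exists b, [/\ p <= b, b <= a, b = a \/ p < b & b <= p + d].
Proof.
move=> ap d0; have [h|h] := leP (p + d) a.
  by exists (p + d); split => //; [lra|right; lra].
by exists a; split => //; [left|lra].
Qed.

(** Induction on the list. A rectangle of sides at most 2 d is cut out around an exceptional point
    p; the four other pieces avoid p or are degenerate, and the piece around p contributes little
    because f is bounded. *)
Lemma goursat_exc E f M x0 x1 y0 y1 : x0 <= x1 -> y0 <= y1 ->
  (forall z, inrect x0 x1 y0 y1 z -> nm (f z) <= M) ->
  (forall z, inrect x0 x1 y0 y1 z -> z \notin E -> holo f z) ->
  rectint f x0 x1 y0 y1 = 0.
Proof.
elim: E x0 x1 y0 y1 => [|p E IH] x0 x1 y0 y1 xx yy fM fh.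
  by apply: goursat => // z zr; exact: fh.
have [pr|pnr] := boolP (inrect x0 x1 y0 y1 p); last first.
  apply: IH => // z zr zE; apply: fh => //; rewrite inE negb_or zE andbT.
  by apply: contra pnr => /eqP <-.
have M0 : 0 <= M by apply: le_trans (fM _ pr); exact: nm_ge0.
have sint a b c d : x0 <= a -> a <= b -> b <= x1 -> y0 <= c -> c <= d -> d <= y1 ->
    sidesint f a b c d.
  move=> *; apply: sidespc_int; apply: (@exc_sides _ M (p :: E)) => //.
    by move=> z zr; apply: fM; exact: inrect_sub zr.
  by move=> z zr zE; apply: holo_cont; apply: fh => //; exact: inrect_sub zr.
have off a b c d : x0 <= a -> a <= b -> b <= x1 -> y0 <= c -> c <= d -> d <= y1 ->
    ~~ inrect a b c d p -> rectint f a b c d = 0.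
  move=> ? ? ? ? ? ? np; apply: IH => // z zr.
    by apply: fM; exact: inrect_sub zr.
  move=> zE; apply: fh; first exact: inrect_sub zr.
  by rewrite inE negb_or zE andbT; apply: contra np => /eqP <-.
apply: nm_le0; apply: le_eps0 => e e0.
(* The piece around p has half perimeter at most 4 d, so [rectint_bound] gives 16 M d. *)
pose d := e / (16 * M + 1).
have d0 : 0 < d by rewrite divr_gt0 // ltr_wpDl // mulr_ge0.
case/andP: (pr) => /andP[p1 p2] /andP[p3 p4].
have [a [xa aRe aE ad]] := cut_below p1 d0.
have [b [Reb bx bE bd]] := cut_above p2 d0.
have [c [yc cIm cE cd]] := cut_below p3 d0.
have [k [Imk ky kE kd]] := cut_above p4 d0.
have Rep := le_trans aRe Reb; have Imp := le_trans cIm Imk.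
have ax1 := le_trans Rep bx; have x0b := le_trans xa Rep.
have ck1 := le_trans Imp ky; have y0k := le_trans yc Imp.
rewrite (@rectint_splitx _ _ _ a); [|by rewrite xa|exact: sint].
have -> : rectint f x0 a y0 y1 = 0.
  case: aE => [->|ap]; first exact: rectint_degx.
  by apply: off => //; rewrite /inrect (lt_geF ap) andbF.
rewrite add0r (@rectint_splitx _ _ _ b); [|by rewrite Rep|exact: sint].
have -> : rectint f b x1 y0 y1 = 0.
  case: bE => [->|bp]; first exact: rectint_degx.
  by apply: off => //; rewrite /inrect (lt_geF bp).
rewrite addr0 (@rectint_splity _ _ _ _ _ c); [|by rewrite yc|exact: sint].
have -> : rectint f a b y0 c = 0.
  case: cE => [->|cp]; first exact: rectint_degy.
  by apply: off => //; rewrite /inrect (lt_geF cp) !andbF.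
rewrite add0r (@rectint_splity _ _ _ _ _ k); [|by rewrite Imp|exact: sint].
have -> : rectint f a b k y1 = 0.
  case: kE => [->|kp]; first exact: rectint_degy.
  by apply: off => //; rewrite /inrect (lt_geF kp) /= andbF.
rewrite addr0; apply: le_trans (@rectint_bound _ _ M _ _ _ _ Rep Imp _ _) _.
- exact: sint.
- by move=> z /andP[zr _]; apply: fM; exact: inrect_sub zr.
have Md : (16 * M + 1) * d = e by rewrite /d mulrC divfK // gt_eqF // ltr_wpDl // mulr_ge0.
clearbody d; clear -M0 ad bd cd kd Md d0.
have h : (b - a) + (k - c) <= 4 * d by lra.
have := ler_wpM2l M0 h; lra.
Qed.

(** A strip |Im z| <= s is cut out. Above and below it [goursat_exc] applies. On the boundary of the
    strip the long sides almost cancel because the jump is small, and the short sides have length 2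
    s. *)
Lemma goursat_line E f M x0 x1 y0 y1 : x0 <= x1 -> y0 < 0 < y1 ->
  (forall z, inrect x0 x1 y0 y1 z -> nm (f z) <= M) ->
  (forall z, inrect x0 x1 y0 y1 z -> Im z != 0 -> z \notin E -> holo f z) ->
  (forall e, 0 < e -> exists2 d, 0 < d & forall t s, x0 <= t <= x1 -> 0 < s < d ->
    nm (f (Complex t s) - f (Complex t (- s))) <= e) ->
  rectint f x0 x1 y0 y1 = 0.
Proof.
move=> xx /andP[y00 y10] fM fh fj.
have M0 : 0 <= M.
  apply: le_trans (fM (Complex x0 0) _); first exact: nm_ge0.
  by rewrite /inrect /= lexx xx !ltW.
(* Only boundedness is known where a vertical side crosses the real axis, so the crossing point
   joins the exceptional ones. *)
have ver x c k : x0 <= x <= x1 -> y0 <= c -> k <= y1 ->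
    cintegrable (fun t => f (Complex x t)) c k.
  move=> xr yc ky; apply: pcont_integrable; apply: (@exc_cint_ver _ M (Complex x 0 :: E)).
    move=> t tt; apply: fM; rewrite /inrect /= xr /=; lra.
  move=> t tt; rewrite inE negb_or => /andP[t0 tE]; apply: holo_cont; apply: fh => //.
    rewrite /inrect /= xr /=; lra.
  by apply: contra t0 => /eqP /= ->.
have hor y : y0 <= y <= y1 -> y != 0 -> cintegrable (fun t => f (Complex t y)) x0 x1.
  move=> yr yn; apply: pcont_integrable; apply: (@exc_cint_hor _ M E).
    by move=> t tt; apply: fM; rewrite /inrect /= tt yr.
  by move=> t tt tE; apply: holo_cont; apply: fh; rewrite // /inrect /= tt yr.
apply: nm_le0; apply: le_eps0 => e e0.
have k0 : 0 < 4 * (x1 - x0) + 1 by rewrite ltr_wpDl // mulr_ge0 // subr_ge0.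
have m0 : 0 < 16 * M + 1 by rewrite ltr_wpDl // mulr_ge0.
have [d d0 dP] := fj (e / (4 * (x1 - x0) + 1)) (divr_gt0 e0 k0).
(* By [cint_bound] the short sides contribute at most 8 M s, and s <= e / (16 M + 1) makes this at
   most e / 2; s < d does the same for the long sides. *)
have [s [s0 sd sM sy0 sy1]] : exists s, [/\ 0 < s, s < d, s <= e / (16 * M + 1), s <= - y0 & s <= y1].
  exists (Num.min (Num.min (d / 2) (e / (16 * M + 1))) (Num.min (- y0) y1)); split.
  - by rewrite !lt_min !divr_gt0 // oppr_gt0 y00.
  - by apply: le_lt_trans (_ : d / 2 < d); [rewrite !ge_min lexx|clear -d0; lra].
  - by rewrite !ge_min lexx ?orbT.
  - by rewrite !ge_min lexx ?orbT.
  - by rewrite !ge_min lexx ?orbT.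
have sint c k : y0 <= c <= y1 -> y0 <= k <= y1 -> c != 0 -> k != 0 -> c <= k ->
    sidesint f x0 x1 c k.
  move=> /andP[c1 c2] /andP[k1 k2] cn kn ck.
  by split; [apply: hor => //; rewrite c1|apply: hor => //; rewrite k1
    |apply: ver; rewrite ?lexx|apply: ver; rewrite ?lexx ?xx].
have sn : - s != 0 by rewrite oppr_eq0 gt_eqF.
have sp : s != 0 by rewrite gt_eqF.
have y0n : y0 != 0 by rewrite lt_eqF.
have y1n : y1 != 0 by rewrite gt_eqF.
have ys : y0 <= - s by rewrite lerNr.
have ss : - s <= s by rewrite ge0_cp ?ltW.
have sy : - s <= y1 := le_trans ss sy1.
have ys' : y0 <= s := le_trans ys ss.
have yy : y0 <= y1 := le_trans ys' sy1.
rewrite (@rectint_splity _ _ _ _ _ (- s)); [|by rewrite ys|by apply: sint => //; rewrite lexx yy].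
have -> : rectint f x0 x1 y0 (- s) = 0.
  apply: (@goursat_exc E _ M) => //.
    by move=> z zr; apply: fM; exact: inrect_sub zr.
  move=> z zr zE; apply: fh => //; first exact: inrect_sub zr.
  case/and3P: zr => _ _ zs; rewrite lt_eqF //; apply: le_lt_trans zs _.
  by rewrite oppr_lt0.
rewrite add0r (@rectint_splity _ _ _ _ _ s); [|by rewrite ss|by apply: sint => //; rewrite ?lexx ?yy ?ys ?sy].
have -> : rectint f x0 x1 s y1 = 0.
  apply: (@goursat_exc E _ M) => //.
    by move=> z zr; apply: fM; exact: inrect_sub zr.
  move=> z zr zE; apply: fh => //; first exact: inrect_sub zr.
  by case/and3P: zr => _ zs _; rewrite gt_eqF //; apply: lt_le_trans zs.
rewrite addr0 /rectint -cintB; [|by apply: hor => //; rewrite ?ys ?sy|by apply: hor => //; rewrite ?ys' ?sy1].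
apply: (le_trans (ler_nmD _ _)); rewrite nmM nm_i mul1r.
have B1 : nm (cint (fun t => f (Complex t (- s)) - f (Complex t s)) x0 x1) <=
    2 * (e / (4 * (x1 - x0) + 1)) * (x1 - x0).
  apply: cint_bound => //.
    by apply: cintegrableB; apply: hor; rewrite ?ys ?sy ?ys' ?sy1.
  by move=> t tt; rewrite nm_distC; apply: dP => //; rewrite s0.
have B2 x : x0 <= x <= x1 -> nm (cint (fun t => f (Complex x t)) (- s) s) <= 2 * M * (s - - s).
  move=> xr; apply: cint_bound => //; first exact: ver.
  move=> t /andP[t1 t2]; apply: fM; rewrite /inrect /= xr /=.
  by rewrite (le_trans ys t1) (le_trans t2 sy1).
have B3 := ler_nmB (cint (fun t => f (Complex x1 t)) (- s) s) (cint (fun t => f (Complex x0 t)) (- s) s).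
have := B2 x0; have := B2 x1; rewrite !lexx xx => /(_ isT) B4 /(_ isT) B5.
have E1 : 2 * (e / (4 * (x1 - x0) + 1)) * (x1 - x0) <= e / 2.
  have h1 : e / (4 * (x1 - x0) + 1) * (4 * (x1 - x0) + 1) = e by rewrite divfK // gt_eqF.
  have h2 : 0 < e / (4 * (x1 - x0) + 1) by rewrite divr_gt0.
  move: h1 h2; set u := e / _; clear; lra.
have E2 : 8 * M * s <= e / 2.
  move: sM; rewrite ler_pdivlMr //; clear -s0; lra.
apply: le_trans (lerD B1 (le_trans B3 (lerD B4 B5))) _.
apply: le_trans (lerD E1 (_ : _ <= e / 2)) _; last by clear; lra.
by clear -E2; lra.
Qed.

End CauchyTheory.

(** * Cauchy's formula *)

Section CauchyFormula.
Variable R : realType.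
Local Notation C := R[i].
Implicit Types (x y t s e d M : R) (f g G : C -> C) (z p w h : C) (E : seq C).

Lemma Re_inv z : Re z^-1 = Re z / nm z ^+ 2.
Proof. by rewrite nm_sqr; case: z. Qed.

Lemma Im_inv z : Im z^-1 = - Im z / nm z ^+ 2.
Proof. by rewrite nm_sqr; case: z => a b /=; rewrite mulNr. Qed.

Lemma pcont_inv (gam : R -> C) z a b d : 0 < d ->
  (forall t, a <= t <= b -> rcont gam t) ->
  (forall t, a <= t <= b -> d <= nm (gam t - z)) ->
  pcont (fun t => (gam t - z)^-1) a b.
Proof.
move=> d0 gc gd; split.
  by exists d^-1 => t /gd h; rewrite nmV lef_pV2 // posrE (lt_le_trans d0).
exists [::] => t tt _; apply: cvgV.
  by rewrite -nm_gt0 (lt_le_trans d0) // gd.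
by apply: cvgB; [exact: gc|exact: cvg_cst].
Qed.

Lemma inv_taylor (u h : C) : u != 0 -> u - h != 0 ->
  (u - h)^-1 - u^-1 - h / u ^+ 2 = h ^+ 2 / (u ^+ 2 * (u - h)).
Proof. by move=> u0 uh; field; rewrite ?u0 ?uh. Qed.

(** Differentiation under the integral sign: the derivative is the integral of phi / (gam - z)^2.
    The distance d from z to the side makes the remainder in [inv_taylor] of order |h|^2 uniformly
    in t. *)
Lemma cauchy_side_holo (phi gam : R -> C) z a b d : a <= b -> 0 < d ->
  pcont phi a b -> (forall t, a <= t <= b -> rcont gam t) ->
  (forall t, a <= t <= b -> d <= nm (gam t - z)) ->
  holo (fun w => cint (fun t => phi t / (gam t - w)) a b) z.
Proof.
move=> ab d0 pp gc gd; have d2 : 0 < d / 2 by rewrite divr_gt0.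
have far h t : nm h < d / 2 -> a <= t <= b -> d / 2 <= nm (gam t - (z + h)).
  move=> hd tt; rewrite opprD addrA; have := gd t tt.
  have := lerB_nm (gam t - z) h; move: hd; clear; lra.
have pinv h : nm h < d / 2 -> pcont (fun t => (gam t - (z + h))^-1) a b.
  by move=> hd; apply: (@pcont_inv _ _ _ _ (d / 2)) => // t; exact: far.
have pinv0 : pcont (fun t => (gam t - z)^-1) a b by exact: (@pcont_inv _ _ _ _ d).
have [[M hM] _] := pp.
have M0 : 0 <= M by apply: le_trans (hM a _); [exact: nm_ge0|rewrite lexx ab].
pose l := cint (fun t => phi t * ((gam t - z)^-1 * (gam t - z)^-1)) a b.
apply/holoP; exists l => e e0.
(* [K - 1] is the [cint_bound] of the remainder divided by |h|^2, from |gam t - z| >= d and, for |h|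
   < d/2, |gam t - z - h| >= d/2. *)
pose K := 2 * (M * 2 / d ^+ 3) * (b - a) + 1.
have d3 : 0 < d ^+ 3 by rewrite exprn_gt0.
have K0 : 0 < K.
  apply: ltr_wpDl => //; apply: mulr_ge0; last by rewrite subr_ge0.
  by apply: mulr_ge0 => //; apply: divr_ge0; [exact: mulr_ge0|exact: ltW].
exists (Num.min (d / 2) (e / K)); first by rewrite lt_min d2 divr_gt0.
move=> h; rewrite lt_min => /andP[hd he].
have i1 : cintegrable (fun t => phi t * (gam t - (z + h))^-1) a b.
  exact: pcont_integrable (pcontM pp (pinv h hd)).
have i2 : cintegrable (fun t => phi t * (gam t - z)^-1) a b.
  exact: pcont_integrable (pcontM pp pinv0).
have i3 : cintegrable (fun t => phi t * ((gam t - z)^-1 * (gam t - z)^-1)) a b.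
  exact: pcont_integrable (pcontM pp (pcontM pinv0 pinv0)).
rewrite [l * h]mulrC /l -cintB // -cintZ // -cintB //; try exact: cintegrableZ; last first.
  exact: cintegrableB.
have : nm (cint (fun t => phi t / (gam t - (z + h)) - phi t / (gam t - z) -
    h * (phi t * ((gam t - z)^-1 * (gam t - z)^-1))) a b) <=
    2 * (M * 2 / d ^+ 3 * nm h ^+ 2) * (b - a).
  apply: cint_bound => //.
    by apply: cintegrableB; [exact: cintegrableB|exact: cintegrableZ].
  move=> t tt; have D1 := gd t tt; have D2 := far h t hd tt.
  have u0 : gam t - z != 0 by rewrite -nm_gt0 (lt_le_trans d0).
  have uh : gam t - z - h != 0 by rewrite -addrA -opprD -nm_gt0 (lt_le_trans d2).
  have -> : phi t / (gam t - (z + h)) - phi t / (gam t - z) -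
      h * (phi t * ((gam t - z)^-1 * (gam t - z)^-1)) =
      phi t * (h ^+ 2 / ((gam t - z) ^+ 2 * (gam t - z - h))).
    rewrite -inv_taylor // opprD addrA expr2 invfM; ring.
  rewrite !(nmM, nmV, nmX).
  have -> : M * 2 / d ^+ 3 * nm h ^+ 2 = M * (nm h ^+ 2 / (d ^+ 2 * (d / 2))).
    by field; rewrite gt_eqF.
  apply: ler_pM => //; rewrite ?nm_ge0 ?hM //.
    by rewrite mulr_ge0 ?exprn_ge0 ?invr_ge0 ?mulr_ge0 ?exprn_ge0 ?nm_ge0.
  apply: ler_pM => //; rewrite ?exprn_ge0 ?nm_ge0 //.
    by rewrite invr_ge0 mulr_ge0 ?exprn_ge0 ?nm_ge0.
  rewrite lef_pV2 ?posrE; last 2 first.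
  - by rewrite mulr_gt0 ?exprn_gt0 ?nm_gt0.
  - by rewrite mulr_gt0 // exprn_gt0.
  apply: ler_pM; [by rewrite exprn_ge0 // ltW|exact: ltW d2| |].
    by rewrite lerXn2r // ?nnegrE ?nm_ge0 // ltW.
  by move: D2; rewrite opprD addrA.
move=> H; rewrite [X in X <= _](_ : _ = nm (cint (fun t => phi t / (gam t - (z + h)) -
    phi t / (gam t - z) - h * (phi t * ((gam t - z)^-1 * (gam t - z)^-1))) a b)) //.
apply: le_trans H _.
have -> : 2 * (M * 2 / d ^+ 3 * nm h ^+ 2) * (b - a) = (K - 1) * nm h * nm h.
  by rewrite /K; ring.
rewrite ler_wpM2r ?nm_ge0 //.
have : K * nm h <= e by rewrite mulrC -ler_pdivlMr // ltW.
have := nm_ge0 h; clear; lra.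
Qed.

Definition inint x0 x1 y0 y1 z : bool := (x0 < Re z < x1) && (y0 < Im z < y1).

(** The numerator of Cauchy's formula; [cauchyW] is its denominator, which equals 2 pi i inside the
    rectangle but enters only as a holomorphic function without zeros. *)
Definition cauchyN G x0 x1 y0 y1 z := rectint (fun p => G p / (p - z)) x0 x1 y0 y1.

Definition cauchyW x0 x1 y0 y1 z := rectint (fun p => (p - z)^-1) x0 x1 y0 y1.

Lemma inint_inrect x0 x1 y0 y1 z : inint x0 x1 y0 y1 z -> inrect x0 x1 y0 y1 z.
Proof. by case/andP => /andP[a b] /andP[c d]; rewrite /inrect !ltW. Qed.

Lemma rcont_horp y t : rcont (fun u => Complex u y) t.
Proof. by apply: (@rcont_hor R id); exact: cvg_id. Qed.

Lemma rcont_verp x t : rcont (fun u => Complex x u) t.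
Proof. by apply: (@rcont_ver R id); exact: cvg_id. Qed.

Lemma side_dist x0 x1 y0 y1 z t : inint x0 x1 y0 y1 z ->
  [/\ Im z - y0 <= nm (Complex t y0 - z), y1 - Im z <= nm (Complex t y1 - z),
      Re z - x0 <= nm (Complex x0 t - z) & x1 - Re z <= nm (Complex x1 t - z)].
Proof.
move=> _; split.
- by apply: le_trans (Im_le_nm _); rewrite cImB /= distrC ler_norm.
- by apply: le_trans (Im_le_nm _); rewrite cImB /= ler_norm.
- by apply: le_trans (Re_le_nm _); rewrite cReB /= distrC ler_norm.
- by apply: le_trans (Re_le_nm _); rewrite cReB /= ler_norm.
Qed.

Lemma cauchyN_holo G x0 x1 y0 y1 z : inint x0 x1 y0 y1 z ->
  sidespc G x0 x1 y0 y1 -> holo (cauchyN G x0 x1 y0 y1) z.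
Proof.
move=> zi [h0 h1 v0 v1].
case/andP: (zi) => /andP[a b] /andP[c d]; have xx := ltW (lt_trans a b).
have yy := ltW (lt_trans c d).
apply: holoD; first apply: holoB.
- apply: (@cauchy_side_holo (fun t => G (Complex t y0)) (fun t => Complex t y0) z _ _ (Im z - y0)) => //.
  + by rewrite subr_gt0.
  + by move=> t _; exact: rcont_horp.
  + by move=> t _; case: (side_dist t zi).
- apply: (@cauchy_side_holo (fun t => G (Complex t y1)) (fun t => Complex t y1) z _ _ (y1 - Im z)) => //.
  + by rewrite subr_gt0.
  + by move=> t _; exact: rcont_horp.
  + by move=> t _; case: (side_dist t zi).
apply: holoM; first exact: holo_cst.
apply: holoB.
- apply: (@cauchy_side_holo (fun t => G (Complex x1 t)) (fun t => Complex x1 t) z _ _ (x1 - Re z)) => //.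
  + by rewrite subr_gt0.
  + by move=> t _; exact: rcont_verp.
  + by move=> t _; case: (side_dist t zi).
- apply: (@cauchy_side_holo (fun t => G (Complex x0 t)) (fun t => Complex x0 t) z _ _ (Re z - x0)) => //.
  + by rewrite subr_gt0.
  + by move=> t _; exact: rcont_verp.
  + by move=> t _; case: (side_dist t zi).
Qed.

Lemma sidespc_cst (k : C) x0 x1 y0 y1 : sidespc (fun=> k) x0 x1 y0 y1.
Proof. by split; exact: pcont_cst. Qed.

Lemma cauchyWE x0 x1 y0 y1 : cauchyW x0 x1 y0 y1 = cauchyN (fun=> 1) x0 x1 y0 y1.
Proof.
apply/funext => z; apply: (congr1 (fun f => rectint f x0 x1 y0 y1)).
by apply/funext => p; rewrite mul1r.
Qed.

Lemma sidespc_inv x0 x1 y0 y1 z : inint x0 x1 y0 y1 z ->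
  sidespc (fun p => (p - z)^-1) x0 x1 y0 y1.
Proof.
move=> zi; case/andP: (zi) => /andP[a b] /andP[c d]; split.
- apply: (@pcont_inv (fun t => Complex t y0) _ _ _ (Im z - y0)); rewrite ?subr_gt0 // => t _.
    exact: rcont_horp.
  by case: (side_dist t zi).
- apply: (@pcont_inv (fun t => Complex t y1) _ _ _ (y1 - Im z)); rewrite ?subr_gt0 // => t _.
    exact: rcont_horp.
  by case: (side_dist t zi).
- apply: (@pcont_inv (fun t => Complex x0 t) _ _ _ (Re z - x0)); rewrite ?subr_gt0 // => t _.
    exact: rcont_verp.
  by case: (side_dist t zi).
- apply: (@pcont_inv (fun t => Complex x1 t) _ _ _ (x1 - Re z)); rewrite ?subr_gt0 // => t _.
    exact: rcont_verp.
  by case: (side_dist t zi).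
Qed.

Lemma sidespcM f g x0 x1 y0 y1 : sidespc f x0 x1 y0 y1 -> sidespc g x0 x1 y0 y1 ->
  sidespc (fun p => f p * g p) x0 x1 y0 y1.
Proof. by move=> [? ? ? ?] [? ? ? ?]; split; exact: pcontM. Qed.

Local Notation mu := (@lebesgue_measure R).

Lemma Rint_le (f : R -> R) a b M : a <= b -> mu.-integrable `[a, b] (EFin \o f) ->
  (forall t, a <= t <= b -> f t <= M) ->
  \int[mu]_(t in `[a, b]) f t <= M * (b - a).
Proof.
move=> ab h fM; rewrite -Rint_cst //.
by apply: le_Rintegral => //; exact: integrable_itv_cst.
Qed.

Lemma Im_rectint f x0 x1 y0 y1 : Im (rectint f x0 x1 y0 y1) =
  (\int[mu]_(t in `[x0, x1]) Im (f (Complex t y0)) -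
   \int[mu]_(t in `[x0, x1]) Im (f (Complex t y1))) +
  (\int[mu]_(t in `[y0, y1]) Re (f (Complex x1 t)) -
   \int[mu]_(t in `[y0, y1]) Re (f (Complex x0 t))).
Proof. by rewrite /rectint cImD cImM cReB cImB /= mul0r mul1r add0r. Qed.

(* Every side is seen from z under a positive angle. *)
Lemma cauchyW_neq0 x0 x1 y0 y1 z : inint x0 x1 y0 y1 z -> cauchyW x0 x1 y0 y1 z != 0.
Proof.
move=> zi; case/andP: (zi) => /andP[a b] /andP[c d].
have xx := lt_trans a b; have yy := lt_trans c d.
have [[_ i0] [_ i1] [i2 _] [i3 _]] := sidespc_int (sidespc_inv zi).
(* [B] bounds the distance from z to any point of the sides. It makes the contribution of the bottom
   side strictly positive; for the three other sides the sign is enough. *)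
pose B := (x1 - x0) + (y1 - y0).
have B0 : 0 < B by rewrite addr_gt0 ?subr_gt0.
have J0 : (Im z - y0) / B ^+ 2 * (x1 - x0) <= \int[mu]_(t in `[x0, x1]) Im (Complex t y0 - z)^-1.
  apply: Rint_ge => //; first exact: ltW.
  move=> t /andP[t0 t1]; rewrite Im_inv cImB /= opprB.
  apply: ler_wpM2l; first by rewrite subr_ge0 ltW.
  rewrite lef_pV2 ?posrE ?exprn_gt0 //; last first.
    by rewrite nm_gt0; apply/eqP => /(congr1 (@complex.Im R)); rewrite cImB /=; clear -c; lra.
  rewrite lerXn2r ?nnegrE ?nm_ge0 ?(ltW B0) //.
  apply: le_trans (nm_le_ReIm _) _; rewrite cReB cImB /=.
  have h1 : `|t - Re z| <= x1 - x0 by rewrite ler_norml; clear -t0 t1 a b; apply/andP; split; lra.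
  have h2 : `|y0 - Im z| <= y1 - y0 by rewrite ler_norml; clear -c d; apply/andP; split; lra.
  exact: lerD.
have J1 : \int[mu]_(t in `[x0, x1]) Im (Complex t y1 - z)^-1 <= 0.
  have := @Rint_le (fun t => Im (Complex t y1 - z)^-1) x0 x1 0 (ltW xx) i1.
  rewrite mul0r; apply => t _; rewrite Im_inv mulNr oppr_le0 cImB.
  by rewrite divr_ge0 ?exprn_ge0 ?nm_ge0 //= subr_ge0 ltW.
have J2 : \int[mu]_(t in `[y0, y1]) Re (Complex x0 t - z)^-1 <= 0.
  have := @Rint_le (fun t => Re (Complex x0 t - z)^-1) y0 y1 0 (ltW yy) i2.
  rewrite mul0r; apply => t _; rewrite Re_inv cReB -oppr_ge0 -mulNr opprB.
  by rewrite divr_ge0 ?exprn_ge0 ?nm_ge0 //= subr_ge0 ltW.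
have J3 : 0 <= \int[mu]_(t in `[y0, y1]) Re (Complex x1 t - z)^-1.
  have := @Rint_ge _ (fun t => Re (Complex x1 t - z)^-1) y0 y1 0 (ltW yy) i3.
  rewrite mul0r; apply => t _; rewrite Re_inv cReB.
  by rewrite divr_ge0 ?exprn_ge0 ?nm_ge0 //= subr_ge0 ltW.
have J4 : 0 < (Im z - y0) / B ^+ 2 * (x1 - x0).
  by rewrite mulr_gt0 ?subr_gt0 // divr_gt0 ?subr_gt0 // exprn_gt0.
apply/eqP => /(congr1 (@complex.Im R)).
rewrite /cauchyW Im_rectint [complex.Im 0]/=; move: J0 J1 J2 J3 J4.
set I0 := \int[_]_(_ in _) _; set I1 := \int[_]_(_ in _) _.
set I2 := \int[_]_(_ in _) _; set I3 := \int[_]_(_ in _) _.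
clear; lra.
Qed.

(** Near z the difference quotient is within 1 of the derivative; elsewhere |p - z| >= d. At p = z
    its value is 0 / 0 = 0. *)
Lemma kernel_bounded G M x0 x1 y0 y1 z : inrect x0 x1 y0 y1 z ->
  (forall p, inrect x0 x1 y0 y1 p -> nm (G p) <= M) -> holo G z ->
  exists K, forall p, inrect x0 x1 y0 y1 p -> nm ((G p - G z) / (p - z)) <= K.
Proof.
move=> zr GM /holoP[l lP]; have [d d0 dP] := lP 1 ltr01.
exists (Num.max (nm l + 1) (2 * M / d)) => p pr; rewrite nmM nmV.
have [->|pz] := eqVneq p z.
  by rewrite !subrr nm0 mul0r le_max addr_ge0 ?nm_ge0.
have pz0 : 0 < nm (p - z) by rewrite nm_gt0 subr_eq0.
rewrite ler_pdivrMr //; have [pd|pd] := ltP (nm (p - z)) d.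
  have := dP _ pd; rewrite subrKC mul1r => H.
  rewrite (le_trans _ (_ : (nm l + 1) * nm (p - z) <= _)) //.
    have := ler_nmD (G p - G z - l * (p - z)) (l * (p - z)).
    rewrite subrK nmM mulrDl mul1r; move: H; clear; lra.
  by rewrite ler_wpM2r ?nm_ge0 // le_max lexx.
rewrite (le_trans (_ : _ <= 2 * M / d * nm (p - z))) //.
  have := ler_nmB (G p) (G z); have := GM _ pr; have := GM _ zr => h1 h2 h3.
  have M0 : 0 <= M := le_trans (nm_ge0 _) h1.
  apply: (le_trans h3); apply: (@le_trans _ _ (2 * M)); first by clear -h1 h2; lra.
  by rewrite -mulrA ler_peMr ?mulr_ge0 // mulrC ler_pdivlMr // mul1r.
by rewrite ler_wpM2r ?nm_ge0 // le_max lexx orbT.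
Qed.

Lemma kernel_holo G z p : p != z -> holo G p -> holo (fun w => (G w - G z) / (w - z)) p.
Proof.
move=> pz hG.
have h1 : holo (fun w => G w - G z) p := holoB hG (@holo_cst R (G z) p).
have h2 : holo (fun w => w - z) p := holoB (@holo_id R p) (@holo_cst R z p).
have pz0 : p - z != 0 by rewrite subr_eq0.
have h3 : holo (fun w => (w - z)^-1) p := @holoV R (fun w => w - z) p pz0 h2.
exact: (@holoM R (fun w => G w - G z) (fun w => (w - z)^-1) p h1 h3).
Qed.

Lemma cauchy_formula G x0 x1 y0 y1 z : inint x0 x1 y0 y1 z -> sidespc G x0 x1 y0 y1 ->
  rectint (fun p => (G p - G z) / (p - z)) x0 x1 y0 y1 = 0 ->
  G z * cauchyW x0 x1 y0 y1 z = cauchyN G x0 x1 y0 y1 z.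
Proof.
move=> zi sG; have sI := sidespc_inv zi.
have -> : (fun p => (G p - G z) / (p - z)) = (fun p => G p / (p - z) - G z * (p - z)^-1).
  by apply/funext => p; rewrite mulrBl.
rewrite rectint_lin; last exact: sidespc_int.
  by move/eqP; rewrite subr_eq0 => /eqP.
by apply: sidespc_int; exact: sidespcM.
Qed.

(** The quotient N / W depends only on the values of G on the sides and is holomorphic in the whole
    interior, even where G is not. [Z] collects the points at which the kernel integral is known to
    vanish. *)
Lemma cauchy_extend G x0 x1 y0 y1 (Z : set C) : sidespc G x0 x1 y0 y1 ->
  (forall z, inint x0 x1 y0 y1 z -> Z z ->
    rectint (fun p => (G p - G z) / (p - z)) x0 x1 y0 y1 = 0) ->
  exists H : C -> C, forall z, inint x0 x1 y0 y1 z -> holo H z /\ (Z z -> H z = G z).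
Proof.
move=> sG GK; exists (fun z => cauchyN G x0 x1 y0 y1 z / cauchyW x0 x1 y0 y1 z) => z zi.
have W0 := cauchyW_neq0 zi; split.
  have hN := cauchyN_holo zi sG.
  have hW : holo (cauchyW x0 x1 y0 y1) z.
    by rewrite cauchyWE; exact: cauchyN_holo zi (sidespc_cst 1 _ _ _ _).
  have hV : holo (fun w => (cauchyW x0 x1 y0 y1 w)^-1) z := @holoV R _ z W0 hW.
  exact: (@holoM R _ (fun w => (cauchyW x0 x1 y0 y1 w)^-1) z hN hV).
by move=> Zz; rewrite -(cauchy_formula zi sG (GK z zi Zz)) mulfK.
Qed.

Lemma riemann_removable G M E x0 x1 y0 y1 : x0 <= x1 -> y0 <= y1 ->
  (forall z, inrect x0 x1 y0 y1 z -> nm (G z) <= M) ->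
  (forall z, inrect x0 x1 y0 y1 z -> z \notin E -> holo G z) ->
  exists H : C -> C, forall z, inint x0 x1 y0 y1 z -> holo H z /\ (z \notin E -> H z = G z).
Proof.
move=> xx yy GM Gh; apply: (@cauchy_extend _ _ _ _ _ (fun z => z \notin E)).
  apply: (@exc_sides R G M E x0 x1 y0 y1 xx yy GM) => z zr zE.
  exact: (holo_cont (Gh z zr zE)).
move=> z zi zE; have zr := inint_inrect zi.
have [K KP] := kernel_bounded zr GM (Gh z zr zE).
(* The kernel is bounded, so its own point z is just one more exceptional point. *)
apply: (@goursat_exc _ (z :: E) _ K) => // p pr.
by rewrite inE negb_or => /andP[pz pE]; apply: kernel_holo => //; exact: Gh.
Qed.

(** For z off the real axis the kernel at z is again bounded with a jump that tends to 0, so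
    [goursat_line] applies to it with z as exceptional point. *)
Lemma schwarz_reflection G M x0 x1 y0 y1 : x0 <= x1 -> y0 < 0 < y1 ->
  (forall z, inrect x0 x1 y0 y1 z -> nm (G z) <= M) ->
  (forall z, inrect x0 x1 y0 y1 z -> Im z != 0 -> holo G z) ->
  (forall e, 0 < e -> exists2 d, 0 < d & forall t s, x0 <= t <= x1 -> 0 < s < d ->
    nm (G (Complex t s) - G (Complex t (- s))) <= e) ->
  exists H : C -> C, forall z, inint x0 x1 y0 y1 z -> holo H z /\ (Im z != 0 -> H z = G z).
Proof.
move=> xx y01 GM Gh Gj; case/andP: (y01) => y00 y10.
have yy : y0 <= y1 by rewrite ltW // (lt_trans y00).
apply: (@cauchy_extend _ _ _ _ _ (fun z => Im z != 0)).
  split.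
  - apply: (@exc_cint_hor _ _ M [::]) => t tt; first by apply: GM; rewrite /inrect /= tt lexx.
    by move=> _; apply: holo_cont; apply: Gh; rewrite /inrect /= ?tt ?lexx // lt_eqF.
  - apply: (@exc_cint_hor _ _ M [::]) => t tt; first by apply: GM; rewrite /inrect /= tt lexx yy.
    by move=> _; apply: holo_cont; apply: Gh; rewrite /inrect /= ?tt ?lexx ?yy // gt_eqF.
  - apply: (@exc_cint_ver _ _ M [:: Complex x0 0]) => t tt.
      by apply: GM; rewrite /inrect /= tt lexx xx.
    rewrite inE => tn; apply: holo_cont; apply: Gh; rewrite /inrect /= ?tt ?lexx ?xx //.
    by apply: contra tn => /eqP ->.
  - apply: (@exc_cint_ver _ _ M [:: Complex x1 0]) => t tt.
      by apply: GM; rewrite /inrect /= tt lexx xx.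
    rewrite inE => tn; apply: holo_cont; apply: Gh; rewrite /inrect /= ?tt ?lexx ?xx //.
    by apply: contra tn => /eqP ->.
move=> z zi zE; have zr := inint_inrect zi.
have [K KP] := kernel_bounded zr GM (Gh z zr zE).
apply: (@goursat_line _ [:: z] _ K) => //.
  by move=> p pr p0; rewrite inE => pz; apply: kernel_holo => //; exact: Gh.
(* Points within c of the real axis have distance at least c from z, so 1/(p - z) is bounded by 1/c
   there. *)
move=> e e0; pose c := `|Im z| / 2.
have c0 : 0 < c by rewrite divr_gt0 // normr_gt0.
have M0 : 0 <= M := le_trans (nm_ge0 _) (GM _ zr).
have ec : 0 < e * c / 2 by rewrite divr_gt0 // mulr_gt0.
have [d d0 dP] := Gj (e * c / 2) ec.
pose m := 4 * M + 1; have m0 : 0 < m by rewrite ltr_wpDl // mulr_ge0.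
exists (Num.min (Num.min d c) (Num.min (e * c ^+ 2 / (2 * m)) (Num.min (- y0) y1))).
  have e1 : 0 < e * c ^+ 2 / (2 * m) by rewrite divr_gt0 // mulr_gt0 // exprn_gt0.
  by rewrite !lt_min d0 c0 oppr_gt0 y00 y10 e1.
move=> t s tt /andP[s0]; rewrite !lt_min => /and4P[/andP[sd sc] se sy0 sy1].
set a := Complex t s; set b := Complex t (- s).
have da : c <= nm (a - z).
  apply: le_trans (Im_le_nm _); rewrite cImB /= distrC.
  have := lerB_dist (Im z) s; rewrite (gtr0_norm s0).
  have : `|Im z| = c + c by rewrite /c; field.
  move: sc; clear; lra.
have db : c <= nm (b - z).
  apply: le_trans (Im_le_nm _); rewrite cImB /= distrC.
  have := lerB_dist (Im z) (- s); rewrite normrN (gtr0_norm s0).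
  have : `|Im z| = c + c by rewrite /c; field.
  move: sc; clear; lra.
have a0 : a - z != 0 by rewrite -nm_gt0 (lt_le_trans c0).
have b0 : b - z != 0 by rewrite -nm_gt0 (lt_le_trans c0).
have br : inrect x0 x1 y0 y1 b.
  by rewrite /inrect /= tt lerNr ltW //= (le_trans _ (ltW y10)) // oppr_le0 ltW.
(* The first term carries the jump of G, the second that of 1/(p - z), which is at most 2 s /
   c^2. *)
have -> : (G a - G z) / (a - z) - (G b - G z) / (b - z) =
    (G a - G b) / (a - z) + (G b - G z) * ((b - a) / ((a - z) * (b - z))).
  by field; rewrite ?a0 ?b0.
apply: le_trans (ler_nmD _ _) _.
have T1 : nm ((G a - G b) / (a - z)) <= e / 2.
  rewrite nmM nmV ler_pdivrMr ?(lt_le_trans c0) //.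
  apply: le_trans (dP t s tt _) _; first by rewrite s0.
  by rewrite mulrAC ler_wpM2l // divr_ge0 // ltW.
have ba : nm (b - a) = 2 * s.
  have -> : b - a = Complex 0 1 * rC (- (2 * s)) by apply: complex_eq; rewrite /=; ring.
  by rewrite nmM nm_i mul1r nm_rC normrN gtr0_norm // mulr_gt0.
have T2 : nm ((G b - G z) * ((b - a) / ((a - z) * (b - z)))) <= e / 2.
  rewrite !(nmM, nmV) ba.
  apply: (@le_trans _ _ (2 * M * (2 * s / c ^+ 2))).
    apply: ler_pM; rewrite ?nm_ge0 //.
    - by rewrite divr_ge0 ?mulr_ge0 ?nm_ge0 // ltW.
    - have := ler_nmB (G b) (G z); have := GM _ br; have := GM _ zr; clear; lra.
    rewrite ler_wpM2l ?mulr_ge0 ?(ltW s0) // lef_pV2 ?posrE ?exprn_gt0 //.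
      by rewrite expr2; apply: ler_pM => //; exact: ltW c0.
    by rewrite mulr_gt0 ?(lt_le_trans c0).
  move: se; rewrite ltr_pdivlMr ?mulr_gt0 // mulrA ler_pdivrMr ?exprn_gt0 // /m.
  have : 0 <= e * c ^+ 2 by rewrite mulr_ge0 ?exprn_ge0 // ltW.
  move: s0 M0; clear => s0 M0.
  set u := e * c ^+ 2; have -> : e / 2 * c ^+ 2 = u / 2 by rewrite /u; field.
  lra.
by apply: le_trans (lerD T1 T2) _; clear; lra.
Qed.

End CauchyFormula.

(** * Analytic continuation *)

Section Continuation.
Variable R : realType.
Local Notation C := R[i].
Implicit Types (x y t s e d M : R) (f g G : C -> C) (z p w h : C) (E : seq C).

Lemma geometric_small (rho e : R) : 0 <= rho < 1 -> 0 < e -> exists n, rho ^+ n <= e.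
Proof.
move=> /andP[r0 r1] e0; have := @cvg_geometric R 1 rho.
rewrite (ger0_norm r0) => /(_ r1) /cvgrPdist_le /(_ _ e0) [n _ /(_ n (leqnn n))] /=.
by rewrite sub0r normrN /geometric /= mul1r ger0_norm ?exprn_ge0 // => H; exists n.
Qed.

(* Apply the Cauchy formula to g z / (z - c) ^+ n and let n tend to infinity. *)
Lemma holo_vanish (c : C) (r d : R) g : 0 < r -> 0 < d ->
  (forall z, inrect (Re c - r) (Re c + r) (Im c - r) (Im c + r) z -> holo g z) ->
  (forall w, nm (w - c) < d -> g w = 0) -> forall z, nm (z - c) < r -> g z = 0.
Proof.
move=> r0 d0 gh g0 z zr.
have cc : nm (c - c) < d by rewrite subrr nm0.
have [->|zc] := eqVneq z c; first exact: g0.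
set x0 := Re c - r in gh *; set x1 := Re c + r in gh *.
set y0 := Im c - r in gh *; set y1 := Im c + r in gh *.
have xx : x0 <= x1 by rewrite /x0 /x1; clear -r0; lra.
have yy : y0 <= y1 by rewrite /y0 /y1; clear -r0; lra.
have [M gM] := continuous_rect_bounded xx yy (fun z zr => holo_cont (gh z zr)).
have zi : inint x0 x1 y0 y1 z.
  have := le_lt_trans (Re_le_nm _) zr; have := le_lt_trans (Im_le_nm _) zr.
  rewrite cReB cImB !ltr_norml /inint /x0 /x1 /y0 /y1 => /andP[a b] /andP[a' b'].
  by apply/andP; split; apply/andP; split; lra.
have ci : inrect x0 x1 y0 y1 c.
  rewrite /inrect /x0 /x1 /y0 /y1; clear -r0.
  by apply/andP; split; apply/andP; split; lra.
have M0 : 0 <= M := le_trans (nm_ge0 _) (gM c ci).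
have W0 := cauchyW_neq0 zi.
pose del := r - nm (z - c); have del0 : 0 < del by rewrite subr_gt0.
pose rho := nm (z - c) / r.
have rho01 : 0 <= rho < 1.
  by rewrite divr_ge0 ?nm_ge0 ?(ltW r0) //= ltr_pdivrMr // mul1r.
pose K := 4 * (M / del) * (x1 - x0 + (y1 - y0)).
have K0 : 0 <= K.
  by rewrite !mulr_ge0 ?invr_ge0 ?(ltW del0) // addr_ge0 ?subr_ge0.
have main n : nm (g z) * nm (cauchyW x0 x1 y0 y1 z) <= K * rho ^+ n.
  (* The new factor is singular only at c, and g vanishes near c; so [gn] is holomorphic on the
     whole square. *)
  pose gn p := g p * ((p - c)^-1) ^+ n.
  have gnh p : inrect x0 x1 y0 y1 p -> holo gn p.
    move=> pr; have [->|pc] := eqVneq p c.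
      apply: (@holo_near R (fun=> 0) gn c d d0); last exact: holo_cst.
      by move=> w wd; rewrite /gn g0 // mul0r.
    have h2 : holo (fun w => w - c) p := holoB (@holo_id R p) (@holo_cst R c p).
    have pc0 : p - c != 0 by rewrite subr_eq0.
    have h3 : holo (fun w => (w - c)^-1) p := @holoV R (fun w => w - c) p pc0 h2.
    have h4 := @holoXn R (fun w => (w - c)^-1) n p h3.
    exact: (@holoM R g (fun w => (w - c)^-1 ^+ n) p (gh p pr) h4).
  have [Mn gMn] := continuous_rect_bounded xx yy (fun z zr => holo_cont (gnh z zr)).
  have zr' := inint_inrect zi.
  have sgn : sidespc gn x0 x1 y0 y1.
    apply: (@exc_sides R gn Mn [::] x0 x1 y0 y1 xx yy gMn) => p pr _.
    exact: (holo_cont (gnh p pr)).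
  have [Kn KP] := kernel_bounded zr' gMn (gnh z zr').
  have kz : rectint (fun p => (gn p - gn z) / (p - z)) x0 x1 y0 y1 = 0.
    apply: (@goursat_exc R [:: z] _ Kn x0 x1 y0 y1 xx yy KP) => p pr.
    rewrite inE => pz; exact: kernel_holo pz (gnh p pr).
  have CF := cauchy_formula zi sgn kz.
  have zc0 : 0 < nm (z - c) by rewrite nm_gt0 subr_eq0.
  have : nm (gn z * cauchyW x0 x1 y0 y1 z) <= K * r^-1 ^+ n.
    rewrite CF /cauchyN.
    have -> : K * r^-1 ^+ n = 4 * (M * r^-1 ^+ n / del) * (x1 - x0 + (y1 - y0)).
      by rewrite /K; ring.
    apply: rectint_bound => //.
      exact: sidespc_int (sidespcM sgn (sidespc_inv zi)).
    move=> p /andP[pr ps].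
    (* The square is circumscribed about the disc of radius r, so |gn| <= M r^-n on its sides, while
       at z the factor is |z - c|^-n; the quotient of the two powers is rho^n. *)
    have pc : r <= nm (p - c).
      case/or4P: ps => /eqP ps.
      - apply: le_trans (Re_le_nm _); rewrite cReB ps /x0 distrC.
        by have -> : Re c - (Re c - r) = r; [ring|exact: ler_norm].
      - apply: le_trans (Re_le_nm _); rewrite cReB ps /x1.
        by have -> : Re c + r - Re c = r; [ring|exact: ler_norm].
      - apply: le_trans (Im_le_nm _); rewrite cImB ps /y0 distrC.
        by have -> : Im c - (Im c - r) = r; [ring|exact: ler_norm].
      - apply: le_trans (Im_le_nm _); rewrite cImB ps /y1.
        by have -> : Im c + r - Im c = r; [ring|exact: ler_norm].
    have pz : del <= nm (p - z).
      have := ler_nmD (p - z) (z - c); rewrite addrA subrK /del.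
      by move: pc; clear; lra.
    rewrite /gn !(nmM, nmV, nmX).
    apply: ler_pM; rewrite ?invr_ge0 ?nm_ge0 //.
    - by rewrite mulr_ge0 ?nm_ge0 // exprn_ge0 // invr_ge0 nm_ge0.
    - apply: ler_pM; rewrite ?nm_ge0 ?gM //.
        by rewrite exprn_ge0 // invr_ge0 nm_ge0.
      rewrite lerXn2r ?nnegrE ?invr_ge0 ?nm_ge0 ?(ltW r0) //.
      by rewrite lef_pV2 // posrE (lt_le_trans r0).
    - by rewrite lef_pV2 // posrE (lt_le_trans del0).
  rewrite /gn !(nmM, nmV, nmX) => H.
  have -> : K * rho ^+ n = K * r^-1 ^+ n * nm (z - c) ^+ n.
    by rewrite /rho exprMn; ring.
  apply: le_trans (ler_wpM2r (exprn_ge0 n (ltW zc0)) H).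
  have -> : nm (g z) * (nm (z - c))^-1 ^+ n * nm (cauchyW x0 x1 y0 y1 z) * nm (z - c) ^+ n =
     nm (g z) * nm (cauchyW x0 x1 y0 y1 z) * ((nm (z - c))^-1 * nm (z - c)) ^+ n.
    by rewrite exprMn; ring.
  by rewrite mulVf ?gt_eqF // expr1n mulr1.
have : nm (g z) * nm (cauchyW x0 x1 y0 y1 z) <= 0.
  apply: le_eps0 => e e0; have K1 : 0 < K + 1 by rewrite ltr_wpDl.
  have [n nP] := geometric_small rho01 (divr_gt0 e0 K1).
  apply: le_trans (main n) _; apply: le_trans (ler_wpM2l K0 nP) _.
  by rewrite mulrCA ler_piMr ?(ltW e0) // ler_pdivrMr // mul1r lerDl.
rewrite pmulr_lle0 ?nm_gt0 //; exact: nm_le0.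
Qed.

(** Large discs exhaust a half-plane: a point at depth D behind the edge of a disc of radius T is
    inside, whatever its offset A along the edge, once T is large. T solves 2 D T = A^2 + D^2 +
    1. *)
Lemma large_radius (A D : R) : 0 < D ->
  exists T : R, 0 < T /\ A ^+ 2 + (T - D) ^+ 2 < T ^+ 2.
Proof.
move=> D0; exists ((A ^+ 2 + D ^+ 2 + 1) / (2 * D)); split.
  by rewrite divr_gt0 ?mulr_gt0 // ltr_wpDl // addr_ge0 ?sqr_ge0.
set T := _ / _; have : 2 * D * T = A ^+ 2 + D ^+ 2 + 1.
  by rewrite /T mulrC divfK // mulf_neq0 ?gt_eqF.
clearbody T; rewrite sqrrB -mulr_natl; clear; lra.
Qed.

Lemma nm_lt (r : R) z : 0 < r -> Re z ^+ 2 + Im z ^+ 2 < r ^+ 2 -> nm z < r.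
Proof.
by move=> r0; rewrite -nm_sqr ltr_pXn2r ?nnegrE ?nm_ge0 // ltW.
Qed.

(** Large discs carry the vanishing from the upper half-plane to Re z < alpha, and from there to the
    lower half-plane. *)
Lemma slit_vanish (alpha : R) g :
  (forall z, slit alpha z -> holo g z) -> (forall z, 0 < Im z -> g z = 0) ->
  forall z, slit alpha z -> g z = 0.
Proof.
move=> gh gp.
have left z : Re z < alpha -> g z = 0.
  move=> za; pose D := (alpha - Re z) / 2.
  have D0 : 0 < D by rewrite divr_gt0 // subr_gt0.
  have [T [T0 TP]] := large_radius (Im z - 1) D0.
  (* The right edge Re c + T = Re z + D stays left of alpha, and the unit disc about c lies in the
     upper half-plane. *)
  pose c := Complex (Re z + D - T) 1 : C.
  apply: (@holo_vanish c T 1 g) => //.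
  - move=> w /andP[/andP[_ w1] _]; apply: gh => -[_ ww].
    move: w1; rewrite /= /D; move: ww za; clear; lra.
  - move=> w /(le_lt_trans (Im_le_nm _)); rewrite cImB /= ltr_norml => /andP[w0 _].
    by apply: gp; move: w0; clear; lra.
  - apply: nm_lt => //; rewrite cReB cImB /=.
    apply: le_lt_trans TP; rewrite addrC.
    have -> : Re z - (Re z + D - T) = T - D by ring.
    exact: lexx.
move=> z zs; have [/left //|za] := ltP (Re z) alpha.
have [/gp //|z0] := ltP 0 (Im z).
have zn : Im z < 0.
  rewrite lt_neqAle z0 andbT; apply/eqP => zE; apply: zs; split => //.
pose D := - Im z / 2.
have D0 : 0 < D by rewrite divr_gt0 // oppr_gt0.
have [T [T0 TP]] := large_radius (Re z - alpha + 1) D0.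
(* The top edge Im c + T = Im z / 2 stays below the real axis, and the unit disc about c lies left
   of alpha. *)
pose c := Complex (alpha - 1) (Im z + D - T) : C.
apply: (@holo_vanish c T 1 g) => //.
- move=> w /andP[_ /andP[_ w1]]; apply: gh => -[ww _].
  move: w1; rewrite /= ww /D; move: zn; clear; lra.
- move=> w /(le_lt_trans (Re_le_nm _)); rewrite cReB /= ltr_norml => /andP[_ w0].
  by apply: left; move: w0; clear; lra.
- apply: nm_lt => //; rewrite cReB cImB /=.
  apply: le_lt_trans TP.
  have -> : Im z - (Im z + D - T) = T - D by ring.
  have -> : Re z - (alpha - 1) = Re z - alpha + 1 by ring.
  exact: lexx.
Qed.

Lemma ccont_eq f g (X : set C) w d : 0 < d -> ccont f w -> ccont g w ->
  (forall e, 0 < e -> exists z, nm (z - w) < e /\ ~ X z) ->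
  (forall z, nm (z - w) < d -> ~ X z -> f z = g z) -> f w = g w.
Proof.
move=> d0 /contCP fc /contCP gc dense fg.
apply/eqP; rewrite -subr_eq0; apply/eqP; apply: nm_le0; apply: le_eps0 => e e0.
have e2 : 0 < e / 2 by rewrite divr_gt0.
have [d1 d10 f1] := fc _ e2; have [d2 d20 g2] := gc _ e2.
have [|z [zw zX]] := dense (Num.min d (Num.min d1 d2)).
  by rewrite !lt_min d0 d10.
move: zw; rewrite !lt_min => /and3P[za zb zc].
have := f1 z zb; have := g2 z zc; rewrite (fg z za zX) => h1 h2.
have -> : f w - g w = (g z - g w) - (g z - f w) by ring.
by apply: le_trans (ler_nmB _ _) _; move: h1 h2; clear; lra.
Qed.

(** Local extensions agree where they overlap, being continuous and equal to G on a dense set. An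
    independent choice at each point therefore yields one consistent function. *)
Lemma glue_local (Om X : set C) G :
  (forall w, Om w -> forall e, 0 < e -> exists z, nm (z - w) < e /\ ~ X z) ->
  (forall w, Om w -> exists (H : C -> C) (d : R), 0 < d /\
     forall z, nm (z - w) < d -> [/\ Om z, holo H z & ~ X z -> H z = G z]) ->
  exists S : C -> C, forall w, Om w -> holo S w /\ (~ X w -> S w = G w).
Proof.
move=> dense loc.
pose S w := if pselect (Om w) is left h then (sval (cid (loc w h))) w else 0.
have SP w (h : Om w) : S w = sval (cid (loc w h)) w.
  rewrite /S; case: pselect => // h'; by rewrite (Prop_irrelevance h' h).
exists S => w hw; have [d [d0 dP]] := svalP (cid (loc w hw)).
set H := sval (cid (loc w hw)) in dP.
have ww : nm (w - w) < d by rewrite subrr nm0.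
have SH z : nm (z - w) < d -> S z = H z.
  move=> zd; have [Oz Hz _] := dP z zd; rewrite (SP z Oz).
  have [d' [d'0 d'P]] := svalP (cid (loc z Oz)).
  set H' := sval (cid (loc z Oz)) in d'P *.
  have zz : nm (z - z) < d' by rewrite subrr nm0.
  have [_ H'z _] := d'P z zz.
  have m0 : 0 < Num.min d' (d - nm (z - w)) by rewrite lt_min d'0 subr_gt0.
  apply: (ccont_eq m0 (holo_cont H'z) (holo_cont Hz) (dense z Oz)) => p.
  rewrite lt_min => /andP[pz pd] pX.
  have [_ _ ->] := d'P p pz => //.
  have pw : nm (p - w) < d.
    have := ler_nmD (p - z) (z - w); rewrite addrA subrK.
    move: pd; clear; lra.
  by have [_ _ ->] := dP p pw.
have [_ Hw HG] := dP w ww; split.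
  by apply: (holo_near d0 _ Hw) => z zd; rewrite SH.
by move=> wX; rewrite SH // HG.
Qed.

Lemma discrete_dense (D : set C) : discrete_in_Piplus D ->
  forall w, Piplus w -> forall e, 0 < e -> exists z, nm (z - w) < e /\ ~ D z.
Proof.
move=> [_ Dd] w wP e e0; have [r [r0 rP]] := Dd w wP.
pose m := Num.min e r / 2.
have m0 : 0 < m by rewrite divr_gt0 // lt_min e0.
have [me mr] : m < e /\ m < r.
  have m1 : Num.min e r <= e by rewrite ge_min lexx.
  have m2 : Num.min e r <= r by rewrite ge_min lexx orbT.
  by rewrite /m in m0 *; split; move: m0 m1 m2; set k := Num.min e r; clear; lra.
exists (w + rC m); rewrite addrC addKr nm_rC gtr0_norm //; split => // Dz.
have := rP _ Dz; rewrite addrC addKr normE nm_rC gtr0_norm // lt_rC => /(_ mr).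
move/(congr1 (@complex.Re R)); rewrite cReD /=; move: m0; clear; lra.
Qed.


Lemma ext_isolated (D : set C) f (c : R) : discrete_in_Piplus D ->
  (forall z, Piplus z -> ~ D z -> holo f z) ->
  (forall z, Piplus z -> ~ D z -> nm (f z) * Im z <= c) ->
  exists S : C -> C, forall w, Piplus w -> holo S w /\ (~ D w -> S w = f w).
Proof.
move=> Dd fh fb; apply: glue_local (discrete_dense Dd) _ => w wP.
have [r [r0 rP]] := Dd.2 w wP.
have w0 : 0 < Im w by move: wP; rewrite /Piplus.
pose s := Num.min r (Im w) / 4.
have m0 : 0 < Num.min r (Im w) by rewrite lt_min r0.
have m1 : Num.min r (Im w) <= r by rewrite ge_min lexx.
have m2 : Num.min r (Im w) <= Im w by rewrite ge_min lexx orbT.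
have s0 : 0 < s by rewrite divr_gt0.
have s1 : s + s < r by rewrite /s; move: m0 m1; clear; set k := Num.min _ _; lra.
have s2 : s <= Im w / 2 by rewrite /s; move: m0 m2; clear; set k := Num.min _ _; lra.
clearbody s.
have near z : inrect (Re w - s) (Re w + s) (Im w - s) (Im w + s) z ->
    nm (z - w) < r /\ Im w / 2 <= Im z.
  move=> /andP[/andP[a b] /andP[a' b']]; split.
    apply: le_lt_trans (nm_le_ReIm _) _; rewrite cReB cImB.
    have h1 : `|Re z - Re w| <= s by rewrite ler_norml; clear -a b; apply/andP; split; lra.
    have h2 : `|Im z - Im w| <= s by rewrite ler_norml; clear -a' b'; apply/andP; split; lra.
    exact: le_lt_trans (lerD h1 h2) s1.
  by clear -a' s2; lra.
(* By the choice of r, no point of [D] other than possibly w lies in the square. *)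
pose E := if pselect (D w) then [:: w] else [::].
have EP z : inrect (Re w - s) (Re w + s) (Im w - s) (Im w + s) z -> z \notin E -> ~ D z.
  move=> /near[zw _] zE Dz.
  have zEw : z = w by apply: rP => //; rewrite normE lt_rC.
  have Dw : D w by rewrite -zEw.
  by move: zE; rewrite zEw /E; case: pselect => [?|//] /=; rewrite inE eqxx.
have EN z : ~ D z -> z \notin E.
  rewrite /E; case: pselect => [Dw|?] nD //=; rewrite inE.
  by apply/eqP => zw; apply: nD; rewrite zw.
have Pz z : Im w / 2 <= Im z -> Piplus z.
  by rewrite /Piplus /=; move: w0; clear; lra.
have c0 : 0 <= c.
  have [z [zw zD]] := discrete_dense Dd wP w0.
  have zP : Piplus z.
    rewrite /Piplus /=; have := le_lt_trans (Im_le_nm _) zw.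
    by rewrite cImB ltr_norml => /andP[+ _]; clear; lra.
  by apply: le_trans (fb z zP zD); rewrite mulr_ge0 ?nm_ge0 // ltW.
(* If w is in [D], the value f w is arbitrary, yet the bound has to cover it. *)
pose M := Num.max (c / (Im w / 2)) (nm (f w)).
have xx : Re w - s <= Re w + s by clear -s0; lra.
have yy : Im w - s <= Im w + s by clear -s0; lra.
have fM z : inrect (Re w - s) (Re w + s) (Im w - s) (Im w + s) z -> nm (f z) <= M.
  move=> zr; have [zwr zi] := near z zr; rewrite /M le_max.
  have [Dz|nD] := pselect (D z).
    have -> : z = w by apply: rP => //; rewrite normE lt_rC.
    by rewrite lexx orbT.
  rewrite ler_pdivlMr ?divr_gt0 //; apply/orP; left.
  by apply: le_trans (fb z (Pz z zi) nD); rewrite ler_wpM2l ?nm_ge0.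
have fhE z : inrect (Re w - s) (Re w + s) (Im w - s) (Im w + s) z -> z \notin E -> holo f z.
  move=> zr zE; have [_ zi] := near z zr.
  by apply: fh; [exact: Pz|exact: EP].
have [H HP] := riemann_removable xx yy fM fhE.
exists H, s; split => // z zs.
have zi : inint (Re w - s) (Re w + s) (Im w - s) (Im w + s) z.
  have := le_lt_trans (Re_le_nm _) zs; have := le_lt_trans (Im_le_nm _) zs.
  rewrite cReB cImB !ltr_norml /inint => /andP[a b] /andP[a' b'].
  by clear -a b a' b'; apply/andP; split; apply/andP; split; lra.
have [Hh HE] := HP z zi; split => //; last by move=> /EN; exact: HE.
by apply: Pz; case: (near z (inint_inrect zi)).
Qed.

Lemma line_dense w e : 0 < e -> exists z : C, nm (z - w) < e /\ ~ (Im z = 0).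
Proof.
move=> e0; have [w0|w0] := eqVneq (Im w) 0; last first.
  by exists w; rewrite subrr nm0; split => //; exact/eqP.
exists (w + Complex 0 1 * rC (e / 2)); rewrite addrC addKr nmM nm_i nm_rC mul1r.
have e2 : 0 < e / 2 by rewrite divr_gt0.
rewrite gtr0_norm //; split; first by clear -e0; lra.
rewrite cImD cImM /= w0; move: e0; clear; lra.
Qed.

(** On a rectangle that keeps distance s from the line Re z = alpha, the bounds by c / (alpha - Re
    z) and k y / (alpha - x)^2 are uniform: these are the hypotheses of [schwarz_reflection]. *)
Lemma ext_reflect (alpha c k : R) (u v : C -> C) : 0 <= c -> 0 <= k ->
  (forall z, 0 < Im z -> holo u z) -> (forall z, Im z < 0 -> holo v z) ->
  (forall z, 0 < Im z -> Re z < alpha -> nm (u z) * (alpha - Re z) <= c) ->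
  (forall z, Im z < 0 -> Re z < alpha -> nm (v z) * (alpha - Re z) <= c) ->
  (forall x y, x < alpha -> 0 < y ->
     nm (u (Complex x y) - v (Complex x (- y))) * (alpha - x) ^+ 2 <= k * y) ->
  exists S : C -> C, [/\ forall w, slit alpha w -> holo S w,
    forall w, 0 < Im w -> S w = u w & forall w, Im w < 0 -> S w = v w].
Proof.
move=> c0 k0 uh vh ub vb uv.
pose G z := if 0 < Im z then u z else if Im z < 0 then v z else 0.
have Gu z : 0 < Im z -> G z = u z by rewrite /G => ->.
have Gv z : Im z < 0 -> G z = v z by move=> z0; rewrite /G (lt_gtF z0) z0.
have Im_near z w : nm (z - w) < `|Im w| -> Im w != 0 -> (0 < Im w -> 0 < Im z) /\ (Im w < 0 -> Im z < 0).
  move=> /(le_lt_trans (Im_le_nm _)); rewrite cImB => zw _; split => w0.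
    by move: zw; rewrite (gtr0_norm w0) ltr_norml => /andP[+ _]; clear; lra.
  by move: zw; rewrite (ltr0_norm w0) ltr_norml => /andP[_]; clear; lra.
have Gh z : Im z != 0 -> holo G z.
  move=> z0; have zn : 0 < `|Im z| by rewrite normr_gt0.
  have [zp|zm|] := ltgtP (Im z) 0; last by move/eqP; rewrite (negbTE z0).
    apply: (@holo_near R v G z _ zn _ (vh z zp)) => w wz.
    by rewrite Gv //; exact: (Im_near w z wz z0).2.
  apply: (@holo_near R u G z _ zn _ (uh z zm)) => w wz.
  by rewrite Gu //; exact: (Im_near w z wz z0).1.
have [S SP] : exists S : C -> C, forall w, slit alpha w -> holo S w /\ (~ (Im w = 0) -> S w = G w).
  apply: (@glue_local (slit alpha) [set w | Im w = 0] G).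
    by move=> w _ e; exact: line_dense.
  move=> w ws; have [w0|w0] := eqVneq (Im w) 0; last first.
    have zn : 0 < `|Im w| by rewrite normr_gt0.
    exists G, `|Im w|; split => // z zw.
    have z0 : Im z != 0.
      have [h1 h2] := Im_near z w zw w0.
      by move: w0; rewrite neq_lt => /orP[/h2|/h1]; [move/lt_eqF ->|move/gt_eqF ->].
    by split => //; [case; move/eqP: z0|exact: Gh].
  have wa : Re w < alpha by rewrite ltNge; apply/negP => wa; apply: ws.
  pose s := (alpha - Re w) / 2; have s0 : 0 < s by rewrite divr_gt0 // subr_gt0.
  have far x : x <= Re w + s -> s <= alpha - x by rewrite /s; clear; lra.
  have xx : Re w - s <= Re w + s by clear -s0; lra.
  have ss : - s < 0 < s by rewrite oppr_lt0 s0.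
  pose M := c / s.
  have M0 : 0 <= M by rewrite divr_ge0 // ltW.
  have GM z : inrect (Re w - s) (Re w + s) (- s) s z -> nm (G z) <= M.
    move=> /andP[/andP[_ /far zs] _].
    have za : Re z < alpha by rewrite -subr_gt0 (lt_le_trans s0).
    rewrite /M ler_pdivlMr // /G; case: ifP => [z0|_].
      by apply: le_trans (ub z z0 za); rewrite ler_wpM2l ?nm_ge0.
    case: ifP => [z0|_]; last by rewrite nm0 mul0r.
    by apply: le_trans (vb z z0 za); rewrite ler_wpM2l ?nm_ge0.
  have Gj e : 0 < e -> exists2 d, 0 < d & forall t y, Re w - s <= t <= Re w + s ->
      0 < y < d -> nm (G (Complex t y) - G (Complex t (- y))) <= e.
    move=> e0; have k1 : 0 < k + 1 by rewrite ltr_wpDl.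
    exists (e * s ^+ 2 / (k + 1)); first by rewrite divr_gt0 // mulr_gt0 // exprn_gt0.
    move=> t y /andP[_ /far ts] /andP[y0]; rewrite ltr_pdivlMr // => yd.
    have ta : t < alpha by rewrite -subr_gt0 (lt_le_trans s0).
    rewrite Gu // Gv /= ?oppr_lt0 //.
    have s2 : 0 < s ^+ 2 by rewrite exprn_gt0.
    rewrite -(ler_pM2r s2).
    have h1 : nm (u (Complex t y) - v (Complex t (- y))) * s ^+ 2 <= k * y.
      apply: le_trans (uv t y ta y0); rewrite ler_wpM2l ?nm_ge0 //.
      by rewrite lerXn2r // nnegrE ltW // (lt_le_trans s0).
    apply: le_trans h1 _; apply: le_trans (ltW yd).
    by rewrite mulrC ler_wpM2l ?(ltW y0) // lerDl.
  have Ghr z : inrect (Re w - s) (Re w + s) (- s) s z -> Im z != 0 -> holo G z.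
    by move=> _; exact: Gh.
  have [H HP] := schwarz_reflection xx ss GM Ghr Gj.
  exists H, s; split => // z zs.
  have := le_lt_trans (Re_le_nm _) zs; have := le_lt_trans (Im_le_nm _) zs.
  rewrite cReB cImB !ltr_norml w0 subr0 => /andP[a b] /andP[a' b'].
  have zi : inint (Re w - s) (Re w + s) (- s) s z.
    by rewrite /inint a b; clear -a' b'; apply/andP; split => //; apply/andP; split; lra.
  have [Hh HG] := HP z zi; split => //; last by move=> /= /eqP; exact: HG.
  move=> [_]; apply/negP; rewrite -ltNge -subr_gt0 (lt_le_trans s0) // far //.
  by clear -b'; lra.
exists S; split => [w /SP[]//|w w0|w w0].
  have ws : slit alpha w by move=> -[w00 _]; move: w0; rewrite w00 ltxx.
  by have [_ ->] := SP w ws; [exact: Gu|apply/eqP; rewrite gt_eqF].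
have ws : slit alpha w by move=> -[w00 _]; move: w0; rewrite w00 ltxx.
by have [_ ->] := SP w ws; [exact: Gv|apply/eqP; rewrite lt_eqF].
Qed.

End Continuation.

(** * Sesquilinear forms *)

Section Forms.
Variable R : realType.
Local Notation C := R[i].

Lemma adjmxE m n (A : 'M[C]_(m, n)) i j : adjmx A i j = conjc (A j i).
Proof. by rewrite !mxE. Qed.

Lemma adjmxK m n (A : 'M[C]_(m, n)) : adjmx (adjmx A) = A.
Proof. by apply/matrixP => i j; rewrite !adjmxE conjcK. Qed.

Lemma adjmxD m n (A B : 'M[C]_(m, n)) : adjmx (A + B) = adjmx A + adjmx B.
Proof. by apply/matrixP => i j; rewrite !mxE rmorphD. Qed.

Lemma adjmxN m n (A : 'M[C]_(m, n)) : adjmx (- A) = - adjmx A.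
Proof. by apply/matrixP => i j; rewrite !mxE rmorphN. Qed.

Lemma adjmxB m n (A B : 'M[C]_(m, n)) : adjmx (A - B) = adjmx A - adjmx B.
Proof. by rewrite adjmxD adjmxN. Qed.

Lemma adjmxZ m n (a : C) (A : 'M[C]_(m, n)) : adjmx (a *: A) = conjc a *: adjmx A.
Proof. by apply/matrixP => i j; rewrite !mxE rmorphM. Qed.

Lemma adjmx0 m n : adjmx (0 : 'M[C]_(m, n)) = 0.
Proof. by apply/matrixP => i j; rewrite !mxE rmorph0. Qed.

Lemma adjmxM m n p (A : 'M[C]_(m, n)) (B : 'M[C]_(n, p)) :
  adjmx (A *m B) = adjmx B *m adjmx A.
Proof.
apply/matrixP => i j; rewrite adjmxE !mxE rmorph_sum; apply: eq_bigr => k _.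
by rewrite !adjmxE rmorphM mulrC.
Qed.

Definition bl m n (M : 'M[C]_(m, n)) (x : 'cV[C]_m) (y : 'cV[C]_n) : C :=
  (adjmx x *m M *m y) 0 0.

Section Bl.
Variables m n : nat.
Implicit Types (M N : 'M[C]_(m, n)) (x : 'cV[C]_m) (y : 'cV[C]_n) (a : C).

Lemma blE M x y : bl M x y = \sum_i \sum_j conjc (x i 0) * M i j * y j 0.
Proof.
rewrite /bl mxE exchange_big /=; apply: eq_bigr => j _.
by rewrite mxE mulr_suml; apply: eq_bigr => i _; rewrite adjmxE.
Qed.

Lemma blDm M N x y : bl (M + N) x y = bl M x y + bl N x y.
Proof. by rewrite /bl mulmxDr mulmxDl mxE. Qed.

Lemma blZm a M x y : bl (a *: M) x y = a * bl M x y.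
Proof. by rewrite /bl -scalemxAr -scalemxAl mxE. Qed.

Lemma blNm M x y : bl (- M) x y = - bl M x y.
Proof. by rewrite -scaleN1r blZm mulN1r. Qed.

Lemma blBm M N x y : bl (M - N) x y = bl M x y - bl N x y.
Proof. by rewrite blDm blNm. Qed.

Lemma blDr M x y y' : bl M x (y + y') = bl M x y + bl M x y'.
Proof. by rewrite /bl mulmxDr mxE. Qed.

Lemma blZr M x a y : bl M x (a *: y) = a * bl M x y.
Proof. by rewrite /bl -scalemxAr mxE. Qed.

Lemma bl0r M x : bl M x 0 = 0.
Proof. by rewrite /bl mulmx0 mxE. Qed.

Lemma blDl M x x' y : bl M (x + x') y = bl M x y + bl M x' y.
Proof. by rewrite /bl adjmxD !mulmxDl mxE. Qed.

Lemma blZl M x a y : bl M (a *: x) y = conjc a * bl M x y.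
Proof. by rewrite /bl adjmxZ -!scalemxAl mxE. Qed.

Lemma bl0l M y : bl M 0 y = 0.
Proof. by rewrite /bl adjmx0 !mul0mx mxE. Qed.

Lemma bl_adj M x y : bl (adjmx M) y x = conjc (bl M x y).
Proof.
have -> : conjc (bl M x y) = adjmx (adjmx x *m M *m y) 0 0 by rewrite adjmxE.
by rewrite !adjmxM adjmxK mulmxA.
Qed.

Lemma bl_delta M i j : bl M (delta_mx i 0) (delta_mx j 0) = M i j.
Proof.
have dE p (k l : 'I_p) : (delta_mx k 0 : 'cV[C]_p) l 0 = (l == k)%:R.
  by rewrite mxE eqxx andbT.
rewrite blE (bigD1 i) //= (bigD1 j) //= !dE !eqxx conjc_nat mul1r mulr1.
rewrite big1 ?addr0 => [|k kj]; last by rewrite !dE (negbTE kj) mulr0.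
rewrite big1 ?addr0 // => k ki; rewrite big1 // => l _.
by rewrite !dE (negbTE ki) conjc_nat !mul0r.
Qed.

End Bl.

Lemma ge0_complexP (a : C) : 0 <= a <-> 0 <= Re a /\ Im a = 0.
Proof.
rewrite lecE /=; split => [/andP[/eqP -> ->]|[-> ->]] //.
by rewrite eqxx.
Qed.

(* Symmetry is free, by polarization. *)
Lemma psdP n (A : 'M[C]_n) : psd A <-> forall v, 0 <= bl A v v.
Proof.
split => [[_ //]|H]; split => //; apply/matrixP => i j.
rewrite adjmxE; set u := delta_mx i 0 : 'cV[C]_n; set v := delta_mx j 0 : 'cV[C]_n.
rewrite -(bl_delta A i j) -(bl_delta A j i) -/u -/v.
have /ge0_complexP[_ h1] := H (u + v).
have /ge0_complexP[_ h2] := H (u + Complex 0 1 *: v).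
have /ge0_complexP[_ h3] := H u; have /ge0_complexP[_ h4] := H v.
move: h1 h2; rewrite !(blDl, blDr, blZl, blZr) !cImD !cImM !(cReM, cImM) /= h3 h4.
case: (bl A u v) => a b; case: (bl A v u) => c d /=.
rewrite !(mul0r, mul1r, mulr0, add0r, addr0, mulN1r, subr0, oppr0, mulr1, sub0r) => h1 h2.
by apply: complex_eq => /=; move: h1 h2; clear; lra.
Qed.

Lemma psd_diag_ge0 n (A : 'M[C]_n) i : psd A -> 0 <= Re (A i i) /\ Im (A i i) = 0.
Proof. by move=> /psdP /(_ (delta_mx i 0)); rewrite bl_delta => /ge0_complexP. Qed.

(** With a = A i j, the form at - t a e_i + e_j is a real quadratic polynomial in t, because the
    factor a removes the phase of the cross terms. Its minimum, at t = 1 / A i i, gives the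
    inequality. *)
Lemma psd_minor n (A : 'M[C]_n) i j : psd A ->
  nm (A i j) ^+ 2 <= Re (A i i) * Re (A j j).
Proof.
move=> pA; have [aii bii] := psd_diag_ge0 i pA; have [ajj bjj] := psd_diag_ge0 j pA.
have Hji : A j i = conjc (A i j) by case: pA => /matrixP/(_ j i); rewrite adjmxE.
have key (t : R) : 0 <= t ^+ 2 * Re (A i i) * nm (A i j) ^+ 2 - 2 * t * nm (A i j) ^+ 2 + Re (A j j).
  have /psdP /(_ (- (rC t * A i j) *: delta_mx i 0 + delta_mx j 0)) := pA.
  rewrite !(blDl, blDr, blZl, blZr) !bl_delta => /ge0_complexP[+ _].
  rewrite Hji nm_sqr; move: bii bjj aii ajj.
  case: (A i j) => a b; case: (A i i) => c d; case: (A j j) => e f /= d0 f0 _ _.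
  by rewrite ?d0 ?f0; congr (0 <= _); ring.
set N := nm (A i j) ^+ 2 in key *; have N0 : 0 <= N by rewrite exprn_ge0 ?nm_ge0.
move: aii ajj key; move: (Re (A i i)) (Re (A j j)) => a b a0 b0 key.
have [a1|a1] := eqVneq a 0.
  move: key; rewrite a1 mul0r => key; rewrite leNgt; apply/negP => N1.
  (* When A i i = 0 the polynomial is linear, and this t gives it the value -1. *)
  have := key ((b + 1) / (2 * N)).
  have E1 : 2 * ((b + 1) / (2 * N)) * N = b + 1 by field; rewrite gt_eqF.
  by rewrite E1 mulr0 mul0r; clear; lra.
have a2 : 0 < a by rewrite lt_def a1 a0.
have := key a^-1; have -> : a^-1 ^+ 2 * a * N - 2 * a^-1 * N + b = b - N / a.
  by field; rewrite gt_eqF.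
by rewrite subr_ge0 ler_pdivrMr // mulrC.
Qed.

End Forms.

(** * Block matrices *)

Section BlockMatrices.
Variable R : realType.
Local Notation C := R[i].
Variable q : nat.
Implicit Types (s : nat -> 'M[C]_q) (A K : 'M[C]_q) (z : C) (x : nat -> 'cV[C]_q) (y : 'cV[C]_q).

Lemma bidx_subproof n (j : 'I_n.+1) (k : 'I_q) : (j * q + k < n.+1 * q)%N.
Proof.
apply: (@leq_trans (j.+1 * q)); first by rewrite mulSn addnC ltn_add2r.
by rewrite leq_mul2r ltn_ord orbT.
Qed.

Definition bidx n (j : 'I_n.+1) (k : 'I_q) : 'I_(n.+1 * q) := Ordinal (bidx_subproof j k).

Lemma bidx_div n (j : 'I_n.+1) (k : 'I_q) : (bidx j k %/ q)%N = j.
Proof.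
have q0 : (0 < q)%N by case: q k => // -[].
by rewrite /= divnMDl // divn_small ?addn0.
Qed.

Lemma bidx_mod n (j : 'I_n.+1) (k : 'I_q) : (bidx j k %% q)%N = k.
Proof. by rewrite /= modnMDl modn_small. Qed.

Lemma bidx_bij n : bijective (fun p : 'I_n.+1 * 'I_q => bidx p.1 p.2).
Proof.
apply: inj_card_bij => [[j k] [j' k'] /= e|]; last by rewrite card_prod !card_ord.
congr pair; apply: val_inj => /=.
  by rewrite -(bidx_div j k) e bidx_div.
by rewrite -(bidx_mod j k) e bidx_mod.
Qed.

Lemma bidx_surj n (i : 'I_(n.+1 * q)) : exists j k, i = bidx j k.
Proof. by have [g _ gK] := bidx_bij n; exists (g i).1, (g i).2; rewrite gK. Qed.

Lemma big_bidx n (F : 'I_(n.+1 * q) -> C) :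
  \sum_i F i = \sum_(j < n.+1) \sum_(k < q) F (bidx j k).
Proof.
rewrite pair_big /= (reindex (fun p : 'I_n.+1 * 'I_q => bidx p.1 p.2)) //=.
by apply: onW_bij; exact: bidx_bij.
Qed.

Lemma mxget_ord m n (M : 'M[C]_(m, n)) (a : 'I_m) (b : 'I_n) : mxget M a b = M a b.
Proof. by rewrite /mxget !valK. Qed.

Lemma mxget0 m n (a b : nat) : mxget (0 : 'M[C]_(m, n)) a b = 0.
Proof.
rewrite /mxget; case: (insub a : option 'I_m) => [i|//].
by case: (insub b : option 'I_n) => [j|//]; rewrite mxE.
Qed.

Lemma blkmxE n B (j j' : 'I_n.+1) (k k' : 'I_q) :
  blkmx n B (bidx j k) (bidx j' k') = B j j' k k' :> C.
Proof. by rewrite mxE !bidx_div !bidx_mod mxget_ord. Qed.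

Lemma blkcolE n (B : nat -> 'M[C]_q) (j : 'I_n.+1) (k l : 'I_q) :
  blkcol n B (bidx j k) l = B j k l.
Proof. by rewrite mxE !bidx_div !bidx_mod mxget_ord. Qed.

Lemma eq_blkcol n (M N : 'M[C]_(n.+1 * q, q)) :
  (forall j k l, M (bidx j k) l = N (bidx j k) l) -> M = N.
Proof.
by move=> H; apply/matrixP => i l; have [j [k ->]] := bidx_surj i; exact: H.
Qed.

Lemma mul_Tmx n (B : nat -> 'M[C]_q) :
  Tmx R q n *m blkcol n B = blkcol n (sm1 B).
Proof.
apply: eq_blkcol => j k l; rewrite blkcolE mxE big_bidx.
under eq_bigr do under eq_bigr do rewrite blkmxE blkcolE.
case: j => -[|j] jn /=.
  by rewrite big1 ?mxE // => i _; rewrite big1 // => i' _; rewrite mxE mul0r.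
have jn' : (j < n.+1)%N by exact: ltnW.
rewrite (bigD1 (Ordinal jn')) //= eqxx (bigD1 k) //= mxE eqxx mul1r.
rewrite big1 ?addr0 => [|i ik]; last by rewrite mxE eq_sym (negbTE ik) mul0r.
rewrite big1 ?addr0 // => i ij; rewrite big1 // => i' _.
by rewrite eqSS eq_sym (negbTE (_ : nat_of_ord i != j)) ?mxE ?mul0r.
Qed.

(** T is strictly lower triangular, so the determinant is 1. *)
Lemma RT_unit n z : (1%:M - z *: Tmx R q n) \in unitmx.
Proof.
rewrite unitmxE det_trig; last first.
  apply/is_trig_mxP => i j ij; rewrite !mxE.
  have -> : (i == j) = false by apply: ltn_eqF.
  case: eqP => [e|_]; last by rewrite mxget0 mulr0 subr0.
  have : (i %/ q <= j %/ q)%N by apply: leq_div2r; exact: ltnW.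
  by rewrite e ltnn.
rewrite big1 ?unitr1 // => i _; rewrite !mxE eqxx.
have -> : (i %/ q == (i %/ q).+1)%N = false by rewrite ltn_eqF.
by rewrite mxget0 mulr0 subr0.
Qed.

(** Horner form of z^j A plus the sum over i < j of z^(j-1-i) s_i. These blocks of the upper right
    column do not depend on n. *)
Fixpoint Xc s z A (j : nat) : 'M[C]_q :=
  if j is j'.+1 then s j' + z *: Xc s z A j' else A.

Lemma RT_blkcol n s z A :
  RT q n z *m blkcol n (fun j => if j is j'.+1 then s j' else A) = blkcol n (Xc s z A).
Proof.
rewrite /RT; apply: (canLR (mulKmx (RT_unit n z))).
rewrite mulmxBl mul1mx -scalemxAl mul_Tmx.
apply: eq_blkcol => j k l; rewrite !mxE !bidx_div !bidx_mod !mxget_ord.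
by case: j => -[|j] jn /=; rewrite !mxE ?mulr0 ?subr0 // addrK.
Qed.

Definition Kf z A : 'M[C]_q := (z - conjc z)^-1 *: (A - adjmx A).

(** Common shape of the even and odd P_k. The corner K is a separate argument because for odd k the
    column starts with g + s_0, while the corner is built from g alone. *)
Definition PM s n z A K : 'M[C]_(n.+1 * q + q) :=
  block_mx (blkmx n (fun j k => s (j + k)%N)) (blkcol n (Xc s z A))
           (adjmx (blkcol n (Xc s z A))) K.

Lemma vmx_mul n A : vmx R q n *m A = blkcol n (fun j => if j is _.+1 then 0 else A).
Proof.
apply: eq_blkcol => j k l; rewrite blkcolE mxE.
under eq_bigr do rewrite blkcolE.
case: j => -[|j] jn /=; last by rewrite mxE big1 // => i _; rewrite mxE mul0r.
rewrite (bigD1 k) //= mxE eqxx mul1r big1 ?addr0 // => i ik.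
by rewrite mxE eq_sym (negbTE ik) mul0r.
Qed.

Lemma PevenE s (f : C -> 'M[C]_q) n z : Peven s f n z = PM s n z (f z) (Kf z (f z)).
Proof.
rewrite /Peven; have -> : RT q n z *m (vmx R q n *m f z - umx s n) = blkcol n (Xc s z (f z)).
  rewrite vmx_mul -RT_blkcol; congr (_ *m _); apply: eq_blkcol => j k l.
  rewrite !mxE !bidx_div !bidx_mod !mxget_ord opprK.
  by case: j => -[|j] jn /=; rewrite mxE ?add0r ?addr0.
by [].
Qed.

(** Block 0 of u_n is 0 and that of y_(0,n) is s_0, whence the summand [s 0]; the later blocks
    combine to [salpha]. *)
Lemma PoddE s alpha (f : C -> 'M[C]_q) n z : Podd s alpha f n z =
  PM (salpha s alpha) n z ((z - rC alpha) *: f z + s 0%N) (Kf z ((z - rC alpha) *: f z)).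
Proof.
rewrite /Podd; set g := _ *: f z.
have -> : RT q n z *m (vmx R q n *m g - (- rC alpha *: umx s n - y0mx s n)) =
    blkcol n (Xc (salpha s alpha) z (g + s 0%N)).
  rewrite vmx_mul -RT_blkcol; congr (_ *m _); apply: eq_blkcol => j k l.
  rewrite !mxE !bidx_div !bidx_mod !mxget_ord.
  case: j => -[|j] jn /=; rewrite !mxE; ring.
by [].
Qed.

(** The quadratic form of [PM] at the vector with blocks x 0, ..., x n, y. Indexing the blocks by
    nat lets n change without casts. *)
Definition Qf s n z A K x y : C :=
  \sum_(j < n.+1) \sum_(k < n.+1) bl (s (j + k)%N) (x j) (x k) +
  \sum_(j < n.+1) bl (Xc s z A j) (x j) y +
  \sum_(j < n.+1) bl (adjmx (Xc s z A j)) y (x j) + bl K y y.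

Definition bvec n x : 'cV[C]_(n.+1 * q) :=
  \col_i mxget (x (i %/ q)%N) (i %% q)%N 0%N.

Lemma bvecE n x (j : 'I_n.+1) (k : 'I_q) : bvec n x (bidx j k) 0 = x j k 0.
Proof. by rewrite mxE bidx_div bidx_mod (mxget_ord (x j) k 0). Qed.

Lemma bvec_surj n (v : 'cV[C]_(n.+1 * q)) : exists x, v = bvec n x.
Proof.
exists (fun j => if insub j is Some j' then \col_k v (bidx (j' : 'I_n.+1) k) 0 else 0).
apply/matrixP => i l; rewrite ord1; have [j [k ->]] := bidx_surj i.
by rewrite bvecE valK mxE.
Qed.

Lemma bl_block m n (A : 'M[C]_m) (B : 'M[C]_(m, n)) (D : 'M[C]_n) (a : 'cV[C]_m) (b : 'cV[C]_n) :
  bl (block_mx A B (adjmx B) D) (col_mx a b) (col_mx a b) =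
  bl A a a + bl B a b + bl (adjmx B) b a + bl D b b.
Proof.
rewrite /bl; have -> : adjmx (col_mx a b) = row_mx (adjmx a) (adjmx b).
  by rewrite /adjmx map_col_mx tr_col_mx.
rewrite mul_row_block mul_row_col !mulmxDl !mxE; ring.
Qed.

Lemma bl_bvec_blkcol n (B : nat -> 'M[C]_q) x y :
  bl (blkcol n B) (bvec n x) y = \sum_(j < n.+1) bl (B j) (x j) y.
Proof.
rewrite blE big_bidx; apply: eq_bigr => j _; rewrite blE; apply: eq_bigr => k _.
by apply: eq_bigr => l _; rewrite bvecE blkcolE.
Qed.

Lemma Qf_PM s n z A K x y :
  bl (PM s n z A K) (col_mx (bvec n x) y) (col_mx (bvec n x) y) = Qf s n z A K x y.
Proof.
rewrite bl_block /Qf bl_adj bl_bvec_blkcol; congr (_ + _ + _ + _).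
  rewrite blE big_bidx; apply: eq_bigr => j _.
  transitivity (\sum_(k < q) \sum_(j' < n.+1) \sum_(k' < q)
      conjc (x j k 0) * s (j + j')%N k k' * x j' k' 0).
    apply: eq_bigr => k _; rewrite big_bidx; apply: eq_bigr => j' _.
    by apply: eq_bigr => k' _; rewrite !bvecE blkmxE.
  rewrite exchange_big /=; apply: eq_bigr => j' _.
  by rewrite blE.
rewrite rmorph_sum; apply: eq_bigr => j _.
by rewrite bl_adj.
Qed.

Lemma PM_psdP s n z A K : psd (PM s n z A K) <-> forall x y, 0 <= Qf s n z A K x y.
Proof.
split => [/psdP H x y|H]; first by rewrite -Qf_PM.
apply/psdP => v; rewrite -[v]vsubmxK; have [x ->] := bvec_surj (usubmx v).
by rewrite Qf_PM.
Qed.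

(** The blocks do not depend on n, so the smaller matrix is a principal submatrix; on forms, the
    test vector is padded with zeros. *)
Lemma PM_psd_le s n n' z A K : (n' <= n)%N -> psd (PM s n z A K) -> psd (PM s n' z A K).
Proof.
move=> nn /PM_psdP H; apply/PM_psdP => x y.
pose x' j := if (j < n'.+1)%N then x j else 0.
have trunc (F : nat -> C) : (forall j, (n' < j)%N -> F j = 0) ->
    \sum_(j < n.+1) F j = \sum_(j < n'.+1) F j.
  move=> F0; rewrite -!(big_mkord predT) (big_cat_nat (n := n'.+1)) //=.
  rewrite [X in _ + X]big_nat_cond [X in _ + X]big1 ?addr0 // => j /andP[/andP[j1 _] _].
  exact: F0.
have := H x' y; congr (0 <= _); rewrite /Qf.
have x'0 j : (n' < j)%N -> x' j = 0.
  by move=> nj; rewrite /x'; case: ltnP => //; rewrite ltnS leqNgt nj.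
have x'E (j : 'I_n'.+1) : x' j = x j by rewrite /x' ltn_ord.
congr (_ + _ + _ + _).
- rewrite (trunc (fun j => \sum_(k < n.+1) bl (s (j + k)%N) (x' j) (x' k))); last first.
    by move=> j /x'0 ->; rewrite big1 // => k _; rewrite bl0l.
  apply: eq_bigr => j _; rewrite (trunc (fun k => bl (s (j + k)%N) (x' j) (x' k))); last first.
    by move=> k /x'0 ->; rewrite bl0r.
  by apply: eq_bigr => k _; rewrite !x'E.
- rewrite (trunc (fun j => bl (Xc s z A j) (x' j) y)); last by move=> j /x'0 ->; rewrite bl0l.
  by apply: eq_bigr => k _; rewrite x'E.
- rewrite (trunc (fun j => bl (adjmx (Xc s z A j)) y (x' j))); last by move=> j /x'0 ->; rewrite bl0r.
  by apply: eq_bigr => k _; rewrite x'E.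
Qed.

Lemma PM_psd_corner s n z A K : psd (PM s n z A K) -> psd K.
Proof.
move=> /PM_psdP H; apply/psdP => y; have := H (fun=> 0) y; rewrite /Qf.
rewrite big1 ?add0r => [|j _]; last by rewrite big1 // => k _; rewrite bl0l.
rewrite big1 ?add0r => [|j _]; last by rewrite bl0l.
by rewrite big1 ?add0r // => j _; rewrite bl0r.
Qed.

Lemma PM_psd_moments s n z A K : psd (PM s n z A K) ->
  forall j k, (j <= n)%N -> (k <= n)%N -> adjmx (s (j + k)%N) = s (j + k)%N.
Proof.
move=> [/matrixP H _] j k jn kn; apply/matrixP => a b; rewrite adjmxE.
have := H (lshift q (bidx (Ordinal (jn : (j < n.+1)%N)) a))
          (lshift q (bidx (Ordinal (kn : (k < n.+1)%N)) b)).
by rewrite adjmxE !block_mxEul !blkmxE /= addnC.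
Qed.

Lemma PM_psd_s0 s n z A K : psd (PM s n z A K) -> psd (s 0%N).
Proof.
move=> H; have {H} /PM_psdP H := PM_psd_le (leq0n n) H.
apply/psdP => u; have := H (fun=> u) 0.
by rewrite /Qf !big_ord1 !(bl0r, bl0l) !addr0.
Qed.

Lemma PM_psd_minor s n z A K a b : psd (PM s n z A K) ->
  nm (A a b) ^+ 2 <= Re (s 0%N a a) * Re (K b b).
Proof.
move=> H; have := psd_minor (lshift q (bidx ord0 a)) (rshift (n.+1 * q)%N b) H.
by rewrite block_mxEur block_mxEul block_mxEdr blkmxE blkcolE.
Qed.

End BlockMatrices.

(** * Conjugation symmetry and limits *)

Section ConjugateSymmetry.
Variable R : realType.
Local Notation C := R[i].
Variable q : nat.
Implicit Types (s M : nat -> 'M[C]_q) (A K : 'M[C]_q) (z : C) (x p : nat -> 'cV[C]_q) (y w : 'cV[C]_q).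

(* If F(z) and the s_j are the integrals of 1/(t - z) and t^j against a measure,
   lam k is the integral of t^k / |t - z|^2; it is invariant under conjugation of z. *)
Fixpoint lamp s z A K k : 'M[C]_q * 'M[C]_q :=
  if k is k'.+1 then
    let: (a, b) := lamp s z A K k' in
    (b, s k' + (z + conjc z) *: b - (z * conjc z) *: a)
  else (K, A + conjc z *: K).

Definition lam s z A K k := (lamp s z A K k).1.

Lemma lam0 s z A K : lam s z A K 0 = K. Proof. by []. Qed.

Lemma lam1 s z A K : lam s z A K 1 = A + conjc z *: K. Proof. by []. Qed.

Lemma lamSS s z A K k : lam s z A K k.+2 =
  s k + (z + conjc z) *: lam s z A K k.+1 - (z * conjc z) *: lam s z A K k.
Proof. by rewrite /lam /=; case: (lamp s z A K k). Qed.

(** The recursion involves z only through z + conj z and z conj z. The starting values agree because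
    the hypothesis says that A + conj z K equals [adjmx A] + z K. *)
Lemma lamp_conj s z A K k : A - adjmx A = (z - conjc z) *: K ->
  lamp s (conjc z) (adjmx A) K k = lamp s z A K k.
Proof.
move=> AK; elim: k => [|k ih] /=.
  congr pair; rewrite conjcK; apply/eqP; rewrite -subr_eq0 opprD addrACA -scalerBl.
  by rewrite -AK -opprB addNr.
by rewrite ih; case: (lamp s z A K k) => a b; rewrite conjcK [conjc z + z]addrC [conjc z * z]mulrC.
Qed.

(** Formally, t^j / (t - z) = (t^(j+1) - conj z t^j) / |t - z|^2. *)
Lemma Xc_lam s z A K j : Xc s z A j = lam s z A K j.+1 - conjc z *: lam s z A K j.
Proof.
elim: j => [|j ih] /=; first by rewrite lam1 lam0 addrK.
rewrite ih lamSS; apply/matrixP => a b; rewrite !mxE; ring.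
Qed.

Lemma lam_herm s z A K N : adjmx K = K -> A - adjmx A = (z - conjc z) *: K ->
  (forall k, (k < N)%N -> adjmx (s k) = s k) ->
  forall k, (k <= N.+1)%N -> adjmx (lam s z A K k) = lam s z A K k.
Proof.
move=> hK AK hs k kN; suff [] : adjmx (lam s z A K k) = lam s z A K k /\
    ((k < N.+1)%N -> adjmx (lam s z A K k.+1) = lam s z A K k.+1) by [].
elim: k kN => [|k ih] kN.
  split; first by rewrite lam0.
  move=> _; rewrite lam1 adjmxD adjmxZ conjcK hK; apply/eqP.
  by rewrite -subr_eq0 opprD addrACA -scalerBl -AK -opprB addNr.
have [h1 h2] := ih (ltnW kN); have h3 := h2 kN; split => // kN'.
have e1 : conjc (z + conjc z) = z + conjc z by rewrite rmorphD /= conjcK addrC.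
have e2 : conjc (z * conjc z) = z * conjc z by rewrite rmorphM /= conjcK mulrC.
by rewrite lamSS adjmxB adjmxD !adjmxZ e1 e2 h1 h3 hs.
Qed.

(* Coefficients of the polynomial (t - z) * \sum_(k <= n) x_k t^k + y. *)
Definition pv n z x y k : 'cV[C]_q :=
  (if k is k'.+1 then x k' else y) - z *: (if (k <= n)%N then x k else 0).

Lemma blBl m n (M : 'M[C]_(m, n)) (a b : 'cV[C]_m) (v : 'cV[C]_n) :
  bl M (a - b) v = bl M a v - bl M b v.
Proof. by rewrite -scaleN1r blDl blZl rmorphN rmorph1 mulN1r. Qed.

Lemma blBr m n (M : 'M[C]_(m, n)) (v : 'cV[C]_m) (a b : 'cV[C]_n) :
  bl M v (a - b) = bl M v a - bl M v b.
Proof. by rewrite -scaleN1r blDr blZr mulN1r. Qed.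

(** Summation by parts moves the factor t - z from the vectors to the coefficients; [bl] is
    conjugate linear on the left, whence conj z. *)
Lemma pv_suml n z x y M w :
  \sum_(j < n.+2) bl (M j) (pv n z x y j) w =
  bl (M 0%N) y w + \sum_(j < n.+1) bl (M j.+1 - conjc z *: M j) (x j) w.
Proof.
under eq_bigr do rewrite blBl blZl.
rewrite sumrB big_ord_recl [X in _ - X]big_ord_recr /= ltnn bl0l mulr0 addr0 -addrA; congr (_ + _).
rewrite -sumrB; apply: eq_bigr => j _.
by rewrite -ltnS ltn_ord /= /bump /= add1n blBm blZm.
Qed.

Lemma pv_sumr n z x y M w :
  \sum_(j < n.+2) bl (M j) w (pv n z x y j) =
  bl (M 0%N) w y + \sum_(j < n.+1) bl (M j.+1 - z *: M j) w (x j).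
Proof.
under eq_bigr do rewrite blBr blZr.
rewrite sumrB big_ord_recl [X in _ - X]big_ord_recr /= ltnn bl0r mulr0 addr0 -addrA; congr (_ + _).
rewrite -sumrB; apply: eq_bigr => j _.
by rewrite -ltnS ltn_ord /= /bump /= add1n blBm blZm.
Qed.

(** The congruence with a block Hankel matrix. Formally, with p(t) the sum of the x_k t^k, both
    sides integrate the square of p(t) + y/(t - z), that is, the square of (t - z) p(t) + y divided
    by |t - z|^2. *)
Lemma Qf_lam s z A K n x y : adjmx K = K -> A - adjmx A = (z - conjc z) *: K ->
  (forall k, (k <= n + n)%N -> adjmx (s k) = s k) ->
  Qf s n z A K x y = \sum_(j < n.+2) \sum_(k < n.+2)
    bl (lam s z A K (j + k)) (pv n z x y j) (pv n z x y k).
Proof.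
move=> hK AK hs; set L := lam s z A K.
have hL k : (k <= n.+1)%N -> adjmx (L k) = L k.
  move=> kn; apply: (lam_herm (N := (n + n)%N.+1)) => //.
  by apply: (leq_trans kn); rewrite ltnS (leq_trans (leq_addr n n)).
under eq_bigr do rewrite (pv_sumr n z x y (fun k => L (_ + k)%N)).
rewrite big_split /=.
rewrite (pv_suml n z x y (fun j => L (j + 0)%N)).
rewrite exchange_big /=.
under [X in _ = _ + X]eq_bigr => k _ do
  rewrite (pv_suml n z x y (fun j => L (j + k.+1)%N - z *: L (j + k)%N)).
rewrite big_split /=.
have E1 : \sum_(j < n.+1) bl (L (j.+1 + 0)%N - conjc z *: L (j + 0)%N) (x j) y =
    \sum_(j < n.+1) bl (Xc s z A j) (x j) y.
  by apply: eq_bigr => j _; rewrite !addn0 (Xc_lam s z A K).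
have E2 : \sum_(k < n.+1) bl (L (0 + k.+1)%N - z *: L (0 + k)%N) y (x k) =
    \sum_(j < n.+1) bl (adjmx (Xc s z A j)) y (x j).
  apply: eq_bigr => k _; rewrite !add0n (Xc_lam s z A K) adjmxB adjmxZ conjcK !hL //.
  by rewrite -ltnS ltnS ltnW // ltn_ord.
have E3 : \sum_(k < n.+1) \sum_(j < n.+1) bl (L (j.+1 + k.+1)%N - z *: L (j.+1 + k)%N -
      conjc z *: (L (j + k.+1)%N - z *: L (j + k)%N)) (x j) (x k) =
    \sum_(j < n.+1) \sum_(k < n.+1) bl (s (j + k)%N) (x j) (x k).
  rewrite exchange_big; apply: eq_bigr => j _; apply: eq_bigr => k _.
  congr (bl _ _ _); rewrite addSn !addnS addSn /L lamSS.
  apply/matrixP => a b; rewrite !mxE; ring.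
rewrite E1 E2 E3 /Qf /L lam0; ring.
Qed.

(** Division with remainder: every polynomial of degree at most n + 1 is (t - z) times a polynomial
    of degree at most n, plus a constant. *)
Lemma pv_surj n z p : exists x y, forall k, (k <= n.+1)%N -> pv n z x y k = p k.
Proof.
(* Synthetic division from the leading coefficient: [xr i] is the coefficient of t^(n+1-i) in the
   quotient, and [xr n.+2] is the remainder. *)
pose xr := fix xr i := if i is i'.+1 then p (n.+1 - i')%N + z *: xr i' else 0.
exists (fun j => xr (n.+1 - j)%N), (xr n.+2) => k kn.
have key i : (i <= n.+1)%N -> xr (n.+2 - i)%N = p i + z *: xr (n.+1 - i)%N.
  by move=> i1; rewrite subSn //= subKn.
rewrite /pv; have -> : (if (k <= n)%N then xr (n.+1 - k)%N else 0) = xr (n.+1 - k)%N.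
  case: leqP => // nk; have -> : k = n.+1 by apply/eqP; rewrite eqn_leq kn.
  by rewrite subnn.
case: k kn => [|k] kn; first by rewrite -[n.+2]subn0 key // addrK.
by rewrite -[(n.+1 - k)%N]/(n.+2 - k.+1)%N key // addrK.
Qed.

Lemma PM_psd_conj s n z A K : A - adjmx A = (z - conjc z) *: K ->
  psd (PM s n z A K) -> psd (PM s n (conjc z) (adjmx A) K).
Proof.
move=> AK H; have [hK _] := PM_psd_corner H.
have hs k : (k <= n + n)%N -> adjmx (s k) = s k.
  move=> kn; have [kn1|kn1] := leqP k n.
    by rewrite -[k]addn0; apply: (PM_psd_moments H).
  rewrite -(subnKC (ltnW kn1)); apply: (PM_psd_moments H) => //.
  by rewrite leq_subLR.
have AK' : adjmx A - adjmx (adjmx A) = (conjc z - conjc (conjc z)) *: K.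
  by rewrite adjmxK conjcK -opprB AK -scaleNr opprB.
move/PM_psdP: H => H; apply/PM_psdP => x y.
(* The polynomial formed with t - conj z is divided anew by t - z. The form in [lam] sees only the
   polynomial, and [lam] is the same at both points. *)
have [x' [y' pE]] := pv_surj n z (pv n (conjc z) x y).
suff -> : Qf s n (conjc z) (adjmx A) K x y = Qf s n z A K x' y' by exact: H.
rewrite (Qf_lam x y hK AK' hs) (Qf_lam x' y' hK AK hs).
apply: eq_bigr => j _; apply: eq_bigr => k _.
have jn : (j <= n.+1)%N by rewrite -ltnS ltn_ord.
have kn : (k <= n.+1)%N by rewrite -ltnS ltn_ord.
by rewrite (pE j jn) (pE k kn) /lam lamp_conj.
Qed.

End ConjugateSymmetry.

(** * Closedness of nonnegativity under limits *)

Section PsdLimits.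
Variable R : realType.
Local Notation C := R[i].
Implicit Types (f g : C -> C) (w z : C).

Lemma ccont_cst (a w : C) : ccont (fun=> a) w.
Proof. by apply/contCP => e e0; exists 1 => // z _; rewrite subrr nm0 ltW. Qed.

Lemma ccont_id w : ccont (fun z : C => z) w.
Proof. by apply/contCP => e e0; exists e => // z /ltW. Qed.

Lemma ccontD f g w : ccont f w -> ccont g w -> ccont (fun z => f z + g z) w.
Proof. by move=> hf hg; exact: (cvgD (F := nbhs (w : C^o)) hf hg). Qed.

Lemma ccontB f g w : ccont f w -> ccont g w -> ccont (fun z => f z - g z) w.
Proof. by move=> hf hg; exact: (cvgB (F := nbhs (w : C^o)) hf hg). Qed.

Lemma ccontM f g w : ccont f w -> ccont g w -> ccont (fun z => f z * g z) w.
Proof. by move=> hf hg; exact: (cvgM (F := nbhs (w : C^o)) hf hg). Qed.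

Lemma ccontV f w : f w != 0 -> ccont f w -> ccont (fun z => (f z)^-1) w.
Proof. by move=> f0 hf; exact: (cvgV (F := nbhs (w : C^o)) f0 hf). Qed.

Lemma ccont_conj f w : ccont f w -> ccont (fun z => conjc (f z)) w.
Proof.
move=> /contCP H; apply/contCP => e /H[d d0 dP]; exists d => // z /dP.
by rewrite -rmorphB nm_conj.
Qed.

Lemma ccont_sum (I : finType) (F : I -> C -> C) w :
  (forall i, ccont (F i) w) -> ccont (fun z => \sum_i F i z) w.
Proof.
move=> FC; elim: (index_enum I) => [|i r ih].
  rewrite (_ : (fun z => _) = fun=> 0); first exact: ccont_cst.
  by apply/funext => z; rewrite big_nil.
rewrite (_ : (fun z => _) = fun z => F i z + \sum_(j <- r) F j z).
  exact: (ccontD (FC i) ih).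
by apply/funext => z; rewrite big_cons.
Qed.

Definition mcont m n (A : C -> 'M[C]_(m, n)) w := forall i j, ccont (fun z => A z i j) w.

Lemma ccont_bl m n (A : C -> 'M[C]_(m, n)) (x : 'cV[C]_m) (y : 'cV[C]_n) w :
  mcont A w -> ccont (fun z => bl (A z) x y) w.
Proof.
move=> hA; rewrite (_ : (fun z => _) = fun z => \sum_i \sum_j conjc (x i 0) * A z i j * y j 0).
  apply: ccont_sum => i; apply: ccont_sum => j.
  apply: (@ccontM (fun z => conjc (x i 0) * A z i j) (fun=> y j 0)); last exact: ccont_cst.
  by apply: (@ccontM (fun=> conjc (x i 0)) (fun z => A z i j)); [exact: ccont_cst|exact: hA].
by apply/funext => z; rewrite blE.
Qed.

Lemma mcont_adj m n (A : C -> 'M[C]_(m, n)) w : mcont A w -> mcont (fun z => adjmx (A z)) w.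
Proof.
move=> hA i j; rewrite (_ : (fun z => _) = fun z => conjc (A z j i)).
  exact: ccont_conj.
by apply/funext => z; rewrite adjmxE.
Qed.

Lemma mcont_cst m n (A : 'M[C]_(m, n)) w : mcont (fun=> A) w.
Proof. by move=> i j; exact: ccont_cst. Qed.

Lemma mcontD m n (A B : C -> 'M[C]_(m, n)) w : mcont A w -> mcont B w ->
  mcont (fun z => A z + B z) w.
Proof.
move=> hA hB i j; rewrite (_ : (fun z => _) = fun z => A z i j + B z i j).
  exact: (ccontD (hA i j) (hB i j)).
by apply/funext => z; rewrite mxE.
Qed.

Lemma mcontZ m n f (A : C -> 'M[C]_(m, n)) w : ccont f w -> mcont A w ->
  mcont (fun z => f z *: A z) w.
Proof.
move=> fC hA i j; rewrite (_ : (fun z => _) = fun z => f z * A z i j).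
  exact: (ccontM fC (hA i j)).
by apply/funext => z; rewrite mxE.
Qed.

Lemma mcontB m n (A B : C -> 'M[C]_(m, n)) w : mcont A w -> mcont B w ->
  mcont (fun z => A z - B z) w.
Proof.
move=> hA hB i j; rewrite (_ : (fun z => _) = fun z => A z i j - B z i j).
  exact: (ccontB (hA i j) (hB i j)).
by apply/funext => z; rewrite !mxE.
Qed.

Variable q : nat.
Implicit Types (s : nat -> 'M[C]_q) (A K : C -> 'M[C]_q).

Lemma mcont_Xc s A w j : mcont A w -> mcont (fun z => Xc s z (A z) j) w.
Proof.
move=> hA; elim: j => [|j ih]; first exact: hA.
have h1 := @mcont_cst q q (s j) w.
have h2 := @mcontZ q q (fun z => z) (fun z => Xc s z (A z) j) w (@ccont_id w) ih.
exact: (@mcontD q q (fun=> s j) (fun z => z *: Xc s z (A z) j) w h1 h2).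
Qed.

Lemma ccont_Qf s n A K x y w : mcont A w -> mcont K w ->
  ccont (fun z => Qf s n z (A z) (K z) x y) w.
Proof.
move=> hA hKc.
have h1 : ccont (fun z => \sum_(j < n.+1) bl (Xc s z (A z) j) (x j) y) w.
  by apply: ccont_sum => j; apply: ccont_bl; exact: mcont_Xc.
have h2 : ccont (fun z => \sum_(j < n.+1) bl (adjmx (Xc s z (A z) j)) y (x j)) w.
  by apply: ccont_sum => j; apply: ccont_bl; apply: mcont_adj; exact: mcont_Xc.
have h3 := @ccont_bl _ _ K y y w hKc.
have h0 := @ccont_cst (\sum_(j < n.+1) \sum_(k < n.+1) bl (s (j + k)%N) (x j) (x k)) w.
exact: (ccontD (ccontD (ccontD h0 h1) h2) h3).
Qed.

(** Approximate nonnegativity is what is available on the half-line: the forms of S(x + iy) have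
    nonnegative real part but become real only as y tends to 0. *)
Lemma ccont_ge0 f w : ccont f w ->
  (forall e, 0 < e -> exists z, nm (z - w) < e /\ - rC e <= rC (Re (f z)) /\ `|Im (f z)| <= e) ->
  0 <= f w.
Proof.
move=> /contCP fC H; apply/ge0_complexP; split.
  rewrite -oppr_le0; apply: le_eps0 => e e0.
  have e2 : 0 < e / 2 by rewrite divr_gt0.
  have [d d0 dP] := fC _ e2.
  have [|z [zw [h1 h2]]] := H (Num.min d (e / 2)); first by rewrite lt_min d0.
  move: zw; rewrite lt_min => /andP[/dP zw _].
  have := le_trans (Re_le_nm _) zw; rewrite cReB ler_norml => /andP[_ h3].
  move: h1; have -> : - rC (Num.min d (e / 2)) = rC (- Num.min d (e / 2)) :> C.
    by apply: complex_eq; rewrite /= ?oppr0.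
  rewrite le_rC; have h4 : Num.min d (e / 2) <= e / 2 by rewrite ge_min lexx orbT.
  by move: h3 h4; clear; set k := Num.min _ _; lra.
apply/eqP; rewrite -normr_eq0 eq_le normr_ge0 andbT; apply: le_eps0 => e e0.
have e2 : 0 < e / 2 by rewrite divr_gt0.
have [d d0 dP] := fC _ e2.
have [|z [zw [h1 h2]]] := H (Num.min d (e / 2)); first by rewrite lt_min d0.
move: zw; rewrite lt_min => /andP[/dP zw _].
have h3 := le_trans (Im_le_nm _) zw; rewrite cImB in h3.
have h4 : Num.min d (e / 2) <= e / 2 by rewrite ge_min lexx orbT.
have h5 := ler_normB (Im (f z)) (Im (f z) - Im (f w)); rewrite subKr in h5.
by move: h2 h3 h4 h5; clear; set k := Num.min _ _; lra.
Qed.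

Lemma ccont_ge0_dense f w : ccont f w ->
  (forall e, 0 < e -> exists z, nm (z - w) < e /\ 0 <= f z) -> 0 <= f w.
Proof.
move=> fC H; apply: ccont_ge0 => // e e0; have [z [zw /ge0_complexP[h1 h2]]] := H e e0.
exists z; split => //; rewrite h2 normr0 (ltW e0); split => //.
have -> : - rC e = rC (- e) :> C by apply: complex_eq; rewrite /= ?oppr0.
by rewrite le_rC (le_trans _ h1) // oppr_le0 ltW.
Qed.

Lemma PM_psd_limit s n A K w : mcont A w -> mcont K w ->
  (forall e, 0 < e -> exists z, nm (z - w) < e /\ psd (PM s n z (A z) (K z))) ->
  psd (PM s n w (A w) (K w)).
Proof.
move=> hA hKc H; apply/PM_psdP => x y.
apply: (@ccont_ge0_dense (fun z => Qf s n z (A z) (K z) x y)); first exact: ccont_Qf.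
by move=> e /H[z [zw /PM_psdP h]]; exists z.
Qed.

Lemma psd_limit K w : mcont K w ->
  (forall e, 0 < e -> exists z, nm (z - w) < e /\ psd (K z)) -> psd (K w).
Proof.
move=> hKc H; apply/psdP => y.
apply: (@ccont_ge0_dense (fun z => bl (K z) y y)); first exact: ccont_bl.
by move=> e /H[z [zw /psdP h]]; exists z.
Qed.

Lemma mcont_Kf A w : Im w != 0 -> mcont A w -> mcont (fun z => Kf z (A z)) w.
Proof.
move=> w0 hA; have h1 : ccont (fun z : C => z - conjc z) w.
  exact: (ccontB (@ccont_id w) (ccont_conj (@ccont_id w))).
have zz : w - conjc w != 0.
  apply/eqP => /(congr1 (@complex.Im R)); rewrite cImB cImJ /= => h0.
  by move/eqP: w0; apply; move: h0; clear; lra.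
have h2 := @ccontV (fun z => z - conjc z) w zz h1.
have h3 := mcontB hA (mcont_adj hA).
exact: (@mcontZ q q (fun z => (z - conjc z)^-1) (fun z => A z - adjmx (A z)) w h2 h3).
Qed.

End PsdLimits.

(** * The matrices P_k *)

Section PkProperties.
Variable R : realType.
Local Notation C := R[i].
Variable q : nat.
Variables (s : nat -> 'M[C]_q) (alpha : R).
Implicit Types (f : C -> 'M[C]_q) (z w : C).

Lemma Pk_eq f g k z : f z = g z -> Pk_psd s alpha f k z -> Pk_psd s alpha g k z.
Proof.
by rewrite /Pk_psd /Peven /Podd /Pm1 => ->.
Qed.

Lemma Pk_even f n z : Pk_psd s alpha f (n.*2)%:Z z <->
  psd (PM s n z (f z) (Kf z (f z))).
Proof. rewrite /Pk_psd odd_double doubleK PevenE; exact: iff_refl. Qed.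

Lemma Pk_odd f n z : Pk_psd s alpha f (n.*2.+1)%:Z z <->
  psd (PM (salpha s alpha) n z ((z - rC alpha) *: f z + s 0%N)
     (Kf z ((z - rC alpha) *: f z))).
Proof.
rewrite /Pk_psd oddS odd_double.
rewrite (_ : (n.*2.+1)./2 = n) ?PoddE; last by rewrite -addn1 halfD odd_double doubleK addn0.
exact: iff_refl.
Qed.

Lemma Pk_N1 f z : Pk_psd s alpha f (-1) z <-> psd (Kf z ((z - rC alpha) *: f z)).
Proof. exact: iff_refl. Qed.

Lemma odd_or_even (k : nat) : k = if odd k then k./2.*2.+1 else k./2.*2.
Proof. by rewrite -[LHS]odd_double_half; case: (odd k). Qed.

Lemma Pk_parity (P : int -> Prop) : P (-1) -> (forall n, P (n.*2)%:Z) ->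
  (forall n, P (n.*2.+1)%:Z) -> forall k : int, -1 <= k -> P k.
Proof.
move=> p1 pe po [k|[|k]] // _; rewrite (odd_or_even k).
by case: (odd k); [exact: po|exact: pe].
Qed.

Lemma Pk_lower f z k k' : odd k = odd k' -> (k' <= k)%N ->
  Pk_psd s alpha f k%:Z z -> Pk_psd s alpha f k'%:Z z.
Proof.
move=> e le; have le2 : (k'./2 <= k./2)%N by exact: half_leq.
rewrite (odd_or_even k) (odd_or_even k') e; case: (odd k').
  by move=> /(Pk_odd f k./2 z) H; apply/(Pk_odd f k'./2 z); exact: PM_psd_le le2 H.
by move=> /(Pk_even f k./2 z) H; apply/(Pk_even f k'./2 z); exact: PM_psd_le le2 H.
Qed.

(** One of the two inequalities serves the even k, the other the odd ones, by principal submatrices;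
    P_(-1) is the lower right corner of every odd P_k. *)
Lemma Pk_down f z m : Pk_psd s alpha f m%:Z z -> Pk_psd s alpha f (m%:Z - 1) z ->
  forall k : int, -1 <= k <= m%:Z -> Pk_psd s alpha f k z.
Proof.
case: m => [|m] Hm Hm1 k /andP[k1 km].
  case: k k1 km => [[|k]|[|k]] //.
have e : m.+1%:Z - 1 = m%:Z by rewrite -addn1 PoszD addrK.
rewrite e in Hm1.
case: k k1 km => [k|[|k]] //= _ km.
  have [ok|ok] := eqVneq (odd k) (odd m.+1).
    by apply: (Pk_lower _ _ Hm) => //.
  apply: (Pk_lower _ _ Hm1).
    by move: ok; rewrite /=; case: (odd k); case: (odd m).
  have : (k <= m.+1)%N by [].
  rewrite leq_eqVlt ltnS => /orP[/eqP kE|//]; by rewrite kE eqxx in ok.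
have low n : odd n -> Pk_psd s alpha f n%:Z z -> Pk_psd s alpha f (-1) z.
  move=> on; rewrite (odd_or_even n) on => /(Pk_odd f n./2 z) H.
  apply/(Pk_N1 f z); exact: PM_psd_corner H.
by case om: (odd m); [exact: low Hm1|apply: low Hm; rewrite /= om].
Qed.

Lemma mcont_shift f w : mcont f w -> mcont (fun z => (z - rC alpha) *: f z) w.
Proof.
move=> hf; have h1 := ccontB (@ccont_id R w) (@ccont_cst R (rC alpha) w).
exact: (@mcontZ R q q (fun z => z - rC alpha) f w h1 hf).
Qed.

Lemma Pk_limit f k w : Im w != 0 -> mcont f w -> -1 <= k ->
  (forall e, 0 < e -> exists z, nm (z - w) < e /\ Pk_psd s alpha f k z) ->
  Pk_psd s alpha f k w.
Proof.
move=> w0 hf k1; have hg := mcont_shift hf; move: k k1; apply: Pk_parity.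
- move=> H; apply: (iffRL (Pk_N1 f w)).
  apply: (@psd_limit R q (fun z => Kf z ((z - rC alpha) *: f z)) w (mcont_Kf w0 hg)).
  by move=> e /H[z [zw Hz]]; exists z; split; [exact: zw|exact: (iffLR (Pk_N1 f z) Hz)].
- move=> n H; apply: (iffRL (Pk_even f n w)).
  apply: (@PM_psd_limit R q s n f (fun z => Kf z (f z)) w hf (mcont_Kf w0 hf)).
  by move=> e /H[z [zw Hz]]; exists z; split; [exact: zw|exact: (iffLR (Pk_even f n z) Hz)].
- move=> n H; apply: (iffRL (Pk_odd f n w)).
  apply: (@PM_psd_limit R q (salpha s alpha) n (fun z => (z - rC alpha) *: f z + s 0%N)
    (fun z => Kf z ((z - rC alpha) *: f z)) w _ (mcont_Kf w0 hg)).
    exact: (@mcontD R q q (fun z => (z - rC alpha) *: f z) (fun=> s 0%N) w hg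
      (@mcont_cst R q q (s 0%N) w)).
  by move=> e /H[z [zw Hz]]; exists z; split; [exact: zw|exact: (iffLR (Pk_odd f n z) Hz)].
Qed.

Lemma Kf_eq z (A : 'M[C]_q) : Im z != 0 -> A - adjmx A = (z - conjc z) *: Kf z A.
Proof.
move=> z0; rewrite /Kf scalerA mulfV ?scale1r //.
apply/eqP => /(congr1 (@complex.Im R)); rewrite cImB cImJ /= => h0.
by move/eqP: z0; apply; move: h0; lra.
Qed.

Lemma Kf_conj z (A : 'M[C]_q) : Kf (conjc z) (adjmx A) = Kf z A.
Proof.
by rewrite /Kf conjcK adjmxK -[conjc z - z]opprB -[adjmx A - A]opprB invrN scalerN scaleNr opprK.
Qed.

Lemma Pk_conj f k z : Im z != 0 -> adjmx (s 0%N) = s 0%N -> f (conjc z) = adjmx (f z) ->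
  -1 <= k -> Pk_psd s alpha f k z -> Pk_psd s alpha f k (conjc z).
Proof.
move=> z0 hs hf k1.
have gE : (conjc z - rC alpha) *: f (conjc z) = adjmx ((z - rC alpha) *: f z).
  rewrite hf adjmxZ rmorphB; congr ((_ - _) *: _).
  by rewrite /= /rC oppr0.
move: k k1; apply: Pk_parity.
- by move=> /(Pk_N1 f z) H; apply/(Pk_N1 f (conjc z)); rewrite gE Kf_conj.
- move=> n /(Pk_even f n z) H; apply/(Pk_even f n (conjc z)); rewrite hf Kf_conj.
  by apply: PM_psd_conj H; exact: Kf_eq.
(* The column starts with g + s_0. Since s_0 is Hermitian it cancels from A - [adjmx A], and the
   corner built from g satisfies the hypothesis of [PM_psd_conj]. *)
- move=> n /(Pk_odd f n z) H; apply/(Pk_odd f n (conjc z)); rewrite gE Kf_conj -{1}hs -adjmxD.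
  apply: PM_psd_conj H; rewrite -Kf_eq // adjmxD hs.
  by rewrite opprD addrACA subrr addr0.
Qed.

Lemma Kf_diag z (A : 'M[C]_q) (v : 'cV[C]_q) : bl (Kf z A) v v = rC (Im (bl A v v) / Im z).
Proof.
rewrite blZm blBm bl_adj.
have e (a : C) : a - conjc a = Complex 0 2 * rC (Im a).
  by apply: complex_eq; case: a => a b /=; ring.
rewrite !e invfM mulrACA mulVf ?mul1r; last by apply/eqP => -[/eqP]; rewrite pnatr_eq0.
have -> : rC (Im (bl A v v) / Im z) = (rC (Im (bl A v v))) * rC (Im z)^-1.
  by apply: complex_eq; rewrite /=; ring.
have -> : (rC (Im z))^-1 = rC (Im z)^-1 :> C by exact: esym (fmorphV (real_complex R) _).
by rewrite mulrC.
Qed.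

(** * Entrywise bounds from P_0 and P_(-1) *)

Section Bounds.
Variables (z : C) (A : 'M[C]_q).
Hypotheses (z0 : 0 < Im z) (P0 : psd (PM s 0 z A (Kf z A)))
  (P1 : psd (Kf z ((z - rC alpha) *: A))).

Let c := \sum_i Re (s 0%N i i).

Let s_ge0 i : 0 <= Re (s 0%N i i).
Proof. by have [] := psd_diag_ge0 i (PM_psd_s0 P0). Qed.

Let s_le i : Re (s 0%N i i) <= c.
Proof. by rewrite /c (bigD1 i) //= lerDl sumr_ge0. Qed.

Lemma bound_c_ge0 : 0 <= c.
Proof. exact: sumr_ge0. Qed.

Let Kdiag i : Re (Kf z A i i) = Im (A i i) / Im z.
Proof. by rewrite -!bl_delta Kf_diag. Qed.

Lemma Im_form_ge0 v : 0 <= Im (bl A v v).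
Proof.
have /psdP/(_ v) := PM_psd_corner P0; rewrite Kf_diag => /ge0_complexP[/= + _].
by rewrite pmulr_lge0 // invr_gt0.
Qed.

Let Im_diag i : 0 <= Im (A i i).
Proof. by rewrite -bl_delta Im_form_ge0. Qed.

(** The minor of P_0 with diagonal entries (s_0)_ii <= c and Im A_jj / Im z. *)
Let minor i j : nm (A i j) ^+ 2 * Im z <= c * Im (A j j).
Proof.
have := PM_psd_minor i j P0; rewrite Kdiag mulrA ler_pdivlMr // => H.
by apply: le_trans H _; rewrite ler_wpM2r.
Qed.

(** For a value a of the form, P_(-1) gives 0 <= (Re z - alpha) Im a + Im z Re a, and the first
    summand is at most 0. *)
Lemma Re_form_ge0 v : Re z < alpha -> 0 <= Re (bl A v v).
Proof.
move=> za; have /psdP/(_ v) := P1; rewrite Kf_diag blZm => /ge0_complexP[/= + _].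
rewrite pmulr_lge0 ?invr_gt0 // cImM cReB cImB /= subr0 => H.
have H1 : (Re z - alpha) * Im (bl A v v) <= 0.
  by rewrite mulr_le0_ge0 ?Im_form_ge0 // subr_le0 ltW.
have H2 : 0 <= Im z * Re (bl A v v) by move: H H1; lra.
by rewrite pmulr_rge0 in H2.
Qed.

(** On the diagonal [minor] gives |A_jj|^2 Im z <= c Im A_jj <= c |A_jj|, and one factor cancels.
    Put back into [minor], this bounds the other entries of column j. *)
Lemma entry_bound i j : nm (A i j) * Im z <= c.
Proof.
have Dj : nm (A j j) * Im z <= c.
  have [->|n0] := eqVneq (nm (A j j)) 0; first by rewrite mul0r bound_c_ge0.
  have n1 : 0 < nm (A j j) by rewrite lt_def n0 nm_ge0.
  rewrite -(ler_pM2r n1); apply: le_trans (_ : c * Im (A j j) <= _).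
    by apply: le_trans (minor j j); rewrite le_eqVlt; apply/orP; left; apply/eqP; ring.
  by rewrite ler_wpM2l ?bound_c_ge0 // (le_trans (ler_norm _)) // Im_le_nm.
rewrite -(ler_pXn2r (n := 2)) ?nnegrE ?bound_c_ge0 ?mulr_ge0 ?nm_ge0 ?(ltW z0) //.
rewrite exprMn [Im z ^+ 2]expr2 mulrA.
apply: le_trans (_ : c * Im (A j j) * Im z <= _); first by rewrite ler_wpM2r ?(ltW z0).
rewrite -mulrA expr2 ler_wpM2l ?bound_c_ge0 //; apply: le_trans Dj.
by rewrite ler_wpM2r ?(ltW z0) // (le_trans (ler_norm _)) // Im_le_nm.
Qed.

Hypothesis za : Re z < alpha.

Let d0 : 0 < alpha - Re z. Proof. by rewrite subr_gt0. Qed.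

Let Im_Re i : (alpha - Re z) * Im (A i i) <= Im z * nm (A i i).
Proof.
have := P1 => /psdP/(_ (delta_mx i 0)); rewrite Kf_diag blZm bl_delta => /ge0_complexP[/= + _].
rewrite pmulr_lge0 ?invr_gt0 // cImM cReB cImB /= subr0 => H.
have : Im z * Re (A i i) <= Im z * nm (A i i).
  by rewrite ler_wpM2l ?(ltW z0) // (le_trans (ler_norm _)) // Re_le_nm.
by move: H; lra.
Qed.

(** In [minor] at (i, i), multiplied by alpha - Re z, the factor (alpha - Re z) Im A_ii is at most
    Im z |A_ii| by P_(-1); then Im z |A_ii| cancels. *)
Let diag_bound i : nm (A i i) * (alpha - Re z) <= c.
Proof.
have [->|n0] := eqVneq (nm (A i i)) 0; first by rewrite mul0r bound_c_ge0.
have n1 : 0 < nm (A i i) by rewrite lt_def n0 nm_ge0.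
rewrite -(ler_pM2r n1) -(ler_pM2r z0).
have -> : nm (A i i) * (alpha - Re z) * nm (A i i) * Im z =
  nm (A i i) ^+ 2 * Im z * (alpha - Re z) by ring.
apply: le_trans (ler_wpM2r (ltW d0) (minor i i)) _.
rewrite -!mulrA ler_wpM2l ?bound_c_ge0 //.
by have := Im_Re i; rewrite mulrC [nm _ * _]mulrC.
Qed.

Let Im_bound i : Im (A i i) * (alpha - Re z) ^+ 2 <= c * Im z.
Proof.
have -> : Im (A i i) * (alpha - Re z) ^+ 2 = (alpha - Re z) * Im (A i i) * (alpha - Re z) by ring.
apply: le_trans (ler_wpM2r (ltW d0) (Im_Re i)) _.
by rewrite -mulrA mulrC ler_wpM2r ?(ltW z0).
Qed.

Lemma entry_left_bound i j : nm (A i j) * (alpha - Re z) <= c.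
Proof.
rewrite -(ler_pXn2r (n := 2)) ?nnegrE ?bound_c_ge0 ?mulr_ge0 ?nm_ge0 ?(ltW d0) //.
rewrite exprMn -(ler_pM2r z0).
have -> : nm (A i j) ^+ 2 * (alpha - Re z) ^+ 2 * Im z =
  nm (A i j) ^+ 2 * Im z * (alpha - Re z) ^+ 2 by ring.
have d2 : 0 <= (alpha - Re z) ^+ 2 by rewrite exprn_ge0 // ltW.
apply: le_trans (ler_wpM2r d2 (minor i j)) _.
by rewrite expr2 -!mulrA ler_wpM2l ?bound_c_ge0 // expr2 -expr2 Im_bound.
Qed.

(** The jump is (z - conj z) K, where |z - conj z| = 2 Im z. The minors of K >= 0 bound its entries
    by the diagonal ones, Im A_kk / Im z <= c / (alpha - Re z)^2. *)
Lemma entry_jump_bound i j : nm (A i j - conjc (A j i)) * (alpha - Re z) ^+ 2 <= 2 * c * Im z.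
Proof.
have z1 : Im z != 0 by rewrite gt_eqF.
have d2 : 0 <= (alpha - Re z) ^+ 2 by rewrite exprn_ge0 // ltW.
have -> : A i j - conjc (A j i) = (z - conjc z) * Kf z A i j.
  by have /matrixP/(_ i j) := Kf_eq A z1; rewrite !mxE.
have -> : nm ((z - conjc z) * Kf z A i j) = 2 * Im z * nm (Kf z A i j).
  rewrite nmM; congr (_ * _).
  have -> : z - conjc z = Complex 0 1 * rC (2 * Im z).
    by case: (z) => a b; apply: complex_eq; rewrite /=; ring.
  by rewrite nmM nm_i mul1r nm_rC ger0_norm // mulr_ge0 // ltW.
have zz : 0 < 2 * Im z by rewrite mulr_gt0.
have -> : 2 * c * Im z = 2 * Im z * c by ring.
rewrite -[X in X <= _]mulrA ler_pM2l //.
rewrite -(ler_pXn2r (n := 2)) ?nnegrE ?bound_c_ge0 ?mulr_ge0 ?nm_ge0 ?(ltW d0) //.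
have := psd_minor i j (PM_psd_corner P0); rewrite !Kdiag => H.
have T k : 0 <= Im (A k k) * (alpha - Re z) ^+ 2 / Im z /\
    Im (A k k) * (alpha - Re z) ^+ 2 / Im z <= c.
  split; last by rewrite ler_pdivrMr // Im_bound.
  by rewrite divr_ge0 ?(ltW z0) // mulr_ge0.
have [Ti0 Tic] := T i; have [Tj0 Tjc] := T j.
rewrite exprMn; apply: le_trans (ler_wpM2r (exprn_ge0 2 d2) H) _.
rewrite [X in X <= _](_ : _ = (Im (A i i) * (alpha - Re z) ^+ 2 / Im z) *
  (Im (A j j) * (alpha - Re z) ^+ 2 / Im z)); last by field.
by rewrite [c ^+ 2]expr2; exact: ler_pM.
Qed.

End Bounds.

End PkProperties.

(** * The extension *)

Section MatrixHolomorphy.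
Variable R : realType.
Local Notation C := R[i].
Variable q : nat.

Lemma derivable_entries (f : C -> 'M[C]_q) z :
  @derivable C C^o 'M[C]_q f z 1 <-> forall i j, holo (fun w => f w i j) z.
Proof.
split=> [/cvg_ex[l fl] i j|fh].
  apply/cvg_ex; exists (l i j); apply/cvg_ballP => e e0.
  move/cvg_ballP: fl => /(_ e e0); apply: filterS => h [_ /(_ i j)].
  by rewrite !mxE.
pose L := \matrix_(i < q, j < q) sval (cid ((cvg_ex _).1 (fh i j))).
apply/cvg_ex; exists L; apply/cvg_ballP => e e0.
have H : \forall h \near (0 : C^o)^', forall i j,
    ball (L i j) e (h^-1 * (f (h *: (1 : C^o) + z) i j - f z i j)).
  apply: filter_forall => i; apply: filter_forall => j.
  rewrite mxE; have := svalP (cid ((cvg_ex _).1 (fh i j))).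
  by move/cvg_ballP => /(_ e e0).
apply: filterS H => h H; split => // i j; have := H i j.
by rewrite !mxE.
Qed.

(** The matrix norm is the largest modulus of an entry and is attained when nonzero. *)
Lemma mx_norm_le (M : 'M[C]_q) (b : R) : 0 <= b ->
  (forall i j, nm (M i j) <= b) -> `|M| <= rC b.
Proof.
move=> b0 Mb; have NE : `|M| = mx_norm M by [].
rewrite NE; have [e|/mx_norm_neq0[ij e]] := eqVneq (mx_norm M) 0; rewrite e.
  by rewrite -[0]/(rC 0) le_rC.
by rewrite normE le_rC.
Qed.

End MatrixHolomorphy.

(** * Existence, uniqueness and membership in the class *)

Section MainProof.
Variable R : realType.
Local Notation C := R[i].
Variables (q : nat) (alpha : R) (s : nat -> 'M[C]_q) (m : nat).
Variables (D : set C) (F : C -> 'M[C]_q).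
Hypothesis hD : discrete_in_Piplus D.
Hypothesis hF : holomorphic_on (@Piplus R `\` D) F.
Hypothesis hP : forall z, (@Piplus R `\` D) z ->
  Pk_psd s alpha F (m%:Z) z /\ Pk_psd s alpha F (m%:Z - 1) z.

Let c := \sum_i Re (s 0%N i i).

Lemma Piplus_Im (z : C) : Piplus z -> 0 < Im z.
Proof. by []. Qed.

Let F_all z : Piplus z -> ~ D z -> forall k : int, -1 <= k <= m%:Z -> Pk_psd s alpha F k z.
Proof. by move=> zP zD; have [h1 h2] := hP (conj zP zD); exact: Pk_down. Qed.

Lemma Pk_psd0 (f : C -> 'M[C]_q) z :
  (forall k : int, -1 <= k <= m%:Z -> Pk_psd s alpha f k z) ->
  psd (PM s 0 z (f z) (Kf z (f z))) /\ psd (Kf z ((z - rC alpha) *: f z)).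
Proof.
move=> H; split; last exact: (iffLR (Pk_N1 s alpha f z) (H (-1) isT)).
exact: (iffLR (Pk_even s alpha f 0 z) (H 0 isT)).
Qed.

Let hFe i j z : Piplus z -> ~ D z -> holo (fun w => F w i j) z.
Proof. by move=> zP zD; exact: (iffLR (derivable_entries F z) (hF (conj zP zD)) i j). Qed.

Lemma extend_upper : exists U : C -> 'M[C]_q,
  [/\ forall z, Piplus z -> ~ D z -> U z = F z,
      forall z i j, Piplus z -> holo (fun w => U w i j) z &
      forall z k, Piplus z -> -1 <= k <= m%:Z -> Pk_psd s alpha U k z].
Proof.
have E (ij : 'I_q * 'I_q) : exists S : C -> C, forall w, Piplus w ->
    holo S w /\ (~ D w -> S w = F w ij.1 ij.2).
  apply: (@ext_isolated R D (fun w => F w ij.1 ij.2) c hD); first exact: hFe.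
  move=> z zP zD; have [P0 P1] := Pk_psd0 (F_all zP zD).
  exact: (entry_bound zP P0).
have [T TP] := choice E; pose U w := \matrix_(i < q, j < q) T (i, j) w.
have UE i j : (fun w => U w i j) = T (i, j) by apply/funext => w; rewrite mxE.
have UF z : Piplus z -> ~ D z -> U z = F z.
  move=> zP zD; apply/matrixP => i j; rewrite mxE.
  by have [_ ->] := TP (i, j) z zP.
have Uh z i j : Piplus z -> holo (fun w => U w i j) z.
  by move=> zP; rewrite UE; have [] := TP (i, j) z zP.
exists U; split => // z k zP /andP[k1 km].
(* At points of [D] the inequality is a limit of inequalities at nearby points outside [D]. *)
apply: Pk_limit => //.
- by rewrite gt_eqF.
- by move=> i j; exact: (holo_cont (Uh z i j zP)).
- move=> e e0; have [|w [wz wD]] := discrete_dense hD zP (e := Num.min e (Im z)).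
    by rewrite lt_min e0.
  move: wz; rewrite lt_min => /andP[we wz].
  have wP : Piplus w.
    rewrite /Piplus /=; have := le_lt_trans (Im_le_nm _) wz.
    by rewrite cImB ltr_norml => /andP[+ _]; lra.
  exists w; split => //; apply: (Pk_eq (f := F)); first by rewrite UF.
  by apply: F_all => //; rewrite k1.
Qed.

Lemma slit_Piplus (z : C) : Piplus z -> slit alpha z.
Proof. by move=> zP [z0 _]; move: (Piplus_Im zP); rewrite z0 ltxx. Qed.

Lemma slit_left (x : R) : x < alpha -> slit alpha (rC x).
Proof. by move=> xa [_ /=]; rewrite leNgt xa. Qed.

Lemma extend_slit : exists S : C -> 'M[C]_q,
  [/\ forall z, Piplus z -> ~ D z -> S z = F z,
      forall z i j, slit alpha z -> holo (fun w => S w i j) z,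
      forall z k, Piplus z -> -1 <= k <= m%:Z -> Pk_psd s alpha S k z &
      forall z, Im z != 0 -> S (conjc z) = adjmx (S z)].
Proof.
have [U [UF Uh UP]] := extend_upper.
have U0 z : Piplus z -> psd (PM s 0 z (U z) (Kf z (U z))) /\
    psd (Kf z ((z - rC alpha) *: U z)).
  by move=> zP; apply: Pk_psd0 => k; exact: UP.
have c0 : 0 <= c.
  have iP : Piplus (Complex 0 1 : C) by rewrite /Piplus /=.
  by have [P0 _] := U0 _ iP; exact: bound_c_ge0 P0.
have E (ij : 'I_q * 'I_q) : exists S : C -> C, [/\ forall w, slit alpha w -> holo S w,
    forall w, 0 < Im w -> S w = U w ij.1 ij.2 &
    forall w, Im w < 0 -> S w = conjc (U (conjc w) ij.2 ij.1)].
  case: ij => i j /=.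
  (* The function below the axis is the (i, j) entry of the adjoint of U(conj z); 2 c is the
     constant of [entry_jump_bound]. *)
  apply: (@ext_reflect R alpha c (2 * c) (fun w => U w i j) (fun w => conjc (U (conjc w) j i))) => //.
  - by rewrite mulr_ge0.
  - by move=> z z0; exact: Uh.
  - move=> z z0; apply: (@holo_conj R (fun w => U w j i)); apply: Uh.
    by rewrite /Piplus /= cImJ oppr_gt0.
  - move=> z z0 za; have [P0 P1] := U0 z z0; exact: entry_left_bound.
  - move=> z z0 za; have zP : Piplus (conjc z) by rewrite /Piplus /= cImJ oppr_gt0.
    have [P0 P1] := U0 _ zP; rewrite nm_conj -[Re z]cReJ.
    by apply: entry_left_bound => //; rewrite cReJ.
  - move=> x y xa y0; have zP : Piplus (Complex x y : C) by [].
    have [P0 P1] := U0 _ zP; rewrite /= opprK.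
    exact: (entry_jump_bound zP P0 P1 xa i j).
have [T TP] := choice E; pose S w := \matrix_(i < q, j < q) T (i, j) w.
have SE i j : (fun w => S w i j) = T (i, j) by apply/funext => w; rewrite mxE.
have SU z : Piplus z -> S z = U z.
  move=> zP; apply/matrixP => i j; rewrite mxE.
  by have [_ -> //] := TP (i, j).
have SL z : Im z < 0 -> S z = adjmx (U (conjc z)).
  move=> z0; apply/matrixP => i j; rewrite adjmxE mxE.
  by have [_ _ -> //] := TP (i, j).
exists S; split.
- by move=> z zP zD; rewrite SU // UF.
- by move=> z i j zs; rewrite SE; have [h _ _] := TP (i, j); exact: h.
- by move=> z k zP km; apply: (Pk_eq (f := U)); [rewrite SU|exact: UP].
- move=> z; rewrite neq_lt => /orP[z0|z0].
    have zP : Piplus (conjc z) by rewrite /Piplus /= cImJ oppr_gt0.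
    by rewrite (SU _ zP) (SL _ z0) adjmxK.
  by rewrite SL ?cImJ ?oppr_lt0 // conjcK SU.
Qed.

(** Continuity carries the agreement across [D] to all of [Piplus], and [slit_vanish] carries it to
    the slit plane. *)
Lemma S0class_unique (S S' : C -> 'M[C]_q) :
  (forall z i j, slit alpha z -> holo (fun w => S w i j) z) ->
  (forall z i j, slit alpha z -> holo (fun w => S' w i j) z) ->
  (forall z, Piplus z -> ~ D z -> S z = S' z) ->
  forall z, slit alpha z -> S' z = S z.
Proof.
move=> hS hS' e z zs; apply/matrixP => i j; apply/eqP; rewrite -subr_eq0; apply/eqP.
apply: (@slit_vanish R alpha (fun w => S' w i j - S w i j)) zs.
  by move=> w ws; exact: (holoB (hS' w i j ws) (hS w i j ws)).
move=> w w0; have wP : Piplus w by [].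
have ws := slit_Piplus wP; apply/eqP; rewrite subr_eq0; apply/eqP.
apply: (@ccont_eq R (fun w => S' w i j) (fun w => S w i j) D w (Im w) w0
   (holo_cont (hS' w i j ws)) (holo_cont (hS w i j ws)) (discrete_dense hD wP)).
move=> p pw pD; rewrite e //.
rewrite /Piplus /=; have := le_lt_trans (Im_le_nm _) pw.
by rewrite cImB ltr_norml => /andP[+ _]; lra.
Qed.

Lemma S0class_extension (S : C -> 'M[C]_q) :
  (forall z i j, slit alpha z -> holo (fun w => S w i j) z) ->
  (forall z k, Piplus z -> -1 <= k <= m%:Z -> Pk_psd s alpha S k z) ->
  (forall z, Im z != 0 -> S (conjc z) = adjmx (S z)) -> S0class alpha S.
Proof.
move=> Sh SP SJ.
have S0 z : Piplus z -> psd (PM s 0 z (S z) (Kf z (S z))) /\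
    psd (Kf z ((z - rC alpha) *: S z)).
  by move=> zP; apply: Pk_psd0 => k; exact: SP.
have c0 : 0 <= c.
  have iP : Piplus (Complex 0 1 : C) by rewrite /Piplus /=.
  by have [P0 _] := S0 _ iP; exact: bound_c_ge0 P0.
split.
- by move=> z zs; apply/derivable_entries => i j; exact: Sh.
- move=> z zP; have [P0 _] := S0 z zP; apply/psdP => v.
  have := Im_form_ge0 zP P0 v; rewrite /ImM blZm blBm bl_adj.
  case: (bl (S z) v v) => a b /= b0.
  have -> : (2 * Complex 0 1)^-1 * (Complex a b - Complex a (- b)) = rC b :> C.
    have -> : Complex a b - Complex a (- b) = 2 * Complex 0 1 * rC b :> C.
      by apply: complex_eq; rewrite /=; ring.
    rewrite mulrA mulVf ?mul1r //.
    by apply/eqP => /(congr1 (@complex.Im R)) /=; lra.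
  by rewrite -[0]/(rC 0) le_rC.
- move=> x xa; have xs := slit_left xa.
  have Sc i j := holo_cont (Sh (rC x) i j xs).
  have conjx : conjc (rC x) = rC x :> C by rewrite /rC /= oppr0.
  (* The symmetry under conjugation holds off the real axis and passes to the limit at x. *)
  have herm : adjmx (S (rC x)) = S (rC x).
    apply/matrixP => i j; rewrite adjmxE.
    have h1 : ccont (fun z => conjc (S (conjc z) j i)) (rC x).
      apply: holo_cont; apply: (@holo_conj R (fun w => S w j i)).
      by rewrite conjx; exact: Sh.
    have := @ccont_eq R _ _ [set w | Im w = 0] (rC x) 1 ltr01 h1 (Sc i j) (@line_dense R (rC x)).
    rewrite conjx; apply => z _ z0; rewrite SJ ?adjmxE ?conjcK //.
    exact/eqP.
  apply/psdP => v.
  have fc : ccont (fun z => bl (S z) v v) (rC x) by apply: ccont_bl.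
  apply: (ccont_ge0 fc) => e e0.
  have [d d0 dP] := iffLR (contCP _ _) fc e e0.
  (* x is approached from above: [Re_form_ge0] controls the real part, and the imaginary part is
     small because the form of the Hermitian matrix S(x) is real. *)
  have [y y0 [yd ye]] : exists2 y : R, 0 < y & y < d /\ y < e.
    exists (Num.min d e / 2); first by rewrite divr_gt0 // lt_min d0.
    have m1 : Num.min d e <= d by rewrite ge_min lexx.
    have m2 : Num.min d e <= e by rewrite ge_min lexx orbT.
    by split; lra.
  pose z := Complex x y : C; have zP : Piplus z by [].
  have zx : nm (z - rC x) = y.
    have -> : z - rC x = Complex 0 1 * rC y by apply: complex_eq; rewrite /=; ring.
    by rewrite nmM nm_i mul1r nm_rC gtr0_norm.
  exists z; rewrite zx; split => //; have [P0 P1] := S0 z zP; split.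
    have h := Re_form_ge0 zP P0 P1 v xa.
    have -> : - rC e = rC (- e) :> C by apply: complex_eq; rewrite /= ?oppr0.
    by rewrite le_rC (le_trans _ h) // oppr_le0 ltW.
  have := dP z; rewrite zx => /(_ yd); apply: le_trans.
  have Im0 : Im (bl (S (rC x)) v v) = 0.
    have := bl_adj (S (rC x)) v v; rewrite herm => /(congr1 (@complex.Im R)).
    by rewrite cImJ; lra.
  by apply: le_trans (Im_le_nm _); rewrite cImB Im0 subr0.
(* At z = iy, where Im z = y, [entry_bound] is already the growth condition, with constant c. *)
- exists c => y y1; have y0 : 0 < y by apply: lt_le_trans y1.
  have zP : Piplus (Complex 0 y : C) by [].
  have [P0 _] := S0 _ zP.
  have H : `|S (Complex 0 y)| <= rC (c / y).
    apply: mx_norm_le => [|i j]; first by rewrite divr_ge0 // ltW.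
    by rewrite ler_pdivlMr //; exact: (entry_bound zP P0).
  have y0' : 0 <= rC y :> C by rewrite -[0]/(rC 0) le_rC ltW.
  apply: le_trans (ler_wpM2l y0' H) _.
  have -> : rC y * rC (c / y) = rC c :> C.
    by apply: complex_eq; rewrite /= ?mulr0 ?mul0r ?subr0 ?addr0 // mulrC divfK // gt_eqF.
  exact: lexx.
Qed.

End MainProof.

Theorem theorem6p5 (R : realType) (q : nat) (hq : (0 < q)%N) (alpha : R)
  (kappa : option nat) (s : nat -> 'M[R[i]]_q) (m : nat) (hm : le_kappa m kappa)
  (D : set R[i]) (hD : discrete_in_Piplus D) (F : R[i] -> 'M[R[i]]_q)
  (hF : holomorphic_on (@Piplus R `\` D) F)
  (hP : forall z, (@Piplus R `\` D) z ->
          Pk_psd s alpha F (m%:Z) z /\ Pk_psd s alpha F (m%:Z - 1) z) :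
  exists S : R[i] -> 'M[R[i]]_q,
    [/\ S0class alpha S,
        forall z, (@Piplus R `\` D) z -> S z = F z,
        forall S' : R[i] -> 'M[R[i]]_q, S0class alpha S' ->
          (forall z, (@Piplus R `\` D) z -> S' z = F z) ->
          forall z, slit alpha z -> S' z = S z &
        forall k : int, -1 <= k <= m%:Z ->
          forall z, complex.Im z != 0 -> Pk_psd s alpha S k z].
Proof.
have [S [SF Sh SP SJ]] := extend_slit hD hF hP.
exists S; split.
- exact: S0class_extension Sh SP SJ.
- by move=> z [zP zD]; exact: SF.
- move=> S' [S'h _ _ _] S'F; apply: (S0class_unique hD Sh).
    by move=> z i j zs; exact: (iffLR (derivable_entries S' z) (S'h z zs) i j).
  by move=> z zP zD; rewrite SF // S'F.
- move=> k km z z0; have k1 : -1 <= k by case/andP: km.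
  move: z0; rewrite neq_lt => /orP[z0|z0]; last exact: SP.
  have zP : Piplus (conjc z) by rewrite /Piplus /= cImJ oppr_gt0.
  (* The inequality is transported from conj z in the upper half-plane; P_0 there also shows that
     s_0 is Hermitian. *)
  rewrite -[z]conjcK; apply: Pk_conj => //.
  + by rewrite cImJ oppr_eq0 lt_eqF.
  + have [P0 _] := Pk_psd0 (fun k => SP (conjc z) k zP).
    by have [h _] := PM_psd_s0 P0.
  + by apply: SJ; rewrite cImJ oppr_eq0 lt_eqF.
  + exact: SP.
Qed.
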